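(* Let $\Gamma=\langle v_0,v_1,\ldots,v_g\rangle$ be the semigroup of values of a plane branch and let $\varphi\in\Sigma_\Gamma$. Then either $\varphi\sim_{\mathcal A}(t^{v_0},t^{v_1})$, or $\Lambda_\varphi\setminus\Gamma\neq\emptyset$ and $\varphi$ is $\mathcal A$-equivalent to a parametrization of the form $$\Big(t^{v_0},\ t^{v_1}+t^{\lambda}+\sum_{i>\lambda,\ i+v_0\notin\Lambda}a_it^i\Big),\qquad (\ast)$$ where $\lambda$ is the Zariski invariant of $\varphi$ and $\Lambda=\Lambda_\varphi$ (the sum is finite). Moreover, if $\varphi$ and $\varphi'$ are two parametrizations of the form $(\ast)$ (with coefficients $a_i$, resp. $a_i'$) having the same semigroup of values $\Gamma$ and the same set of values of differentials $\Lambda$ (hence the same $\lambda$), then $\varphi\sim_{\mathcal A}\varphi'$ if and only if there exists $r\in\mathbb C^*$ with $r^{\lambda-v_1}=1$ and $a_i=r^{\,i-v_1}a_i'$ for all $i$.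
   Context: $\mathcal O_1=\mathbb C\{t\}$ and $\mathcal O_2=\mathbb C\{X,Y\}$ denote the rings of convergent power series, with maximal ideals $\mathcal M_1,\mathcal M_2$. A parametrization is a pair $\varphi(t)=(x(t),y(t))$ with $x,y\in\mathcal M_1$ not both zero; it is primitive if it is not of the form $\psi(t^m)$ with $\psi$ a parametrization and $m\ge 2$. Two parametrizations are $\mathcal A$-equivalent, $\varphi_1\sim_{\mathcal A}\varphi_2$, if $\varphi_2=\sigma\circ\varphi_1\circ\rho^{-1}$ for germs of analytic automorphisms $\sigma$ of $(\mathbb C^2,0)$ and $\rho$ of $(\mathbb C,0)$. For $h\in\mathcal O_2$, $\varphi^*(h)=h(x(t),y(t))$; for a differential $\omega=h\,dX+g\,dY$ ($g,h\in\mathcal O_2$), $\varphi^*(\omega)=\varphi^*(h)x'(t)+\varphi^*(g)y'(t)$. For primitive $\varphi$: $v_\varphi(h)=\mathrm{ord}_t\varphi^*(h)$, $v_\varphi(\omega)=\mathrm{ord}_t\varphi^*(\omega)+1$; the semigroup of values is $\Gamma_\varphi=\{v_\varphi(h):h\in\mathcal O_2,\varphi^*(h)\ne0\}$, with minimal generators $v_0<v_1<\dots<v_g$ and conductor $c$ (least integer with $l\in\Gamma_\varphi$ for all $l\ge c$); the set of values of differentials is $\Lambda_\varphi=\{v_\varphi(\omega):\omega=h\,dX+g\,dY,\ \varphi^*(\omega)\neq0\}$. A Puiseux parametrization is a primitive parametrization $(t^{v_0},\sum_{i\ge v_1}a_it^i)$ with $a_{v_1}=1$, $v_0<v_1$,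 $v_0\nmid v_1$ (then $v_0,v_1$ are the two smallest generators of its semigroup). For a semigroup $\Gamma$ with smallest generators $v_0<v_1$ and conductor $c$, $\Sigma_\Gamma$ is the set of Puiseux parametrizations $(t^{v_0},t^{v_1}+\sum_{v_1<i<c}a_it^i)$ whose semigroup of values is $\Gamma$. If $\Lambda_\varphi\setminus\Gamma_\varphi\ne\emptyset$, the Zariski invariant of $\varphi$ is $\lambda=\min(\Lambda_\varphi\setminus\Gamma_\varphi)-v_0$. *)

(* Defs.v *)
From Stdlib Require Import Reals Arith Lia.
Open Scope R_scope.

Definition Cplx : Type := (R * R)%type.
Definition Czero : Cplx := (0, 0).
Definition Cone : Cplx := (1, 0).
Definition Cadd (z w : Cplx) : Cplx := (fst z + fst w, snd z + snd w).
Definition Cmul (z w : Cplx) : Cplx :=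
  (fst z * fst w - snd z * snd w, fst z * snd w + snd z * fst w).
Definition Cnat (n : nat) : Cplx := (INR n, 0).
Fixpoint Cpow (z : Cplx) (n : nat) : Cplx :=
  match n with O => Cone | S k => Cmul z (Cpow z k) end.
Definition Cnorm (z : Cplx) : R := sqrt (fst z * fst z + snd z * snd z).

Fixpoint Csum (f : nat -> Cplx) (n : nat) : Cplx :=
  match n with O => Czero | S k => Cadd (Csum f k) (f k) end.

Definition ser := nat -> Cplx.
Definition ser2 := nat -> nat -> Cplx.

(** convergence (= geometric bound on the coefficients, Cauchy estimates) *)
Definition conv1 (s : ser) : Prop :=
  exists M K : R, forall n, Cnorm (s n) <= M * K ^ n.
Definition conv2 (h : ser2) : Prop :=
  exists M K : R, forall i j, Cnorm (h i j) <= M * K ^ (i + j).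

Definition mono (k : nat) : ser := fun n => if Nat.eqb n k then Cone else Czero.

Definition smul (f g : ser) : ser :=
  fun n => Csum (fun k => Cmul (f k) (g (n - k)%nat)) (S n).
Fixpoint spow (f : ser) (i : nat) : ser :=
  match i with O => mono 0 | S k => smul f (spow f k) end.
(** f o r, for r with r 0 = 0 *)
Definition comp1 (f r : ser) : ser :=
  fun n => Csum (fun i => Cmul (f i) (spow r i n)) (S n).

Definition smul2 (f g : ser2) : ser2 :=
  fun a b => Csum (fun i => Csum (fun j =>
       Cmul (f i j) (g (a - i)%nat (b - j)%nat)) (S b)) (S a).
Definition mono2 (k l : nat) : ser2 :=
  fun a b => if andb (Nat.eqb a k) (Nat.eqb b l) then Cone else Czero.
Fixpoint spow2 (f : ser2) (i : nat) : ser2 :=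
  match i with O => mono2 0 0 | S k => smul2 f (spow2 f k) end.
(** h(u, v), for u, v in the maximal ideal of C{X,Y} *)
Definition comp2 (h u v : ser2) : ser2 :=
  fun a b => Csum (fun i => Csum (fun j =>
       Cmul (h i j) (smul2 (spow2 u i) (spow2 v j) a b)) (S (a + b))) (S (a + b)).
(** pull-back phi^*(h) = h(x(t), y(t)), for x, y in M_1 *)
Definition pull (h : ser2) (x y : ser) : ser :=
  fun n => Csum (fun i => Csum (fun j =>
       Cmul (h i j) (smul (spow x i) (spow y j) n)) (S n)) (S n).
Definition deriv (s : ser) : ser := fun n => Cmul (Cnat (S n)) (s (S n)).

Definition param_t := (ser * ser)%type.

Definition is_param (phi : param_t) : Prop :=
  fst phi 0%nat = Czero /\ snd phi 0%nat = Czero /\ conv1 (fst phi) /\ conv1 (snd phi) /\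
  exists n, fst phi n <> Czero \/ snd phi n <> Czero.

Definition subst_pow (s : ser) (m : nat) : ser :=
  fun n => if Nat.eqb (n mod m) 0 then s (n / m)%nat else Czero.

Definition primitive (phi : param_t) : Prop :=
  is_param phi /\
  ~ exists (psi : param_t) (m : nat), is_param psi /\ (2 <= m)%nat /\
      (forall n, fst phi n = subst_pow (fst psi) m n) /\
      (forall n, snd phi n = subst_pow (snd psi) m n).

(** germs of analytic automorphisms of (C,0) and (C^2,0): convergent germs
    with a convergent two-sided compositional inverse *)
Definition aut1 (rho rhoi : ser) : Prop :=
  conv1 rho /\ conv1 rhoi /\ rho 0%nat = Czero /\ rhoi 0%nat = Czero /\
  (forall n, comp1 rho rhoi n = mono 1 n) /\ (forall n, comp1 rhoi rho n = mono 1 n).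

Definition aut2 (s1 s2 : ser2) : Prop :=
  conv2 s1 /\ conv2 s2 /\ s1 0%nat 0%nat = Czero /\ s2 0%nat 0%nat = Czero /\
  exists t1 t2 : ser2,
    conv2 t1 /\ conv2 t2 /\ t1 0%nat 0%nat = Czero /\ t2 0%nat 0%nat = Czero /\
    (forall a b, comp2 s1 t1 t2 a b = mono2 1 0 a b) /\
    (forall a b, comp2 s2 t1 t2 a b = mono2 0 1 a b) /\
    (forall a b, comp2 t1 s1 s2 a b = mono2 1 0 a b) /\
    (forall a b, comp2 t2 s1 s2 a b = mono2 0 1 a b).

Definition A_equiv (phi1 phi2 : param_t) : Prop :=
  exists (s1 s2 : ser2) (rho rhoi : ser), aut2 s1 s2 /\ aut1 rho rhoi /\
    (forall n, fst phi2 n =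
       pull s1 (comp1 (fst phi1) rhoi) (comp1 (snd phi1) rhoi) n) /\
    (forall n, snd phi2 n =
       pull s2 (comp1 (fst phi1) rhoi) (comp1 (snd phi1) rhoi) n).

Definition is_ord (s : ser) (n : nat) : Prop :=
  s n <> Czero /\ forall k, (k < n)%nat -> s k = Czero.

Definition in_Gamma (phi : param_t) (v : nat) : Prop :=
  exists h : ser2, conv2 h /\ is_ord (pull h (fst phi) (snd phi)) v.

Definition in_Lambda (phi : param_t) (v : nat) : Prop :=
  exists h g : ser2, conv2 h /\ conv2 g /\
    exists o, is_ord (fun n => Cadd (smul (pull h (fst phi) (snd phi)) (deriv (fst phi)) n)
                                   (smul (pull g (fst phi) (snd phi)) (deriv (snd phi)) n)) o
              /\ v = S o.

Definition has_semigroup (phi : param_t) (Gamma : nat -> Prop) : Prop :=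
  primitive phi /\ forall v, Gamma v <-> in_Gamma phi v.

Definition branch_semigroup (Gamma : nat -> Prop) : Prop :=
  exists psi, has_semigroup psi Gamma.

(** v0 = first minimal generator, v1 = second minimal generator, c = conductor *)
Definition is_v0 (Gamma : nat -> Prop) (v0 : nat) : Prop :=
  Gamma v0 /\ (0 < v0)%nat /\ forall v, Gamma v -> (0 < v)%nat -> (v0 <= v)%nat.
Definition is_v1 (Gamma : nat -> Prop) (v0 v1 : nat) : Prop :=
  Gamma v1 /\ (v1 mod v0 <> 0)%nat /\
  forall v, Gamma v -> (v mod v0 <> 0)%nat -> (v1 <= v)%nat.
Definition is_conductor (Gamma : nat -> Prop) (c : nat) : Prop :=
  (forall l, (c <= l)%nat -> Gamma l) /\
  forall c', (forall l, (c' <= l)%nat -> Gamma l) -> (c <= c')%nat.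

Definition in_Sigma (Gamma : nat -> Prop) (v0 v1 c : nat) (phi : param_t) : Prop :=
  has_semigroup phi Gamma /\
  exists a : ser, (forall n, fst phi n = mono v0 n) /\
    (forall n, snd phi n =
       if Nat.eqb n v1 then Cone
       else if andb (Nat.ltb v1 n) (Nat.ltb n c) then a n else Czero).

Definition is_zariski (phi : param_t) (v0 lam : nat) : Prop :=
  exists m, in_Lambda phi m /\ ~ in_Gamma phi m /\
    (forall m', in_Lambda phi m' -> ~ in_Gamma phi m' -> (m <= m')%nat) /\
    (lam + v0 = m)%nat.

Definition is_normal_form (v0 v1 lam : nat) (Lam : nat -> Prop) (a : ser)
    (phi : param_t) : Prop :=
  (forall n, fst phi n = mono v0 n) /\
  (forall n, (lam < n)%nat /\ ~ Lam (n + v0)%nat ->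
       snd phi n = Cadd (Cadd (mono v1 n) (mono lam n)) (a n)) /\
  (forall n, ~ ((lam < n)%nat /\ ~ Lam (n + v0)%nat) ->
       snd phi n = Cadd (mono v1 n) (mono lam n)).

(* Main.v *)
(** Elements of O_1 and O_2 are filtered by the order in t and by the weights v0 of X and
    v1 of Y; a parametrization with leading terms (t^v0, t^v1) is then a filtered algebra
    morphism, and an equivalence is a pair of filtered automorphisms.

    Reduction.  If i + v0 is the value of a differential g2 dX - g1 dY with g1, g2 of weights
    larger than v0, v1, then composing with the flows of g1 d/dX + g2 d/dY and of a suitable
    vector field in t removes the coefficient of t^i and changes only higher terms.  Every
    1-form is dh + k (v1 Y dX - v0 X dY); the second form has value lambda + v0 at the first
    obstruction t^lambda, so lambda is the Zariski invariant, and beyond lambda every element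
    of Lambda is the value of a form of the required weights.  This gives the normal form to
    any finite order.  Finite determinacy makes it convergent: Lagrange interpolation over the
    conjugates y(zeta^l t) shows that a convergent series of large order in t is h(x, y) with
    h convergent, and a convergent automorphism has a convergent inverse.

    Uniqueness.  The leading terms of an equivalence between normal forms are (r^v0 X, r^v1 Y)
    and r t.  After this homothety the equivalence is unipotent, so it has a logarithm, a
    vector field, which shows that the first index i where the two normal forms differ
    satisfies i + v0 in Lambda.  This excludes i > lambda, and i = lambda would put
    lambda + v0 into Gamma. *)

Require Import Defs.
From Stdlib Require Import Reals Arith.

Module PlaneBranches.
From HB Require Import structures.
From mathcomp Require Import all_boot all_order all_algebra cyclic separable cyclotomic.
From mathcomp Require Import boolp complex Rstruct ring zify.
Set Implicit Arguments. Unset Strict Implicit. Unset Printing Implicit Defensive.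
Import Order.TTheory GRing.Theory Num.Theory.
Local Open Scope ring_scope.

(** * Formal power series and complete filtered algebras *)

(** Normal forms are treated for formal series over a field of characteristic zero. A
    parametrization is a morphism [phi] from F[[X, Y]] to F[[t]], an equivalence is an identity
    [phi \o S = R \o psi], and an estimate in the filtration need only be checked on X, Y or t.

    Two obstacles shape the proof. Convergence of the infinite composition of flows that normalizes
    [phi] is not clear. So only finitely many steps are taken, the two automorphisms are truncated
    to polynomials, and the error, convergent and of large order in t, is absorbed into the
    coordinate change of the plane. Conversely, a given analytic equivalence fixes the origin but is
    not known to respect the weights v0 and v1. It does because v0 does not divide v1: monomials of
    weight at most v0 + v1 have distinct weights, so up to that bound the order of a pull-back
    reveals the weight.

    The value of a function or a differential depends on finitely many coefficients, so formal and
    convergent series yield the same Gamma and Lambda, and uniqueness needs no convergence. *)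

Record fps (R : Type) := Fps { coefs :> nat -> R }.

Lemma fpsP (R : Type) (f g : fps R) : f =1 g -> f = g.
Proof. by case: f g => [f] [g] /= /funext ->. Qed.

HB.instance Definition _ (R : Type) := gen_eqMixin (fps R).
HB.instance Definition _ (R : Type) := gen_choiceMixin (fps R).

HB.lock Definition fps_mul (R : comNzRingType) (f g : fps R) : fps R :=
  Fps (fun n => \sum_(i < n.+1) f i * g (n - i)%N).
Arguments fps_mul {R}.

Section FpsRing.
Variable R : comNzRingType.
Implicit Types f g h : fps R.

Definition fps_zero : fps R := Fps (fun=> 0).
Definition fps_add f g : fps R := Fps (fun n => f n + g n).
Definition fps_opp f : fps R := Fps (fun n => - f n).

Fact fps_addA : associative fps_add.
Proof. by move=> f g h; apply: fpsP => n /=; rewrite addrA. Qed.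
Fact fps_addC : commutative fps_add.
Proof. by move=> f g; apply: fpsP => n /=; rewrite addrC. Qed.
Fact fps_add0 : left_id fps_zero fps_add.
Proof. by move=> f; apply: fpsP => n /=; rewrite add0r. Qed.
Fact fps_addN : left_inverse fps_zero fps_opp fps_add.
Proof. by move=> f; apply: fpsP => n /=; rewrite addNr. Qed.
HB.instance Definition _ := GRing.isZmodule.Build (fps R)
  fps_addA fps_addC fps_add0 fps_addN.

Lemma fps_mulE f g n : fps_mul f g n = \sum_(i < n.+1) f i * g (n - i)%N.
Proof. by rewrite fps_mul.unlock. Qed.
Definition fps_cst (c : R) : fps R := Fps (fun n => if n is 0 then c else 0).

Definition trunc N f : {poly R} := \poly_(i < N) f i.

Lemma coef_trunc N f i : (trunc N f)`_i = if (i < N)%N then f i else 0.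
Proof. exact: coef_poly. Qed.

(** The coefficient of index n sees only truncations at any N > n, so the ring laws of series are
    those of [{poly R}]. *)
Lemma fps_mul_trunc N f g n : (n < N)%N ->
  fps_mul f g n = (trunc N f * trunc N g)`_n.
Proof.
move=> ltnN; rewrite coefM fps_mulE; apply: eq_bigr => i _.
by rewrite !coef_trunc !(leq_ltn_trans _ ltnN) // ?leq_subr // -ltnS.
Qed.

Fact fps_mulA : associative (@fps_mul R).
Proof.
move=> f g h; apply: fpsP => n.
transitivity ((trunc n.+1 f * trunc n.+1 g * trunc n.+1 h)`_n).
  rewrite -mulrA coefM fps_mulE; apply: eq_bigr => i _.
  by rewrite coef_trunc ltn_ord (@fps_mul_trunc n.+1) // ltnS leq_subr.
rewrite coefM fps_mulE; apply: eq_bigr => i _.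
by rewrite (@fps_mul_trunc n.+1) // coef_trunc ltnS leq_subr.
Qed.
Fact fps_mulC : commutative (@fps_mul R).
Proof.
by move=> f g; apply: fpsP => n; rewrite !(@fps_mul_trunc n.+1) // mulrC.
Qed.
Fact fps_mul1 : left_id (fps_cst 1) (@fps_mul R).
Proof.
move=> f; apply: fpsP => n; rewrite fps_mulE big_ord_recl /= mul1r subn0 big1 ?addr0 //.
by move=> i _; rewrite mul0r.
Qed.
Fact fps_mulD : left_distributive (@fps_mul R) fps_add.
Proof.
move=> f g h; apply: fpsP => n; rewrite [RHS]/= !fps_mulE -big_split /=.
by apply: eq_bigr => i _; rewrite mulrDl.
Qed.
Fact fps_one_neq0 : fps_cst 1 != 0.
Proof. by apply/eqP=> /(congr1 (fun f : fps R => f 0%N)) /eqP; rewrite /= oner_eq0. Qed.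
HB.instance Definition _ := GRing.Zmodule_isComNzRing.Build (fps R)
  fps_mulA fps_mulC fps_mul1 fps_mulD fps_one_neq0.

Lemma fpsD f g n : (f + g) n = f n + g n. Proof. by []. Qed.
Lemma fpsN f n : (- f) n = - f n. Proof. by []. Qed.
Lemma fpsB f g n : (f - g) n = f n - g n. Proof. by []. Qed.
Lemma fps0 n : (0 : fps R) n = 0. Proof. by []. Qed.
Lemma fps1 n : (1 : fps R) n = (n == 0)%N%:R. Proof. by case: n. Qed.
Lemma fpsM f g n : (f * g) n = \sum_(i < n.+1) f i * g (n - i)%N.
Proof. exact: fps_mulE. Qed.
Lemma fpsM_trunc N f g n : (n < N)%N -> (f * g) n = (trunc N f * trunc N g)`_n.
Proof. exact: fps_mul_trunc. Qed.
Lemma fps_sum I (r : seq I) (P : pred I) (F : I -> fps R) n :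
  (\sum_(i <- r | P i) F i) n = \sum_(i <- r | P i) F i n.
Proof. by apply: (big_morph (fun f : fps R => f n)). Qed.

Lemma fpsMn f n k : (f *+ k) n = f n *+ k.
Proof. by elim: k => [|k IH]; rewrite ?mulr0n // !mulrSr fpsD IH. Qed.

Lemma fps_natM r f i : (r%:R * f) i = r%:R * f i.
Proof. by rewrite mulr_natl fpsMn mulr_natl. Qed.

Fact fps_cst_zmod : zmod_morphism fps_cst.
Proof. by move=> a b; apply: fpsP => -[|n] /=; rewrite ?subr0. Qed.
Fact fps_cst_mon : monoid_morphism fps_cst.
Proof.
split=> // a b; apply: fpsP => -[|n]; rewrite fpsM; first by rewrite big_ord1.
by rewrite big_ord_recl /= mulr0 big1 ?addr0 // => i _; rewrite mul0r.
Qed.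
HB.instance Definition _ := GRing.isZmodMorphism.Build R (fps R) fps_cst fps_cst_zmod.
HB.instance Definition _ := GRing.isMonoidMorphism.Build R (fps R) fps_cst fps_cst_mon.

Lemma fps_cstE c n : fps_cst c n = c *+ (n == 0)%N. Proof. by case: n. Qed.

Lemma fpsCM c f n : (fps_cst c * f) n = c * f n.
Proof.
rewrite fpsM big_ord_recl /= subn0 big1 ?addr0 // => i _.
by rewrite mul0r.
Qed.

Definition fpsX : fps R := Fps (fun n => (n == 1)%N%:R).

Lemma fpsXM f n : (fpsX * f) n = if n is n'.+1 then f n' else 0.
Proof.
rewrite fpsM; case: n => [|n]; first by rewrite big_ord1 mul0r.
rewrite 2!big_ord_recl /= mul0r add0r mul1r subSS subn0 big1 ?addr0 //.
by move=> i _; rewrite mul0r.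
Qed.

Lemma fpsXnM k f n : (fpsX ^+ k * f) n = if (n < k)%N then 0 else f (n - k)%N.
Proof.
elim: k n => [|k IH] n; first by rewrite mul1r subn0.
by rewrite exprS -mulrA fpsXM; case: n => // n; rewrite IH ltnS subSS.
Qed.

Lemma fpsXn k n : (fpsX ^+ k) n = (n == k)%:R.
Proof.
rewrite -[fpsX ^+ k]mulr1 fpsXnM fps1 subn_eq0.
by case: ltngtP.
Qed.

Lemma fpsX_divide f k : (forall i, (i < k)%N -> f i = 0) ->
  f = fpsX ^+ k * Fps (fun i => f (i + k)%N).
Proof.
move=> f0; apply: fpsP => i; rewrite fpsXnM; case: ltnP => [/f0 //|le_ki] /=.
by rewrite subnK.
Qed.

End FpsRing.
Arguments fpsX {R}.
Arguments fps_cst {R}.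

(** A complete separated multiplicative decreasing filtration of an algebra over [F]. *)
Record filt (F : fieldType) (A : comNzRingType) := Filt {
  sc : {rmorphism F -> A};
  fl :> nat -> A -> Prop;
  fl_all : forall a, fl 0 a;
  fl_dec : forall k a, fl k.+1 a -> fl k a;
  fl_zero : forall k, fl k 0;
  flB : forall k a b, fl k a -> fl k b -> fl k (a - b);
  flM : forall k l a b, fl k a -> fl l b -> fl (k + l)%N (a * b);
  fl_sep : forall a, (forall k, fl k a) -> a = 0;
  fl_sum : forall u : nat -> A, (forall k, fl k (u k)) ->
    exists s, forall N, fl N (s - \sum_(k < N) u k) }.
Arguments sc {F A} W : rename.
Arguments fl_all {F A} W a : rename.
Arguments fl_zero {F A} W k : rename.
Arguments fl_dec {F A} W [k a] : rename.
Arguments flB {F A} W [k a b] : rename.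
Arguments flM {F A} W [k l a b] : rename.
Arguments fl_sep {F A} W [a] : rename.

Section FiltTheory.
Variables (F : fieldType) (A : comNzRingType) (W : filt F A).
Implicit Types (a b : A) (k l : nat).

Lemma flN k a : W k a -> W k (- a).
Proof. by rewrite -sub0r; apply: flB; apply: fl_zero. Qed.
Lemma flD k a b : W k a -> W k b -> W k (a + b).
Proof. by move=> Wa Wb; rewrite -[b]opprK; apply: flB => //; apply: flN. Qed.
Lemma flW k l a : (l <= k)%N -> W k a -> W l a.
Proof.
move/subnK <-; elim: (k - l)%N => // d IH Wa; apply: IH.
by apply: (fl_dec W); rewrite -addSn.
Qed.
Lemma flMl k a b : W k b -> W k (a * b).
Proof. by move=> Wb; have := flM W (fl_all W a) Wb; rewrite add0n. Qed.
Lemma flMr k a b : W k a -> W k (a * b).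
Proof. by rewrite mulrC; apply: flMl. Qed.
Lemma fl_bigsum I (r : seq I) (P : pred I) (G : I -> A) k :
  (forall i, P i -> W k (G i)) -> W k (\sum_(i <- r | P i) G i).
Proof. by move=> WG; apply: big_ind => //; [apply: fl_zero|apply: flD]. Qed.
Lemma flX k a n : W k a -> W (k * n)%N (a ^+ n).
Proof.
move=> Wa; elim: n => [|n IH]; first by rewrite muln0; apply: fl_all.
by rewrite exprS mulnS; apply: flM.
Qed.
Lemma fl_trans k b a c : W k (a - b) -> W k (b - c) -> W k (a - c).
Proof. by move=> h1 h2; have := flD h1 h2; rewrite addrA subrK. Qed.
Lemma fl_sym k a b : W k (a - b) -> W k (b - a).
Proof. by move=> /flN; rewrite opprB. Qed.
Lemma fl_congr k a b : W k (a - b) -> W k b -> W k a.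
Proof. by move=> h1 h2; have := flD h1 h2; rewrite subrK. Qed.
Lemma fl_eq a b : (forall k, W k (a - b)) -> a = b.
Proof. by move/fl_sep => /eqP; rewrite subr_eq0 => /eqP. Qed.

(** Sum of a series with k-th term in [W k], picked by choice and unique by separation. The value 0
    is a default for families without a sum. *)
Definition fsum (u : nat -> A) : A :=
  if pselect (exists s, forall N, W N (s - \sum_(k < N) u k)) is left e
  then projT1 (cid e) else 0.
Lemma fsumP (u : nat -> A) : (forall k, W k (u k)) -> forall N, W N (fsum u - \sum_(k < N) u k).
Proof.
move=> Wu; rewrite /fsum; case: pselect => [e|[]]; last exact: (fl_sum Wu).
by case: (cid e).
Qed.
Lemma fsum_uniq (u : nat -> A) (s : A) : (forall N, W N (s - \sum_(k < N) u k)) -> fsum u = s.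
Proof.
move=> h; rewrite /fsum; case: pselect => [e|[]]; last by exists s.
case: (cid e) => /= s' h'; apply: fl_eq => N.
exact: fl_trans (h' N) (fl_sym (h N)).
Qed.
Lemma fsum_fl (u : nat -> A) k : (forall i, W i (u i)) -> (forall i, W k (u i)) -> W k (fsum u).
Proof.
move=> Wu Wk; apply: (fl_congr (fsumP Wu k)).
by apply: fl_bigsum => i _.
Qed.
Lemma fsum_lead (u : nat -> A) e : (forall i, W i (u i)) -> (forall i, W e (u i.+1)) ->
  W e (fsum u - u 0%N).
Proof.
move=> Wu We; apply: (fl_trans (flW (leqnSn e) (fsumP Wu e.+1))).
rewrite big_ord_recl addrAC subrr add0r.
by apply: fl_bigsum => i _; apply: We.
Qed.

(** Partial sums are values at 1 of truncated polynomials. The product of two of them differs from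
    the partial sum of the Cauchy product by coefficients of index at least N, which lie in
    [W N]. *)
Lemma fsum_mul (f g : fps A) : (forall k, W k (f k)) -> (forall k, W k (g k)) ->
  fsum (f * g) = fsum f * fsum g.
Proof.
move=> Wf Wg; apply: fsum_uniq => N.
have hor (h : fps A) : \sum_(k < N) h k = (trunc N h).[1].
  rewrite (@horner_coef_wide _ N) ?size_poly //.
  by apply: eq_bigr => i _; rewrite coef_trunc ltn_ord expr1n mulr1.
have Wt (h : fps A) k : W k (h k) -> W k (trunc N h)`_k.
  by rewrite coef_trunc; case: ifP => // _ _; apply: fl_zero.
apply: (@fl_trans N ((trunc N f).[1] * (trunc N g).[1])).
  have -> : fsum f * fsum g - (trunc N f).[1] * (trunc N g).[1] =
    (fsum f - (trunc N f).[1]) * fsum g + (trunc N f).[1] * (fsum g - (trunc N g).[1]).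
    by ring.
  by rewrite -!hor; apply: flD; [apply: flMr|apply: flMl]; apply: fsumP.
rewrite hor -hornerM -hornerN -hornerD horner_coef.
apply: fl_bigsum => i _; rewrite expr1n mulr1 coefB coef_trunc.
case: (ltnP i N) => [lt|le]; first by rewrite (fpsM_trunc _ _ lt) subrr; apply: fl_zero.
rewrite subr0 coefM; apply: flW le _; apply: fl_bigsum => j _.
have := flM W (Wt f j (Wf _)) (Wt g (i - j)%N (Wg _)).
by rewrite subnKC // -ltnS.
Qed.

Lemma fsum_add (u v : nat -> A) : (forall k, W k (u k)) -> (forall k, W k (v k)) ->
  fsum (fun k => u k + v k) = fsum u + fsum v.
Proof.
move=> Wu Wv; apply: fsum_uniq => N; rewrite big_split /=.
have := flD (fsumP Wu N) (fsumP Wv N).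
by congr (W N _); ring.
Qed.

Lemma fsum_opp (u : nat -> A) : (forall k, W k (u k)) ->
  fsum (fun k => - u k) = - fsum u.
Proof.
by move=> Wu; apply: fsum_uniq => N; rewrite sumrN -opprD; apply/flN/fsumP.
Qed.
End FiltTheory.

Section Subst.
Variables (F : fieldType) (R A : comNzRingType) (kap : {rmorphism R -> A}).
Variables (W : filt F A) (u : A) (Wu : W 1 u).
Implicit Types f g : fps R.

(** Coefficients are moved by an arbitrary ring morphism [kap]: taking for [kap] a substitution for
    Y, and then substituting for X, treats series in two variables. *)
Definition fsubst f : A := fsum W (fun i => kap (f i) * u ^+ i).

Let Wterm f i : W i (kap (f i) * u ^+ i).
Proof. by apply: flMl; have := @flX _ _ W 1%N u i Wu; rewrite mul1n. Qed.

Lemma fsubst_fin N f : W N (fsubst f - \sum_(i < N) kap (f i) * u ^+ i).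
Proof. exact: fsumP. Qed.

Lemma fsubst_finW N f M : (N <= M)%N ->
  W N (fsubst f - \sum_(i < M) kap (f i) * u ^+ i).
Proof. by move=> leNM; apply: flW leNM _; apply: fsubst_fin. Qed.

Lemma fsubst_zmod : zmod_morphism fsubst.
Proof.
move=> f g; rewrite /fsubst -fsum_opp // -fsum_add //; last first.
  by move=> k; apply/flN/Wterm.
by congr (fsum W _); apply: funext => i; rewrite fpsB raddfB mulrBl.
Qed.

Lemma fsubst_mon : monoid_morphism fsubst.
Proof.
split=> [|f g].
  apply: fsum_uniq => -[|N]; first exact: fl_all.
  rewrite big_ord_recl big1 ?addr0 ?rmorph1 ?mulr1 ?subrr; first exact: fl_zero.
  by move=> i _; rewrite fps1 mulr0n raddf0 mul0r.
pose ser h : fps A := Fps (fun i => kap (h i) * u ^+ i).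
rewrite /fsubst -(@fsum_mul _ _ _ (ser f) (ser g)); try exact: Wterm.
congr (fsum W _).
apply: funext => i; rewrite !fpsM raddf_sum mulr_suml; apply: eq_bigr => j _ /=.
rewrite rmorphM -[in u ^+ i](@subnKC j i) -1?ltnS // exprD; ring.
Qed.

HB.instance Definition _ := GRing.isZmodMorphism.Build (fps R) A fsubst fsubst_zmod.
HB.instance Definition _ := GRing.isMonoidMorphism.Build (fps R) A fsubst fsubst_mon.
Definition fsubst_hom : {rmorphism fps R -> A} := fsubst.

Lemma fsubst_cst c : fsubst (fps_cst c) = kap c.
Proof.
apply: (@fl_eq _ _ W) => N.
apply: (fl_trans (fsubst_finW _ (leqnSn N))).
rewrite big_ord_recl big1 ?addr0 ?mulr1 ?subrr; first exact: fl_zero.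
by move=> i _; rewrite raddf0 mul0r.
Qed.
Lemma fsubst_X : fsubst fpsX = u.
Proof.
apply: (@fl_eq _ _ W) => N.
apply: (fl_trans (fsubst_finW _ (leq_trans (leqnSn N) (leqnSn N.+1)))).
rewrite 2!big_ord_recl big1 ?addr0 /=.
  by rewrite raddf0 mul0r add0r rmorph1 mul1r subrr; apply: fl_zero.
by move=> i _; rewrite raddf0 mul0r.
Qed.
Lemma fsubst_fl k f : (forall i, W k (kap (f i) * u ^+ i)) -> W k (fsubst f).
Proof. by move=> h; apply: fsum_fl. Qed.
End Subst.

(** * Morphisms and derivations of filtered algebras *)

Section Generated.
Variables (F : fieldType) (A : comNzRingType) (W : filt F A) (G : nat -> A -> Prop).

Inductive mon : nat -> A -> Prop :=
| mon1 : mon 0 1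
| monM k w x a : G k x -> mon w a -> mon (k + w)%N (x * a).

Inductive span (w : nat) : A -> Prop :=
| span0 : span w 0
| spanD w' c a b : (w <= w')%N -> mon w' a -> span w b -> span w (sc W c * a + b).

(** Density of the polynomials in the generators, with control of weights: an element of [W w] is
    approximated by monomials of weight at least w. This lets an estimate on generators pass to all
    of [W w]. *)
Definition generated :=
  (forall k x, G k x -> W k x) /\
  forall w N h, W w h -> exists2 h', span w h' & W N (h - h').

Lemma span_add w a b : span w a -> span w b -> span w (a + b).
Proof.
by elim=> [|w' c x y le mx _ IH] sb; rewrite ?add0r // -addrA; apply: spanD le mx (IH sb).
Qed.

Lemma span_sum w I (r : seq I) (P : pred I) (H : I -> A) :
  (forall i, P i -> span w (H i)) -> span w (\sum_(i <- r | P i) H i).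
Proof. by move=> sH; apply: big_ind => //; [apply: span0|apply: span_add]. Qed.

Lemma mon_mul v w a b : mon v a -> mon w b -> mon (v + w)%N (a * b).
Proof.
elim=> [|k v' x a' Gx _ IH] mb; first by rewrite mul1r.
by rewrite -addnA -mulrA; apply: monM (IH mb).
Qed.

Lemma mon_exp k x i : G k x -> mon (k * i)%N (x ^+ i).
Proof.
move=> Gx; elim: i => [|i IH]; first by rewrite muln0; apply: mon1.
by rewrite exprS mulnS; apply: monM.
Qed.
End Generated.

Definition fhom (F : fieldType) (A B : comNzRingType) (W : filt F A) (W' : filt F B)
  (f : A -> B) :=
  (forall c, f (sc W c) = sc W' c) /\ (forall k a, W k a -> W' k (f a)).

Section TwistedDerivation.
Variables (F : fieldType) (A B : comNzRingType) (W : filt F A) (W' : filt F B).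
Variables (G : nat -> A -> Prop) (genG : generated W G).

Definition continuous (T : A -> B) := forall N, exists M, forall h, W M h -> W' N (T h).

(** Covers both the difference of two algebra morphisms [f - g] and derivations ([f = g]). *)
Lemma twisted_raise (f g T : A -> B) (e : nat) :
  fhom W W' f -> fhom W W' g ->
  zmod_morphism T -> (forall a b, T (a * b) = f a * T b + T a * g b) ->
  (forall c, T (sc W c) = 0) -> continuous T ->
  (forall k x, G k x -> W' (k + e)%N (T x)) ->
  forall w h, W w h -> W' (w + e)%N (T h).
Proof.
move=> [_ fW] [_ gW] Tz TM Tc Tcont TG w h Wh.
have TD a b : T (a + b) = T a + T b.
  have T0 : T 0 = 0 by rewrite -(subrr 0) Tz subrr.
  have TN x : T (- x) = - T x by rewrite -sub0r Tz T0 sub0r.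
  by rewrite -{1}[b]opprK Tz TN opprK.
have Tmon v a : mon G v a -> W v a /\ W' (v + e)%N (T a).
  elim=> [|k u x b Gx _ [Wb WTb]].
    by split; [apply: fl_all|rewrite -(rmorph1 (sc W)) Tc; apply: fl_zero].
  have Wx := genG.1 _ _ Gx.
  split; first exact: flM.
  rewrite TM; apply: flD.
    by rewrite -addnA; apply: flM => //; apply: fW.
  by rewrite -addnA [(u + e)%N]addnC addnA; apply: flM; [apply: TG|apply: gW].
have [M TM'] := Tcont (w + e)%N.
have [h' sh' Whh'] := genG.2 w M h Wh.
rewrite -[h](subrK h') TD; apply: flD; first exact: TM'.
elim: sh' => [|v c a b le ma _ IH].
  by rewrite -(rmorph0 (sc W)) Tc; apply: fl_zero.
rewrite TD TM Tc mul0r addr0; apply: flD => //; apply: flMl.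
by apply: flW (Tmon _ _ ma).2; rewrite leq_add2r.
Qed.

Lemma hom_diff_raise (f g : {rmorphism A -> B}) e :
  fhom W W' f -> fhom W W' g ->
  (forall k x, G k x -> W' (k + e)%N (f x - g x)) ->
  forall w h, W w h -> W' (w + e)%N (f h - g h).
Proof.
move=> hf hg; apply: (@twisted_raise f g (fun x => f x - g x) e hf hg).
- by move=> a b; rewrite !rmorphB; ring.
- by move=> a b; rewrite !rmorphM; ring.
- by move=> c; rewrite hf.1 hg.1 subrr.
- by move=> N; exists N => h Wh; apply: flB; [apply: hf.2|apply: hg.2].
Qed.

(** Morphisms equal on generators satisfy [hom_diff_raise] for every e, so their difference lies in
    every step of the filtration. *)
Lemma hom_uniq (f g : {rmorphism A -> B}) :
  fhom W W' f -> fhom W W' g -> (forall k x, G k x -> f x = g x) -> f =1 g.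
Proof.
move=> hf hg fgE h; apply: (@fl_eq _ _ W') => k.
rewrite -[k]add0n; apply: (hom_diff_raise hf hg); last exact: fl_all.
by move=> i x /fgE ->; rewrite subrr; apply: fl_zero.
Qed.

Lemma der_raise (f : {rmorphism A -> B}) (T : A -> B) e :
  fhom W W' f -> zmod_morphism T -> (forall a b, T (a * b) = f a * T b + f b * T a) ->
  (forall c, T (sc W c) = 0) -> continuous T ->
  (forall k x, G k x -> W' (k + e)%N (T x)) ->
  forall w h, W w h -> W' (w + e)%N (T h).
Proof.
move=> hf' Tz TM; apply: (@twisted_raise f f T e hf' hf' Tz).
by move=> a b; rewrite TM [f b * _]mulrC.
Qed.

Lemma der_uniq (f : {rmorphism A -> B}) (T T' : A -> B) :
  fhom W W' f ->
  zmod_morphism T -> (forall a b, T (a * b) = f a * T b + f b * T a) ->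
  (forall c, T (sc W c) = 0) -> continuous T ->
  zmod_morphism T' -> (forall a b, T' (a * b) = f a * T' b + f b * T' a) ->
  (forall c, T' (sc W c) = 0) -> continuous T' ->
  (forall k x, G k x -> T x = T' x) -> T =1 T'.
Proof.
move=> hf Tz TM Tc Tk Tz' TM' Tc' Tk' TT' h; apply: (@fl_eq _ _ W') => k.
rewrite -[k]add0n.
apply: (@der_raise f (fun x => T x - T' x) k hf); last exact: fl_all.
- by move=> a b; rewrite Tz Tz'; ring.
- by move=> a b; rewrite TM TM'; ring.
- by move=> c; rewrite Tc Tc' subrr.
- move=> N; have [M1 h1] := Tk N; have [M2 h2] := Tk' N.
  exists (maxn M1 M2) => x Wx; apply: flB.
    by apply: h1; apply: flW Wx; rewrite leq_maxl.
  by apply: h2; apply: flW Wx; rewrite leq_maxr.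
- by move=> i x /TT' ->; rewrite subrr; apply: fl_zero.
Qed.
End TwistedDerivation.

Lemma fhom_comp (F : fieldType) (A B C : comNzRingType) (WA : filt F A)
  (WB : filt F B) (WC : filt F C) (f : A -> B) (g : B -> C) :
  fhom WA WB f -> fhom WB WC g -> fhom WA WC (g \o f).
Proof.
move=> [f1 f2] [g1 g2]; split=> [c|k a Wa] /=; first by rewrite f1 g1.
by apply: g2; apply: f2.
Qed.

Lemma fhom_id (F : fieldType) (A : comNzRingType) (W : filt F A) : fhom W W id.
Proof. by []. Qed.

(** * The filtrations of F[[t]] by order and of F[[X, Y]] by weight *)

Section FiltB.
Variable F : fieldType.
Notation B := (fps F).

Definition ordB (k : nat) (f : B) := forall i, (i < k)%N -> f i = 0.

Fact ordB_all f : ordB 0 f. Proof. by []. Qed.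
Fact ordB_dec k f : ordB k.+1 f -> ordB k f.
Proof. by move=> h i lt; apply: h; apply: ltnW. Qed.
Fact ordB_zero k : ordB k 0. Proof. by []. Qed.
Fact ordB_B k f g : ordB k f -> ordB k g -> ordB k (f - g).
Proof. by move=> hf hg i lt; rewrite fpsB hf // hg // subrr. Qed.
Fact ordB_M k l f g : ordB k f -> ordB l g -> ordB (k + l) (f * g).
Proof.
move=> hf hg i lt; rewrite fpsM big1 // => j _.
case: (ltnP j k) => [/hf ->|le]; first by rewrite mul0r.
by rewrite hg ?mulr0 //; have := ltn_ord j; lia.
Qed.
Fact ordB_sep f : (forall k, ordB k f) -> f = 0.
Proof. by move=> h; apply: fpsP => n; apply: (h n.+1). Qed.
Fact ordB_sum (u : nat -> B) : (forall k, ordB k (u k)) ->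
  exists s, forall N, ordB N (s - \sum_(k < N) u k).
Proof.
move=> hu; exists (Fps (fun n => \sum_(k < n.+1) u k n)) => N i lt.
rewrite fpsB /= fps_sum.
rewrite -(big_mkord xpredT (fun k => u k i)) -(big_mkord xpredT (fun k => u k i)).
rewrite [X in _ - X](@big_cat_nat _ _ _ i.+1) //=.
rewrite [X in _ - (_ + X)]big_nat_cond [X in _ - (_ + X)]big1 ?addr0 ?subrr //.
by move=> k /andP[/andP[lti _] _]; apply: hu.
Qed.
Definition filtB : filt F B := @Filt F B (@fps_cst F) ordB ordB_all ordB_dec
  ordB_zero ordB_B ordB_M ordB_sep ordB_sum.

Definition genB (k : nat) (x : B) := k = 1%N /\ x = fpsX.
Lemma ordB_X : ordB 1 (fpsX : B). Proof. by case. Qed.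
Lemma ordB_Xn k : ordB k (fpsX ^+ k : B).
Proof. by move=> i lt; rewrite fpsXn; case: ltngtP lt. Qed.

Lemma genB_generated : generated filtB genB.
Proof.
split=> [k x [-> ->]|w N h Wh]; first exact: ordB_X.
exists (\sum_(i < N | (w <= i)%N) fps_cst (h i) * fpsX ^+ i).
  apply: span_sum => i le; rewrite -[_ * _]addr0.
  apply: (@spanD _ _ filtB _ _ i) => //; last exact: span0.
  by have := @mon_exp _ genB 1%N fpsX i (conj erefl erefl); rewrite mul1n.
move=> i lt; rewrite fpsB fps_sum.
under eq_bigr => k _ do rewrite fpsCM fpsXn.
rewrite big_mkcond (bigD1 (Ordinal lt)) //= big1 ?addr0; last first.
  move=> k /eqP ne; case: ifP => // _.
  by case: eqP => e; rewrite ?mulr0 //; case: ne; apply: val_inj.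
case: ifP => [_|/negbT]; first by rewrite eqxx mulr1 subrr.
by rewrite -ltnNge => /Wh ->; rewrite subrr.
Qed.
End FiltB.

(** [fps (fps F)] is F[[X, Y]], the outer index being the exponent of X; it is filtered
    by the weights [p] of X and [q] of Y. *)
Section FiltA.
Variables (F : fieldType) (p q : nat).
Notation A := (fps (fps F)).

Definition ordA (k : nat) (h : A) := forall i j, (p * i + q * j < k)%N -> h i j = 0.

Fact ordA_all f : ordA 0 f. Proof. by []. Qed.
Fact ordA_dec k f : ordA k.+1 f -> ordA k f.
Proof. by move=> h i j lt; apply: h; apply: ltnW. Qed.
Fact ordA_zero k : ordA k 0. Proof. by []. Qed.
Fact ordA_B k f g : ordA k f -> ordA k g -> ordA k (f - g).
Proof. by move=> hf hg i j lt; rewrite !fpsB hf // hg // subrr. Qed.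

Lemma fpsM2 (f g : A) a b : (f * g) a b =
  \sum_(i < a.+1) \sum_(j < b.+1) f i j * g (a - i)%N (b - j)%N.
Proof. by rewrite fpsM fps_sum; apply: eq_bigr => i _; rewrite fpsM. Qed.

Fact ordA_M k l f g : ordA k f -> ordA l g -> ordA (k + l) (f * g).
Proof.
move=> hf hg a b lt; rewrite fpsM2 big1 // => i _; rewrite big1 // => j _.
case: (ltnP (p * i + q * j) k) => [/hf ->|le]; first by rewrite mul0r.
rewrite hg ?mulr0 //.
have ha : (p * a = p * i + p * (a - i))%N by rewrite -mulnDr subnKC // -ltnS.
have hb : (q * b = q * j + q * (b - j))%N by rewrite -mulnDr subnKC // -ltnS.
by lia.
Qed.
Fact ordA_sep f : (forall k, ordA k f) -> f = 0.
Proof. by move=> h; apply: fpsP => i; apply: fpsP => j; apply: (h (p * i + q * j).+1). Qed.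
Fact ordA_sum (u : nat -> A) : (forall k, ordA k (u k)) ->
  exists s, forall N, ordA N (s - \sum_(k < N) u k).
Proof.
move=> hu.
exists (Fps (fun i => Fps (fun j => \sum_(k < (p * i + q * j).+1) u k i j))) => N i j lt.
rewrite !fpsB /= !fps_sum.
rewrite -(big_mkord xpredT (fun k => u k i j)) -(big_mkord xpredT (fun k => u k i j)).
rewrite [X in _ - X](@big_cat_nat _ _ _ (p * i + q * j).+1) //=.
rewrite [X in _ - (_ + X)]big_nat_cond [X in _ - (_ + X)]big1 ?addr0 ?subrr //.
by move=> k /andP[/andP[lti _] _]; apply: hu.
Qed.

Definition scA : F -> A := fps_cst \o fps_cst.
HB.instance Definition _ := GRing.RMorphism.on scA.
Definition filtA : filt F A := @Filt F A scA ordA ordA_all ordA_dec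
  ordA_zero ordA_B ordA_M ordA_sep ordA_sum.

Definition vX : A := fpsX.
Definition vY : A := fps_cst fpsX.
Definition genA (k : nat) (x : A) := k = p /\ x = vX \/ k = q /\ x = vY.

Lemma vX_coef i j : vX i j = ((i == 1) && (j == 0))%N%:R.
Proof. by rewrite /vX /=; case: eqP => _; rewrite ?fps1 //. Qed.
Lemma vY_coef i j : vY i j = ((i == 0) && (j == 1))%N%:R.
Proof. by case: i. Qed.
Lemma monA_coef a b i j : (vX ^+ a * vY ^+ b) i j = ((i == a) && (j == b))%:R.
Proof.
have -> : vY ^+ b = fps_cst (fpsX ^+ b) by rewrite rmorphXn.
rewrite fpsXnM fps_cstE subn_eq0.
by case: ltngtP => //= _; rewrite mulr1n fpsXn.
Qed.
Lemma scAM c h i j : (scA c * h) i j = c * h i j.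
Proof. by have -> : scA c = fps_cst (fps_cst c) by []; rewrite !fpsCM. Qed.
Lemma ordA_vX : ordA p vX.
Proof. by move=> i j; rewrite vX_coef; case: i j => [|[|i]] [|j] //=; lia. Qed.
Lemma ordA_vY : ordA q vY.
Proof. by move=> i j; rewrite vY_coef; case: i j => [|i] [|[|j]] //=; lia. Qed.

Hypotheses (p0 : (0 < p)%N) (q0 : (0 < q)%N).

(** As p and q are positive, a monomial of weight below N has both exponents below N and is kept by
    the square truncation. *)
Lemma ordA_trunc N (h : A) :
  ordA N (h - \sum_(i < N) \sum_(j < N) scA (h i j) * (vX ^+ i * vY ^+ j)).
Proof.
move=> a b lt.
have lta : (a < N)%N by nia.
have ltb : (b < N)%N by nia.
rewrite !fpsB !fps_sum (bigD1 (Ordinal lta)) //= [X in _ - (_ + X)]big1 ?addr0; last first.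
  move=> i /eqP ne; rewrite !fps_sum big1 // => j _.
  rewrite scAM monA_coef; case: eqP => e; rewrite ?mulr0 //.
  by case: ne; apply: val_inj.
rewrite !fps_sum (bigD1 (Ordinal ltb)) //= big1 ?addr0; last first.
  move=> j /eqP ne; rewrite scAM monA_coef andbC.
  by case: eqP => e; rewrite ?mulr0 //; case: ne; apply: val_inj.
by rewrite scAM monA_coef !eqxx mulr1 subrr.
Qed.

Lemma genA_generated : generated filtA genA.
Proof.
split=> [k x [[-> ->]|[-> ->]]|w N h Wh].
- exact: ordA_vX.
- exact: ordA_vY.
eexists; last exact: ordA_trunc.
apply: span_sum => i _; apply: span_sum => j _.
case: (leqP w (p * i + q * j)) => [le|/Wh ->]; last first.
  by rewrite rmorph0 mul0r; apply: span0.
rewrite -[_ * _]addr0; apply: (@spanD _ _ filtA _ _ (p * i + q * j)) => //; last exact: span0.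
by apply: mon_mul; apply: mon_exp; [left|right].
Qed.
End FiltA.
Arguments scA {F}.
Arguments vX {F}.
Arguments vY {F}.

Lemma rmorph_of (A B : comNzRingType) (f : A -> B) :
  zmod_morphism f -> monoid_morphism f -> exists g : {rmorphism A -> B}, g =1 f.
Proof.
move=> fz fm.
pose g : {rmorphism A -> B} := HB.pack f
  (GRing.isZmodMorphism.Build A B f fz) (GRing.isMonoidMorphism.Build A B f fm).
by exists g.
Qed.

Section ZmodMorphism.
Variables (A B : zmodType) (f : A -> B) (fz : zmod_morphism f).
Lemma zm0 : f 0 = 0. Proof. by rewrite -(subrr 0) fz subrr. Qed.
Lemma zmN a : f (- a) = - f a. Proof. by rewrite -sub0r fz zm0 sub0r. Qed.
Lemma zmD a b : f (a + b) = f a + f b.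
Proof. by rewrite -{1}[b]opprK fz zmN opprK. Qed.
Lemma zm_sum I (r : seq I) (P : pred I) (G : I -> A) :
  f (\sum_(i <- r | P i) G i) = \sum_(i <- r | P i) f (G i).
Proof. exact: (big_morph f zmD zm0). Qed.
End ZmodMorphism.

(** * Operators raising the filtration: inverses and exponentials *)

Section Operators.
Variables (F : fieldType) (A : comNzRingType) (W : filt F A).

Definition raises (e : nat) (T : A -> A) :=
  zmod_morphism T /\ forall k a, W k a -> W (k + e)%N (T a).

Section Raising.
Variables (T : A -> A) (hT : raises 1 T).

Lemma iterT_zmod k : zmod_morphism (iter k T).
Proof. by elim: k => // k IH a b /=; rewrite IH hT.1. Qed.

Lemma iterT_raise k w a : W w a -> W (w + k)%N (iter k T a).
Proof.
move=> Wa; elim: k => [|k IH]; first by rewrite addn0.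
by rewrite addnS -addn1 iterS; apply: hT.2.
Qed.

Lemma iterT_fl k a : W k (iter k T a).
Proof. by have := iterT_raise k (fl_all W a). Qed.

Lemma iterT_keep k w a : W w a -> W w (iter k T a).
Proof. by move=> Wa; apply: flW (iterT_raise k Wa); rewrite leq_addr. Qed.

(** The operator c(T) for a power series c over F, convergent because [T] raises the filtration.
    Below, c is the geometric, the exponential or the logarithmic series. *)
Definition opser (c : nat -> F) (a : A) : A :=
  fsum W (fun k => sc W (c k) * iter k T a).

Lemma opser_term (c : nat -> F) a k : W k (sc W (c k) * iter k T a).
Proof. by apply: flMl; apply: iterT_fl. Qed.

Lemma opser_fin c a N :
  W N (opser c a - \sum_(k < N) sc W (c k) * iter k T a).
Proof. exact: (fsumP (opser_term c a)). Qed.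

Lemma opser_zmod c : zmod_morphism (opser c).
Proof.
move=> a b; rewrite /opser -fsum_opp -?fsum_add; try by move=> k; try apply: flN; apply: opser_term.
by congr (fsum W _); apply: funext => k; rewrite iterT_zmod mulrBr.
Qed.

Lemma opser_fl c w a : W w a -> W w (opser c a).
Proof.
move=> Wa; apply: fsum_fl => k; first exact: opser_term.
by apply: flMl; apply: iterT_keep.
Qed.

Lemma opser_lead c w a : W w a -> W w.+1 (opser c a - sc W (c 0%N) * a).
Proof.
move=> Wa; apply: (@fsum_lead _ _ W (fun k => sc W (c k) * iter k T a)) => k.
  exact: opser_term.
by apply: flMl; apply: flW (iterT_raise k.+1 Wa); lia.
Qed.

Lemma one_plus_inj a : a + T a = 0 -> a = 0.
Proof.
move=> /eqP; rewrite addr_eq0 => /eqP aE.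
apply: (@fl_sep _ _ W) => k; elim: k => [|k IH]; first exact: fl_all.
by rewrite aE -addn1; apply/flN/hT.2.
Qed.

Lemma one_plus_surj a : exists b, b + T b = a.
Proof.
exists (opser (fun k => (-1) ^+ k) a); apply: (@fl_eq _ _ W) => N.
set b := opser _ a; set s := \sum_(k < N) sc W ((-1) ^+ k) * iter k T a.
have Wb : W N (b - s) := opser_fin _ _ _.
apply: (@fl_trans _ _ _ _ (s + T s)).
  rewrite opprD addrACA -(hT.1); apply: flD => //.
  by apply: flW (hT.2 _ _ Wb); lia.
have -> : s + T s = a - (-1) ^+ N * iter N T a.
  rewrite /s; elim: N {s Wb} => [|N IH].
    by rewrite big_ord0 (zm0 hT.1) /= mul1r subrr addr0.
  rewrite big_ord_recr /= (zmD hT.1) addrACA IH rmorphXn rmorphN1.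
  have -> : T ((-1) ^+ N * iter N T a) = (-1) ^+ N * T (iter N T a).
    by rewrite -signr_odd !mulr_sign; case: ifP => // _; rewrite (zmN hT.1).
  by rewrite exprS; ring.
by rewrite addrAC subrr add0r; apply/flN/flMl/iterT_fl.
Qed.
End Raising.

Lemma unit_inv u : W 1 (u - 1) -> exists v, u * v = 1.
Proof.
move=> Wu; have hT : raises 1 (fun a => (u - 1) * a).
  split=> [a b|k a Wa]; first by rewrite mulrBr.
  by rewrite addnC; apply: flM.
have [v <-] := one_plus_surj hT 1; exists v; ring.
Qed.

(** [S] is the identity plus an operator raising the filtration, hence bijective by the geometric
    series; injectivity of [S] makes the inverse a ring morphism. *)
Lemma hom_inv (S : {rmorphism A -> A}) :
  fhom W W S -> (forall k a, W k a -> W k.+1 (S a - a)) ->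
  exists S' : {rmorphism A -> A}, [/\ fhom W W S', cancel S S', cancel S' S
    & forall k a, W k a -> W k.+1 (S' a - a)].
Proof.
move=> hS hS1; pose T a := S a - a.
have hT : raises 1 T.
  split=> [a b|k a Wa]; last by rewrite addn1; apply: hS1.
  by rewrite /T rmorphB; ring.
have ST a : S a = a + T a by rewrite /T addrC subrK.
have Sinj : injective S.
  by move=> a b /eqP; rewrite -subr_eq0 -rmorphB ST => /eqP /(one_plus_inj hT) /eqP;
     rewrite subr_eq0 => /eqP.
pose g a := projT1 (cid (one_plus_surj hT a)).
have Sg : cancel g S by move=> a; rewrite ST /g; case: cid.
have gS : cancel S g by move=> a; apply: Sinj; rewrite Sg.
have [|| S' S'E] := @rmorph_of _ _ g.
- by move=> a b; apply: Sinj; rewrite rmorphB !Sg.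
- by split=> [|a b]; apply: Sinj; rewrite ?rmorph1 ?rmorphM !Sg ?rmorph1.
have gW k a : W k a -> W k (g a).
  move=> Wa; elim: k Wa => [|k IH] Wa; first exact: fl_all.
  have Wga : W k (g a) by apply: IH; apply: (fl_dec W).
  apply: (fl_congr _ Wa); apply: fl_sym; rewrite -{1}[a]Sg.
  exact: (hS1 _ _ Wga).
exists S'; split.
- split=> [c|k a Wa]; rewrite S'E; first by rewrite -{1}(hS.1 c) gS.
  exact: gW.
- by move=> a; rewrite S'E.
- by move=> a; rewrite S'E.
- move=> k a Wa; rewrite S'E; apply: fl_sym; rewrite -{1}[a]Sg.
  by apply/hS1/gW.
Qed.

Section Exponential.
Hypothesis nat0 : forall k, (0 < k)%N -> k%:R != 0 :> F.
Variables (D : A -> A) (hD : raises 1 D).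
Hypothesis DM : forall a b, D (a * b) = a * D b + D a * b.
Hypothesis Dc : forall c, D (sc W c) = 0.

Lemma iterD_leibniz k a b : iter k D (a * b) =
  \sum_(j < k.+1) (iter j D a * iter (k - j) D b) *+ 'C(k, j).
Proof.
have DMn x m : D (x *+ m) = D x *+ m.
  by elim: m => [|m IH]; rewrite ?mulr0n ?(zm0 hD.1) // !mulrS (zmD hD.1) IH.
elim: k => [|k IH]; first by rewrite big_ord1.
have -> : iter k.+1 D (a * b) =
    \sum_(j < k.+1) (iter j.+1 D a * iter (k - j) D b) *+ 'C(k, j) +
    \sum_(j < k.+1) (iter j D a * iter (k - j).+1 D b) *+ 'C(k, j).
  rewrite iterS IH (zm_sum hD.1) -big_split /=; apply: eq_bigr => j _.
  by rewrite DMn DM addrC mulrnDl.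
rewrite [X in _ + X]big_ord_recl [RHS]big_ord_recl addrCA; congr (_ + _); first by rewrite !bin0 !subn0.
under [RHS]eq_bigr => j _ do rewrite lift0 binS mulrnDr subSS.
rewrite [RHS]big_split /= addrC; congr (_ + _).
rewrite [RHS]big_ord_recr /= bin_small // mulr0n addr0.
apply: eq_bigr => j _; rewrite -[bump 0 j]/(j.+1).
by have -> : (k - j = (k - j.+1).+1)%N by have := ltn_ord j; lia.
Qed.

Definition expD := opser D (fun k => k`!%:R^-1).

Let fact_neq0 k : k`!%:R != 0 :> F.
Proof. by rewrite nat0 ?fact_gt0. Qed.

(** By the Leibniz formula, the k-th iterate of [D] on ab divided by k! is the k-th term of the
    Cauchy product of the two exponential series. *)
Lemma expD_mon : monoid_morphism expD.
Proof.
split=> [|a b].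
  apply: fsum_uniq => -[|N]; first exact: fl_all.
  rewrite big_ord_recl big1 ?addr0 /= ?fact0 ?invr1 ?rmorph1 ?mulr1 ?subrr.
    exact: fl_zero.
  move=> i _; have -> : D (iter (0 + i) D 1) = 0.
    rewrite -[LHS]/(iter i.+1 D 1) iterSr -[1](rmorph1 (sc W)) Dc.
    by elim: (nat_of_ord i) => //= m ->; rewrite (zm0 hD.1).
  by rewrite mulr0.
pose ser x : fps A := Fps (fun k => sc W k`!%:R^-1 * iter k D x).
have Wser x k : W k (ser x k) by exact: (opser_term hD (fun k => k`!%:R^-1) x k).
rewrite -[expD a]/(fsum W (ser a)) -[expD b]/(fsum W (ser b)) -fsum_mul //.
congr (fsum W _); apply: funext => k; rewrite fpsM iterD_leibniz mulr_sumr.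
apply: eq_bigr => j _ /=.
have lejk : (j <= k)%N by rewrite -ltnS.
rewrite mulrACA -rmorphM mulrnAr -mulrnAl -raddfMn; congr (sc W _ * _).
have h1 := fact_neq0 k; have h2 := fact_neq0 j; have h3 := fact_neq0 (k - j)%N.
rewrite -[_ *+ 'C(k, j)]mulr_natr; apply: (mulfI h1); rewrite mulrA divff // mul1r.
rewrite -(bin_fact lejk) !natrM; field.
by rewrite h2 h3.
Qed.

Lemma expD_fhom : exists S : {rmorphism A -> A},
  [/\ S =1 expD, fhom W W S & forall k a, W k a -> W k.+1 (S a - a)].
Proof.
have [S SE] := rmorph_of (opser_zmod hD (fun k => k`!%:R^-1)) expD_mon.
exists S; split=> // [|k a Wa]; last first.
  rewrite SE; have := opser_lead hD (fun k => k`!%:R^-1) Wa.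
  by rewrite fact0 invr1 rmorph1 mul1r.
split=> [c|k a Wa]; rewrite SE; last exact: opser_fl.
apply: fsum_uniq => -[|N]; first exact: fl_all.
rewrite big_ord_recl big1 ?addr0 /= ?fact0 ?invr1 ?rmorph1 ?mul1r ?subrr.
  exact: fl_zero.
move=> i _; have -> : D (iter (0 + i) D (sc W c)) = 0.
  rewrite -[LHS]/(iter i.+1 D (sc W c)) iterSr Dc.
  by elim: (nat_of_ord i) => //= m ->; rewrite (zm0 hD.1).
by rewrite mulr0.
Qed.
End Exponential.
End Operators.

(** The iterates beyond the first contribute terms raising the filtration by at least
    [e + 1], so that only the coefficient [c 1] is visible. *)
Lemma opser_compare (F : fieldType) (A B : comNzRingType) (W : filt F A) (W' : filt F B)
  (phi : A -> B) (U : A -> A) (V : B -> B) (c : nat -> F) (e : nat) :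
  fhom W W' phi -> zmod_morphism phi -> (forall x a, phi (sc W x * a) = sc W' x * phi a) ->
  raises W 1 U -> raises W' 1 V ->
  (forall w a, W w a -> W' (w + e)%N (phi (U a) - V (phi a))) ->
  forall w a, W w a ->
  W' (w + e).+1 (phi (opser W U c a) - opser W' V c (phi a)
                 - sc W' (c 1%N) * (phi (U a) - V (phi a))).
Proof.
move=> hphi phiz phiZ hU hV hT w a Wa.
have cmp k w' b : W w' b ->
    W' (w' + e + k)%N (phi (iter k.+1 U b) - iter k.+1 V (phi b)).
  elim: k w' b => [|k IH] w' b Wb; first by rewrite addn0; apply: hT.
  have := hU.2 _ _ Wb; rewrite addn1 => /IH.
  rewrite addSn addSn -addnS => h1.
  have h2 := iterT_raise hV k.+1 (hT _ _ Wb).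
  have := flD h1 h2; rewrite (iterT_zmod hV) -!iterSr.
  by rewrite addrA subrK.
pose N := (w + e).+2.
have h1 : W' N (phi (opser W U c a) - \sum_(k < N) sc W' (c k) * phi (iter k U a)).
  have := hphi.2 _ _ (opser_fin hU c a N); rewrite phiz (zm_sum phiz).
  by under eq_bigr => k _ do rewrite phiZ.
have h2 := opser_fin hV c (phi a) N.
apply: (@fl_trans _ _ _ _ (\sum_(k < N) sc W' (c k) * (phi (iter k U a) - iter k V (phi a)))).
  have -> : \sum_(k < N) sc W' (c k) * (phi (iter k U a) - iter k V (phi a)) =
      \sum_(k < N) sc W' (c k) * phi (iter k U a)
      - \sum_(k < N) sc W' (c k) * iter k V (phi a).
    by rewrite -sumrB; apply: eq_bigr => k _; rewrite mulrBr.
  by apply: flW (leqnSn _) _; have := flB W' h1 h2; congr (W' _ _); ring.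
rewrite /N 2!big_ord_recl /= subrr mulr0 add0r addrAC subrr add0r.
apply: fl_bigsum => k _; apply: flMl.
by apply: flW (cmp k.+1 w a Wa); rewrite !addnS ltnS leq_addr.
Qed.

(** * Derivations of power series and logarithms *)

Section FormalDerivative.
Variable R : comNzRingType.
Implicit Types f g : fps R.

Definition fderiv f : fps R := Fps (fun n => f n.+1 *+ n.+1).

Lemma fderivE f n : fderiv f n = f n.+1 *+ n.+1. Proof. by []. Qed.
Lemma fderiv_zmod : zmod_morphism fderiv.
Proof. by move=> f g; apply: fpsP => n; rewrite fpsB !fderivE fpsB mulrnBl. Qed.
Lemma fderiv_cst c : fderiv (fps_cst c) = 0.
Proof. by apply: fpsP => n; rewrite fderivE /= mul0rn. Qed.
Lemma fderiv_X : fderiv fpsX = 1.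
Proof. by apply: fpsP => -[|n]; rewrite fderivE fps1 /= ?mulr1n ?mul0rn. Qed.

Lemma fpsM_poly (P Q : {poly R}) f g n :
  (forall i, (i <= n)%N -> P`_i = f i) -> (forall i, (i <= n)%N -> Q`_i = g i) ->
  (f * g) n = (P * Q)`_n.
Proof.
move=> hP hQ; rewrite fpsM coefM; apply: eq_bigr => i _.
by rewrite hP ?hQ ?leq_subr // -ltnS.
Qed.

Lemma fderivM f g : fderiv (f * g) = f * fderiv g + fderiv f * g.
Proof.
apply: fpsP => n; rewrite fderivE fpsD.
rewrite (fpsM_trunc f g (ltnSn n.+1)) -coef_deriv derivM coefD addrC.
congr (_ + _); apply/esym/fpsM_poly => i le; rewrite ?coef_deriv coef_trunc.
- by rewrite ltnW.
- by rewrite !ltnS le.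
- by rewrite !ltnS le.
- by rewrite ltnW.
Qed.
End FormalDerivative.

Section IsDerivation.
Variables (F : fieldType) (A : comNzRingType) (W : filt F A).
Definition isder (T : A -> A) :=
  [/\ zmod_morphism T, forall a b, T (a * b) = a * T b + T a * b,
      forall c, T (sc W c) = 0 & continuous W W T].

Lemma isderD T T' : isder T -> isder T' -> isder (fun a => T a + T' a).
Proof.
move=> [z m c k] [z' m' c' k']; split.
- by move=> a b; rewrite z z'; ring.
- by move=> a b; rewrite m m'; ring.
- by move=> x; rewrite c c' addr0.
- move=> N; have [M1 h1] := k N; have [M2 h2] := k' N.
  exists (maxn M1 M2) => x Wx; apply: flD.
    by apply: h1; apply: flW Wx; rewrite leq_maxl.
  by apply: h2; apply: flW Wx; rewrite leq_maxr.
Qed.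
Lemma isderZ g T : isder T -> isder (fun a => g * T a).
Proof.
move=> [z m c k]; split.
- by move=> a b; rewrite z; ring.
- by move=> a b; rewrite m; ring.
- by move=> x; rewrite c mulr0.
- by move=> N; have [M h] := k N; exists M => x Wx; apply/flMl/h.
Qed.

Lemma isder_raise (G : nat -> A -> Prop) T e : generated W G -> isder T ->
  (forall k x, G k x -> W (k + e)%N (T x)) -> raises W e T.
Proof.
move=> genG [z m c k] TG; split=> //.
apply: (@der_raise _ _ _ _ _ _ genG (idfun : {rmorphism A -> A}) T e) => //.
by move=> a b; rewrite m /= [b * _]mulrC.
Qed.
End IsDerivation.

Section Derivations.
Variable F : fieldType.
Notation B := (fps F).
Notation A := (fps (fps F)).

Lemma fderiv_isder : isder (filtB F) (@fderiv F).
Proof.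
split; [exact: fderiv_zmod|exact: fderivM|exact: fderiv_cst|].
by move=> N; exists N.+1 => h Wh i lt; rewrite fderivE Wh ?mul0rn.
Qed.

Definition dX (h : A) : A := fderiv h.
Definition dY (h : A) : A := Fps (fun i => fderiv (h i)).

Lemma dXE (h : A) i j : dX h i j = h i.+1 j *+ i.+1.
Proof. by rewrite /dX fderivE fpsMn. Qed.
Lemma dYE (h : A) i j : dY h i j = h i j.+1 *+ j.+1. Proof. by []. Qed.

Lemma dX_isder p q : isder (filtA F p q) dX.
Proof.
split; [exact: fderiv_zmod|exact: fderivM|by move=> c; apply: fderiv_cst|].
move=> N; exists (N + p)%N => h Wh i j lt; rewrite dXE Wh ?mul0rn //; lia.
Qed.
Lemma dY_isder p q : isder (filtA F p q) dY.
Proof.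
split.
- by move=> f g; apply: fpsP => i; apply: fderiv_zmod.
- move=> f g; apply: fpsP => i.
  rewrite fpsD -[LHS]/(fderiv ((f * g) i)) !fpsM -big_split /= (zm_sum (@fderiv_zmod F)).
  by apply: eq_bigr => j _; rewrite fderivM.
- by move=> c; apply: fpsP => -[|i]; [apply: fderiv_cst|apply: (zm0 (@fderiv_zmod F))].
- move=> N; exists (N + q)%N => h Wh i j lt; rewrite dYE Wh ?mul0rn //; lia.
Qed.
Lemma dX_vX : dX vX = 1. Proof. exact: fderiv_X. Qed.
Lemma dX_vY : dX vY = 0. Proof. exact: fderiv_cst. Qed.
Lemma dY_vX : dY vX = 0.
Proof.
apply: fpsP => i; apply: fpsP => j; rewrite dYE vX_coef.
by rewrite andbF mul0rn.
Qed.
Lemma dY_vY : dY vY = 1.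
Proof. by apply: fpsP => -[|i]; [apply: fderiv_X|apply: (zm0 (@fderiv_zmod F))]. Qed.

Section Chain.
Variables (C : comNzRingType) (W : filt F C) (T : C -> C) (dT : isder W T).

(** Here and in [chainA], both sides are derivations along [f] with the same values on the
    generators. *)
Lemma chainB (f : {rmorphism B -> C}) : fhom (filtB F) W f ->
  forall h, T (f h) = f (fderiv h) * T (f fpsX).
Proof.
case: dT => z m c k hf.
have [dz dm dc dk] := fderiv_isder.
apply: (@der_uniq _ _ _ _ _ _ (genB_generated F) f (T \o f) (fun h => f (fderiv h) * T (f fpsX)) hf).
- by move=> a b; rewrite /= rmorphB z.
- by move=> a b; rewrite /= rmorphM m; ring.
- by move=> x; rewrite /= hf.1 c.
- by move=> N; have [M hM] := k N; exists M => h Wh; apply/hM/hf.2.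
- by move=> a b; rewrite dz rmorphB; ring.
- by move=> a b; rewrite dm rmorphD !rmorphM; ring.
- by move=> x; rewrite dc rmorph0 mul0r.
- by move=> N; have [M hM] := dk N; exists M => h Wh; apply/flMr/hf.2/hM.
- by move=> i x [_ ->] /=; rewrite fderiv_X rmorph1 mul1r.
Qed.

Lemma chainA p q (f : {rmorphism A -> C}) : (0 < p)%N -> (0 < q)%N ->
  fhom (filtA F p q) W f ->
  forall h, T (f h) = f (dX h) * T (f vX) + f (dY h) * T (f vY).
Proof.
move=> p0 q0 hf; case: dT => z m c k.
have [dz dm dc dk] := dX_isder p q; have [dz' dm' dc' dk'] := dY_isder p q.
apply: (@der_uniq _ _ _ _ _ _ (genA_generated F p0 q0) f (T \o f)
  (fun h => f (dX h) * T (f vX) + f (dY h) * T (f vY)) hf).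
- by move=> a b; rewrite /= rmorphB z.
- by move=> a b; rewrite /= rmorphM m; ring.
- by move=> x; rewrite /= hf.1 c.
- by move=> N; have [M hM] := k N; exists M => h Wh; apply/hM/hf.2.
- by move=> a b; rewrite dz dz' !rmorphB; ring.
- by move=> a b; rewrite dm dm' !rmorphD !rmorphM; ring.
- by move=> x; rewrite dc dc' !rmorph0 !mul0r addr0.
- move=> N; have [M1 h1] := dk N; have [M2 h2] := dk' N.
  exists (maxn M1 M2) => h Wh; apply: flD; apply/flMr/hf.2.
    by apply: h1; apply: flW Wh; rewrite leq_maxl.
  by apply: h2; apply: flW Wh; rewrite leq_maxr.
- move=> i x [[_ ->]|[_ ->]] /=.
    by rewrite dX_vX dY_vX rmorph1 rmorph0 mul1r mul0r addr0.
  by rewrite dX_vY dY_vY rmorph1 rmorph0 mul1r mul0r add0r.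
Qed.
End Chain.

Lemma vecA_isder p q g1 g2 : isder (filtA F p q) (fun h => g1 * dX h + g2 * dY h).
Proof. by apply: isderD; apply: isderZ; [apply: dX_isder|apply: dY_isder]. Qed.

Lemma vecA_raise p q e g1 g2 : (0 < p)%N -> (0 < q)%N ->
  filtA F p q (p + e)%N g1 -> filtA F p q (q + e)%N g2 ->
  raises (filtA F p q) e (fun h => g1 * dX h + g2 * dY h).
Proof.
move=> p0 q0 h1 h2.
apply: (isder_raise (genA_generated F p0 q0)); first exact: vecA_isder.
move=> k x [[-> ->]|[-> ->]].
  by rewrite dX_vX dY_vX mulr1 mulr0 addr0.
by rewrite dX_vY dY_vY mulr1 mulr0 add0r.
Qed.

Lemma vecB_raise e (eps : B) : filtB F (1 + e)%N eps ->
  raises (filtB F) e (fun h => eps * fderiv h).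
Proof.
move=> h1; apply: (isder_raise (genB_generated F)).
  by apply: isderZ; apply: fderiv_isder.
by move=> k x [-> ->]; rewrite fderiv_X mulr1.
Qed.
End Derivations.

(** * The logarithm of a unipotent automorphism of F[[t]] *)

Section Logarithm.
Variable F : fieldType.
Hypothesis nat0 : forall k, (0 < k)%N -> k%:R != 0 :> F.
Notation B := (fps F).
Notation WB := (filtB F).

Definition log_coef k : F := if k is k'.+1 then (-1) ^+ k' / k%:R else 0.

(** The binomial coefficient x over j as a polynomial in x. The power R^x is the sum of these times
    the iterates of R - 1, and log R is its derivative at x = 0, which explains the coefficients
    [log_coef]. *)
Definition binp j : {poly F} := (j`!%:R)^-1 *: \prod_(i < j) ('X - i%:R%:P).

Let fact_neq0 k : k`!%:R != 0 :> F. Proof. by rewrite nat0 ?fact_gt0. Qed.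

Lemma binp_nat j k : (binp j).[k%:R] = 'C(k, j)%:R.
Proof.
rewrite /binp hornerZ horner_prod; apply: (mulfI (fact_neq0 j)).
rewrite mulrA divff // mul1r -natrM mulnC bin_ffact ffact_prod natr_prod.
case: (leqP j k) => [le|lt].
  by apply: eq_bigr => i _; rewrite hornerXsubC natrB // (leq_trans (ltnW (ltn_ord i))).
rewrite (bigD1 (Ordinal lt)) // [RHS](bigD1 (Ordinal lt)) //=.
by rewrite hornerXsubC subrr subnn !mul0r.
Qed.

Lemma binp_at0 j : (binp j).[0] = (j == 0)%N%:R.
Proof. by rewrite -[0]/(0%:R) binp_nat; case: j. Qed.

Lemma binp_deriv0 j : (binp j)^`().[0] = log_coef j.
Proof.
case: j => [|j].
  by rewrite /binp big_ord0 derivZ derivC scaler0 horner0.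
rewrite /binp derivZ hornerZ big_ord_recl subr0 derivM derivX mul1r hornerD hornerM.
rewrite hornerX mul0r addr0 horner_prod /log_coef.
rewrite (eq_bigr (fun i : 'I_j => (-1) * i.+1%:R)); last first.
  by move=> i _; rewrite hornerXsubC lift0 sub0r mulN1r.
rewrite big_split /= prodr_const card_ord -natr_prod.
have -> : (\prod_(i < j) i.+1 = j`!)%N by rewrite fact_prod big_add1 big_mkord.
rewrite factS natrM.
have h1 := fact_neq0 j; have h2 := @nat0 j.+1 isT; field.
by rewrite h1 nat1r h2.
Qed.

Lemma poly_nat_roots (p : {poly F}) : (forall k, p.[k%:R] = 0) -> p = 0.
Proof.
move=> hp; apply/eqP; apply/negPn/negP => p0.
pose rs := [seq k%:R : F | k <- iota 0 (size p)].
have h1 : all (root p) rs by apply/allP => x /mapP[k _ ->]; apply/rootP.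
have h2 : uniq rs.
  rewrite map_inj_uniq ?iota_uniq // => a b /eqP e; apply/eqP.
  case: (ltngtP a b) => // lt.
    have := @nat0 (b - a)%N.
    by rewrite subn_gt0 lt natrB ?(ltnW lt) // subr_eq0 eq_sym e => /(_ isT).
  have := @nat0 (a - b)%N.
  by rewrite subn_gt0 lt natrB ?(ltnW lt) // subr_eq0 e => /(_ isT).
by have := max_poly_roots p0 h1 h2; rewrite size_map size_iota ltnn.
Qed.

Variables (R : {rmorphism B -> B}) (hR : fhom WB WB R).
Hypothesis hR1 : forall k a, WB k a -> WB k.+1 (R a - a).
Let T a := R a - a.
Let hT : raises WB 1 T.
Proof. by split=> [a b|k a /hR1]; rewrite ?addn1 // /T rmorphB; ring. Qed.

Lemma iter_binomial k a : iter k R a = \sum_(j < k.+1) iter j T a *+ 'C(k, j).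
Proof.
elim: k => [|k IH]; first by rewrite big_ord1.
have -> : iter k.+1 R a = iter k R a + T (iter k R a) by rewrite /T addrC subrK.
rewrite {2}IH (zm_sum hT.1) IH.
rewrite [RHS]big_ord_recl [X in X + _]big_ord_recl -addrA; congr (_ + _); first by rewrite !bin0.
under [RHS]eq_bigr => j _ do rewrite lift0 binS mulrnDr.
rewrite [RHS]big_split /=; congr (_ + _).
  by rewrite [RHS]big_ord_recr /= bin_small // mulr0n addr0.
apply: eq_bigr => j _.
by elim: 'C(k, j) => [|m IHm]; rewrite ?mulr0n ?(zm0 hT.1) // !mulrS (zmD hT.1) IHm.
Qed.

(** The range of summation no longer depends on k: the binomial vanishes for j > k, the coefficient
    of index s for j >= N. The right-hand side is thus the value at k of a fixed polynomial. *)
Lemma iter_binomial_mod k a s N : (s < N)%N ->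
  iter k R a s = \sum_(j < N) iter j T a s * 'C(k, j)%:R.
Proof.
move=> ltsN; rewrite iter_binomial fps_sum.
under eq_bigr => j _ do rewrite fpsMn -mulr_natr.
rewrite -(big_mkord xpredT (fun j => iter j T a s * 'C(k, j)%:R)).
rewrite -[RHS](big_mkord xpredT (fun j => iter j T a s * 'C(k, j)%:R)).
have ext M1 M2 : (forall j, (M1 <= j)%N -> iter j T a s * 'C(k, j)%:R = 0) -> (M1 <= M2)%N ->
   \sum_(0 <= j < M1) iter j T a s * 'C(k, j)%:R = \sum_(0 <= j < M2) iter j T a s * 'C(k, j)%:R.
  move=> h le; rewrite [RHS](@big_cat_nat _ _ _ M1) //=.
  by rewrite [X in _ + X]big_nat_cond [X in _ + X]big1 ?addr0 // => j /andP[/andP[? _] _]; apply: h.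
rewrite (ext k.+1 (maxn k.+1 N)) ?leq_maxl //; last first.
  by move=> j lt; rewrite bin_small // mulr0.
rewrite -(ext N) ?leq_maxr // => j le.
have -> : iter j T a s = 0 by apply: (iterT_fl hT j a); apply: leq_trans le.
by rewrite mul0r.
Qed.

(** [R^k (a b) = R^k a * R^k b] is a polynomial identity in [k]; its linear coefficient
    is the Leibniz rule for [log R]. *)
Lemma log_isder : isder WB (opser WB T log_coef).
Proof.
split.
- exact: opser_zmod hT _.
- move=> a b; apply: fpsP => s; set N := s.+1.
  have logE x y : (x * opser WB T log_coef y) s =
      \sum_(j < N) log_coef j * (x * iter j T y) s.
    have /(flMl x)/(_ s (ltnSn s)) := opser_fin hT log_coef y N.
    rewrite mulrBr fpsB => /eqP; rewrite subr_eq0 => /eqP ->.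
    rewrite mulr_sumr fps_sum; apply: eq_bigr => j _.
    by rewrite mulrCA fpsCM.
  pose u (j l : nat) := (iter j T a * iter l T b) s.
  pose Q : {poly F} := \sum_(j < N) iter j T (a * b) s *: binp j
     - \sum_(j < N) \sum_(l < N) u j l *: (binp j * binp l).
  have Q0 : Q = 0.
    apply: poly_nat_roots => k; rewrite hornerD hornerN !horner_sum.
    apply/eqP; rewrite subr_eq0; apply/eqP.
    transitivity (iter k R (a * b) s).
      by rewrite (@iter_binomial_mod k _ s N) //; apply: eq_bigr => j _; rewrite hornerZ binp_nat.
    have -> : iter k R (a * b) = iter k R a * iter k R b.
      by elim: k => //= k ->; rewrite rmorphM.
    rewrite fpsM.
    transitivity (\sum_(i < N) \sum_(j < N) \sum_(l < N)
       (iter j T a i * 'C(k, j)%:R) * (iter l T b (s - i)%N * 'C(k, l)%:R)).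
      apply: eq_bigr => i _.
      rewrite (@iter_binomial_mod k a i N) // (@iter_binomial_mod k b (s - i)%N N) ?ltnS ?leq_subr //.
      by rewrite mulr_suml; apply: eq_bigr => j _; rewrite mulr_sumr.
    rewrite exchange_big; apply: eq_bigr => j _; rewrite exchange_big horner_sum.
    apply: eq_bigr => l _; rewrite hornerZ hornerM !binp_nat /u fpsM mulr_suml.
    by apply: eq_bigr => i _; rewrite mulrACA.
  have dsum n (G : 'I_n -> {poly F}) : (\sum_(j < n) G j)^`() = \sum_(j < n) (G j)^`().
    exact: (big_morph _ (@derivD F) (deriv0 F)).
  have : Q^`().[0] = 0 by rewrite Q0 deriv0 horner0.
  rewrite derivB hornerD hornerN => /eqP; rewrite subr_eq0 => /eqP.
  rewrite !dsum !horner_sum.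
  under eq_bigr => j _ do rewrite derivZ hornerZ binp_deriv0 mulrC.
  move=> leibniz; rewrite -[opser _ _ _ (a * b)]mul1r logE.
  under eq_bigr => j _ do rewrite mul1r.
  rewrite leibniz fpsD logE [opser _ _ _ a * b]mulrC logE addrC.
  transitivity (\sum_(j < N) \sum_(l < N) (log_coef j * u j l * (l == 0 :> nat)%:R
      + log_coef l * u j l * (j == 0 :> nat)%:R)).
    apply: eq_bigr => j _; rewrite dsum horner_sum; apply: eq_bigr => l _.
    rewrite derivZ hornerZ derivM hornerD !hornerM !binp_deriv0 !binp_at0; ring.
  under eq_bigr => j _ do rewrite big_split.
  rewrite big_split /=; congr (_ + _).
    apply: eq_bigr => j _; rewrite (bigD1 ord0) //= big1 ?addr0 ?mulr1.
      by rewrite /u /= [b * _]mulrC.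
    by move=> l; case: l => -[|l] //= ?; rewrite mulr0.
  rewrite exchange_big; apply: eq_bigr => l _; rewrite (bigD1 ord0) //= big1 ?addr0 ?mulr1 //.
  by move=> j; case: j => -[|j] //= ?; rewrite mulr0.
- move=> c; apply: fsum_uniq => N; rewrite big1 ?subr0; first exact: fl_zero.
  case=> -[|j] /= _ _; first by rewrite rmorph0 mul0r.
  rewrite -[T _]/(iter j.+1 T (fps_cst c)) iterSr.
  have -> : T (fps_cst c) = 0 by rewrite /T (hR.1 c) subrr.
  by elim: j => [|j IH]; rewrite ?mulr0 //= -[X in _ * T X]/(iter j T 0) (zm0 (iterT_zmod hT j)) (zm0 hT.1) mulr0.
- by move=> N; exists N => h Wh; apply: opser_fl.
Qed.
End Logarithm.

(** * Substitution and orders *)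

Section Substitution.
Variables (F : fieldType) (C : comNzRingType) (W : filt F C).
Notation B := (fps F).
Notation A := (fps (fps F)).

Lemma subst1_ex (u : C) : W 1 u ->
  exists f : {rmorphism B -> C}, fhom (filtB F) W f /\ f fpsX = u.
Proof.
move=> Wu; exists (fsubst_hom (sc W) Wu); split; last exact: fsubst_X.
split=> [c|k h Wh]; first exact: fsubst_cst.
apply: fsubst_fl => // i; case: (ltnP i k) => [/Wh ->|le].
  by rewrite rmorph0 mul0r; apply: fl_zero.
apply: flMl; apply: flW le _.
by have := @flX _ _ W 1%N u i Wu; rewrite mul1n.
Qed.

(** The morphism is chosen before the weights and is filtered for all p and q that fit the images of
    X and Y. One substitution can thus be used both with the weights (n, m) and with (1, 1). *)
Lemma subst2_ex (u v : C) : W 1 u -> W 1 v ->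
  exists f : {rmorphism A -> C}, [/\ f vX = u, f vY = v &
    forall p q, W p u -> W q v -> fhom (filtA F p q) W f].
Proof.
move=> Wu Wv; pose g := fsubst_hom (sc W) Wv.
exists (fsubst_hom g Wu); split; first exact: fsubst_X.
  by rewrite [LHS](fsubst_cst _ Wu); exact: (fsubst_X (sc W) Wv).
move=> p q Wpu Wqv; split=> [c|k h Wh].
  by rewrite [LHS](fsubst_cst _ Wu); exact: (fsubst_cst (sc W) Wv).
apply: fsubst_fl => // i.
have Wui := @flX _ _ W p u i Wpu.
suff Wg : W (k - p * i)%N (g (h i)).
  by apply: (flW _ (flM W Wg Wui)); lia.
apply: fsubst_fl => // j; have Wvj := @flX _ _ W q v j Wqv.
case: (ltnP (p * i + q * j) k) => [/Wh ->|le].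
  by rewrite raddf0 mul0r; apply: fl_zero.
by apply: flMl; apply: flW Wvj; lia.
Qed.
End Substitution.

Section Orders.
Variable F : fieldType.
Notation B := (fps F).
Notation WB := (filtB F).
Implicit Types (f g : B) (a b k : nat).

Definition hasord f k := f k != 0 /\ ordB k f.

Lemma coefM_lead f g a b : ordB a f -> ordB b g -> (f * g) (a + b)%N = f a * g b.
Proof.
move=> hf hg; have lt : (a < (a + b).+1)%N by rewrite ltnS leq_addr.
rewrite fpsM (bigD1 (Ordinal lt)) //= big1 ?addr0 ?addKn // => i /eqP ne.
have {}ne : nat_of_ord i <> a by move=> e; apply: ne; apply: val_inj.
case: (ltngtP i a) ne => [/hf -> _|gt _|->] //; first by rewrite mul0r.
by rewrite hg ?mulr0 //; have := ltn_ord i; lia.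
Qed.

Lemma hasordM f g a b : hasord f a -> hasord g b -> hasord (f * g) (a + b).
Proof.
move=> [f0 hf] [g0 hg]; split; last exact: ordB_M.
by rewrite coefM_lead // mulf_neq0.
Qed.

Lemma ordB_S f k : ordB k f -> f k = 0 -> ordB k.+1 f.
Proof.
by move=> hf f0 i; rewrite ltnS leq_eqVlt => /orP[/eqP -> //|]; apply: hf.
Qed.

Lemma hasord_congr f g k l : (k < l)%N -> ordB l (f - g) -> hasord g k -> hasord f k.
Proof.
move=> lt fg [g0 hg]; have e i : (i < l)%N -> f i = g i.
  by move/fg => /eqP; rewrite fpsB subr_eq0 => /eqP.
split; first by rewrite e.
by move=> i lti; rewrite e ?hg // (ltn_trans lti).
Qed.

Lemma ordB_divl f g k l : hasord f k -> ordB (k + l) (f * g) -> ordB l g.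
Proof.
move=> [f0 hf]; elim: l => [//|l IH] hfg.
have hg : ordB l g by apply: IH => i lt; apply: hfg; rewrite addnS ltnS ltnW.
apply: ordB_S => //; apply: (mulfI f0); rewrite mulr0 -coefM_lead //.
by apply: hfg; rewrite addnS.
Qed.

Lemma hasord_divl f g k l : hasord f k -> hasord (f * g) (k + l) -> hasord g l.
Proof.
move=> hf [fg0 hfg]; have hg := ordB_divl hf hfg; split=> //.
by move: fg0; rewrite coefM_lead ?mulf_eq0 ?negb_or; [case/andP|case: hf|].
Qed.

Lemma ordB_divide f g k l : hasord f k -> ordB (k + l) g -> exists2 h, g = h * f & ordB l h.
Proof.
move=> hf; have [f0 kf] := hf => hg.
pose u := fps_cst (f k)^-1 * Fps (fun i => f (i + k)%N).
have [v uv] : exists v, u * v = 1.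
  apply: (@unit_inv _ _ WB) => -[|i] // _.
  by rewrite fpsB fpsCM fps1 /= add0n mulVf // subrr.
have fE : f = fps_cst (f k) * fpsX ^+ k * u.
  rewrite /u mulrACA -rmorphM mulfV // rmorph1 mul1r.
  exact: fpsX_divide.
pose h := fps_cst (f k)^-1 * v * Fps (fun i => g (i + k)%N).
have gE : g = h * f.
  rewrite {1}(@fpsX_divide _ g k) /h; last by move=> i lt; apply: hg; lia.
  rewrite [X in _ = _ * X]fE; set G := Fps _.
  transitivity ((u * v) * (fps_cst (f k)^-1 * fps_cst (f k)) * (fpsX ^+ k * G)).
    by rewrite uv -rmorphM mulVf // rmorph1 !mul1r.
  by ring.
by exists h => //; apply: (ordB_divl hf); rewrite mulrC -gE.
Qed.
End Orders.

Section AlgebraAut.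
Variables (F : fieldType) (A : comNzRingType) (W : filt F A).
Definition faut (S S' : {rmorphism A -> A}) :=
  [/\ fhom W W S, fhom W W S', cancel S S' & cancel S' S].
Lemma faut_sym S S' : faut S S' -> faut S' S. Proof. by case=> ????; split. Qed.
End AlgebraAut.

Lemma hasord_aut (F : fieldType) (R R' : {rmorphism fps F -> fps F}) f k :
  faut (filtB F) R R' -> hasord (R f) k <-> hasord f k.
Proof.
have half (Q Q' : {rmorphism fps F -> fps F}) g : faut (filtB F) Q Q' -> hasord g k -> hasord (Q g) k.
  move=> [hQ hQ' QK _] [g0 hg]; split; last exact: hQ.2.
  apply/negP => /eqP e; have := hQ'.2 k.+1 _ (ordB_S (hQ.2 _ _ hg) e).
  by rewrite QK => /(_ k (ltnSn k)) /eqP; apply/negP.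
move=> hR; split; last exact: half hR.
by move=> h; have := half _ _ _ (faut_sym hR) h; case: hR => _ _ -> _.
Qed.

(** * Formal reduction to normal form *)

Section FormalBranches.
Variable F : fieldType.
Hypothesis nat0 : forall k, (0 < k)%N -> k%:R != 0 :> F.
Variables n m : nat.
Hypotheses (n0 : (0 < n)%N) (nm : (n < m)%N).
Notation B := (fps F).
Notation A := (fps (fps F)).
Notation WB := (filtB F).
Notation WA := (filtA F n m).
Notation t := (fpsX : fps F).
Notation genA' := (genA_generated F n0 (ltn_trans n0 nm)).
Implicit Types (phi psi : {rmorphism A -> B}).

Let m0 : (0 < m)%N := ltn_trans n0 nm.

Lemma fderiv_ord k (f : B) : ordB k.+1 f -> ordB k (fderiv f).
Proof. by move=> h i lt; rewrite fderivE h ?mul0rn. Qed.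

Lemma fderiv_hasord k (f : B) : hasord f k.+1 -> hasord (fderiv f) k.
Proof.
move=> [f0 hf]; split; last exact: fderiv_ord.
by rewrite fderivE -mulr_natr mulf_neq0 ?nat0.
Qed.

Lemma fderiv_ord_inv k (f : B) : ordB k (fderiv f) -> ordB k.+1 (f - fps_cst (f 0%N)).
Proof.
move=> h [|i] lt; first by rewrite fpsB /= subrr.
rewrite fpsB /= subr0; have := h i lt; rewrite fderivE -mulr_natr => /eqP.
by rewrite mulf_eq0 (negPf (@nat0 i.+1 _)) // orbF => /eqP.
Qed.

Lemma fderiv_hasord_inv k (f : B) :
  hasord (fderiv f) k -> hasord (f - fps_cst (f 0%N)) k.+1.
Proof.
move=> [f0 hf]; split; last exact: fderiv_ord_inv.
rewrite fpsB /= subr0; apply: contraNneq f0 => f0.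
by rewrite fderivE f0 mul0rn.
Qed.

(** A morphism [A -> B] compatible with the filtrations is the pull-back along the formal
    parametrization [(phi vX, phi vY)]. *)
Definition lead phi :=
  [/\ fhom WA WB phi, ordB n.+1 (phi vX - t ^+ n) & ordB m.+1 (phi vY - t ^+ m)].

(** [S] and [R] are the pull-backs along automorphisms sigma of the plane and rho of the line. The
    equation says that sigma after the first parametrization is the second parametrization after
    rho. *)
Definition fequiv phi psi := exists S S' R R',
  [/\ faut WA S S', faut WB R R' & forall h, phi (S h) = R (psi h)].

Lemma fequiv_refl phi : fequiv phi phi.
Proof. by exists idfun, idfun, idfun, idfun. Qed.

Lemma faut_comp (C : comNzRingType) (W : filt F C) (S S' T T' : {rmorphism C -> C}) :
  faut W S S' -> faut W T T' -> faut W (S \o T) (T' \o S').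
Proof.
move=> [h1 h2 k1 k2] [h3 h4 k3 k4]; split.
- exact: (fhom_comp h3 h1).
- exact: (fhom_comp h2 h4).
- by move=> a /=; rewrite k1 k3.
- by move=> a /=; rewrite k4 k2.
Qed.

Lemma fequiv_trans phi psi chi : fequiv phi psi -> fequiv psi chi -> fequiv phi chi.
Proof.
move=> [S [S' [R [R' [hS hR E]]]]] [T [T' [Q [Q' [hT hQ E']]]]].
exists (S \o T), (T' \o S'), (R \o Q), (Q' \o R'); split; try exact: faut_comp.
by move=> h /=; rewrite E E'.
Qed.

Lemma fequiv_sym phi psi : fequiv phi psi -> fequiv psi phi.
Proof.
move=> [S [S' [R [R' [hS hR E]]]]]; exists S', S, R', R.
have [_ _ RK R'K] := hR; have [_ _ _ SK] := hS.
split; try exact: faut_sym.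
by move=> h; apply: (can_inj RK); rewrite R'K -E SK.
Qed.

(** The coefficient of [dt] in the pull-back of [h dX + g dY]. *)
Definition pform phi (h g : A) : B := phi h * fderiv (phi vX) + phi g * fderiv (phi vY).
Definition Gam phi v := exists h, hasord (phi h) v.
Definition Lam phi v := exists h g o, hasord (pform phi h g) o /\ v = o.+1.

Lemma fequiv_Gam phi psi v : fequiv phi psi -> Gam phi v <-> Gam psi v.
Proof.
have half (p q : {rmorphism A -> B}) : fequiv p q -> Gam q v -> Gam p v.
  move=> [S [S' [R [R' [hS hR E]]]]] [h hh]; exists (S h).
  by rewrite E; apply/(hasord_aut _ _ hR).
by move=> e; split; apply: half => //; apply: fequiv_sym.
Qed.

Lemma pform_chain phi : fhom WA WB phi ->
  forall h, fderiv (phi h) = pform phi (dX h) (dY h).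
Proof. by move=> hphi h; apply: (chainA (fderiv_isder F) n0 m0). Qed.

(** The form is pulled back along [S]. Its pull-back by the first morphism is the image under [R] of
    its pull-back by the second, times the derivative of [R t], which is a unit; so the orders
    agree. *)
Lemma fequiv_Lam phi psi v : fhom WA WB phi -> fhom WA WB psi ->
  fequiv phi psi -> Lam phi v <-> Lam psi v.
Proof.
have half (p q : {rmorphism A -> B}) : fhom WA WB p -> fequiv p q -> Lam q v -> Lam p v.
  move=> hp [S [S' [R [R' [hS hR E]]]]] [h [g [o [hh ->]]]].
  exists (S h * dX (S vX) + S g * dX (S vY)), (S h * dY (S vX) + S g * dY (S vY)), o.
  split=> //.
  have [hR1 _ _ _] := hR.
  have RX : hasord (fderiv (R t)) 0.
    apply: fderiv_hasord; apply/(hasord_aut _ _ hR); split=> //.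
    - by rewrite /= oner_neq0.
    - by case.
  have -> : pform p (S h * dX (S vX) + S g * dX (S vY)) (S h * dY (S vX) + S g * dY (S vY))
    = fderiv (R t) * R (pform q h g).
    have e1 := pform_chain hp (S vX); have e2 := pform_chain hp (S vY).
    rewrite /pform in e1 e2.
    transitivity (p (S h) * fderiv (p (S vX)) + p (S g) * fderiv (p (S vY))).
      by rewrite e1 e2 /pform !rmorphD !rmorphM; ring.
    rewrite !E (chainB (fderiv_isder F) hR1 (q vX)).
    rewrite (chainB (fderiv_isder F) hR1 (q vY)) /pform rmorphD !rmorphM; ring.
  by rewrite -[o]add0n; apply: hasordM => //; apply/(hasord_aut _ _ hR).
move=> h1 h2 e; split; apply: half => //; exact: fequiv_sym.
Qed.

Lemma ordB_leadX phi : lead phi -> ordB n (phi vX).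
Proof. by case=> hphi _ _; apply: hphi.2; apply: ordA_vX. Qed.
Lemma ordB_leadY phi : lead phi -> ordB m (phi vY).
Proof. by case=> hphi _ _; apply: hphi.2; apply: ordA_vY. Qed.
Lemma leadX_coef phi : lead phi -> phi vX n = 1.
Proof.
case=> _ h _; have := h n (ltnSn n); rewrite fpsB fpsXn eqxx => /eqP.
by rewrite subr_eq0 => /eqP.
Qed.
Lemma leadY_coef phi : lead phi -> phi vY m = 1.
Proof.
case=> _ _ h; have := h m (ltnSn m); rewrite fpsB fpsXn eqxx => /eqP.
by rewrite subr_eq0 => /eqP.
Qed.
Lemma lead_of phi psi e : lead phi -> fhom WA WB psi ->
  ordB (n + e.+1) (psi vX - phi vX) -> ordB (m + e.+1) (psi vY - phi vY) -> lead psi.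
Proof.
move=> [h1 h2 h3] hpsi hx hy; split=> //.
  by apply: (fl_trans (W := WB) _ h2); apply: (flW (W := WB) _ hx); lia.
by apply: (fl_trans (W := WB) _ h3); apply: (flW (W := WB) _ hy); lia.
Qed.

(** Moving along the flows of [g1 d/dX + g2 d/dY] and of [eps d/dt] changes [phi] by its
    infinitesimal variation, to leading order. *)
Lemma flow_step phi g1 g2 eps e :
  lead phi -> WA n.+1 g1 -> WA m.+1 g2 -> WB 2 eps ->
  WB (n + e.+1)%N (phi g1 - eps * fderiv (phi vX)) ->
  WB (m + e.+1)%N (phi g2 - eps * fderiv (phi vY)) ->
  exists psi, [/\ lead psi, fequiv phi psi,
    WB (n + e.+2)%N (psi vX - (phi vX + (phi g1 - eps * fderiv (phi vX)))) &
    WB (m + e.+2)%N (psi vY - (phi vY + (phi g2 - eps * fderiv (phi vY))))].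
Proof.
move=> lphi Wg1 Wg2 Weps; set th1 := phi g1 - _; set th2 := phi g2 - _ => Wt1 Wt2.
have [hphi _ _] := lphi.
pose U (h : A) : A := g1 * dX h + g2 * dY h.
pose V (f : B) : B := eps * fderiv f.
have hU : raises WA 1 U by apply: vecA_raise => //; rewrite addn1.
have hV : raises WB 1 V by apply: vecB_raise.
have [_ UM Uc _] : isder WA U := vecA_isder n m g1 g2.
have [_ VM Vc _] : isder WB V := isderZ eps (fderiv_isder F).
have thetaE h : phi (U h) - V (phi h) = phi (dX h) * th1 + phi (dY h) * th2.
  by rewrite /U /V pform_chain // /pform /th1 /th2 rmorphD !rmorphM; ring.
have theta_raise w h : WA w h -> WB (w + e.+1)%N (phi (U h) - V (phi h)).
  apply: (@der_raise _ _ _ _ _ _ genA' phi (fun h => phi (U h) - V (phi h)) e.+1 hphi).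
  - by move=> a b; rewrite rmorphB (hU.1) (hV.1) rmorphB; ring.
  - by move=> a b; rewrite rmorphM UM VM rmorphD !rmorphM; ring.
  - by move=> c; rewrite Uc hphi.1 Vc rmorph0 subrr.
  - move=> N; exists N => x Wx; apply: flB.
      by apply/hphi.2; apply: flW (hU.2 _ _ Wx); rewrite leq_addr.
    by apply: flW (hV.2 _ _ (hphi.2 _ _ Wx)); rewrite leq_addr.
  - move=> k x [[-> ->]|[-> ->]]; rewrite thetaE.
      by rewrite dX_vX dY_vX rmorph1 rmorph0 mul1r mul0r addr0.
    by rewrite dX_vY dY_vY rmorph1 rmorph0 mul1r mul0r add0r.
have [S [SE hS S1]] := expD_fhom nat0 hU UM Uc.
have [R [RE hR R1]] := expD_fhom nat0 hV VM Vc.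
have [S' [hS' SK S'K _]] := hom_inv hS S1.
have [R' [hR' RK R'K R'1]] := hom_inv hR R1.
(* This is exp(-V) phi exp(U), so [psi - phi] begins with phi U - V phi. *)
pose psi : {rmorphism A -> B} := R' \o phi \o S.
have hpsi : fhom WA WB psi := fhom_comp hS (fhom_comp hphi hR').
have cmp w h : WA w h -> WB (w + e.+2)%N (psi h - (phi h + (phi (U h) - V (phi h)))).
  move=> Wh; have Wth := theta_raise _ _ Wh.
  have phiZ x a : phi (sc WA x * a) = sc WB x * phi a by rewrite rmorphM hphi.1.
  have := opser_compare (fun k => k`!%:R^-1) hphi (rmorphB phi) phiZ hU hV theta_raise Wh.
  rewrite -/(expD WA U h) -/(expD WB V (phi h)) -SE -RE.
  rewrite (_ : 1`! = 1)%N // invr1 rmorph1 mul1r.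
  move: (phi (U h) - _) Wth => th Wth.
  move=> /hR'.2; rewrite !rmorphB RK => c1.
  have c2 := R'1 _ _ Wth.
  have := flD c1 c2; rewrite !addnS; congr (WB _ _).
  by rewrite /psi /=; ring.
have thX : phi (U vX) - V (phi vX) = th1.
  by rewrite thetaE dX_vX dY_vX rmorph1 rmorph0 mul1r mul0r addr0.
have thY : phi (U vY) - V (phi vY) = th2.
  by rewrite thetaE dX_vY dY_vY rmorph1 rmorph0 mul1r mul0r add0r.
have cX := cmp _ _ (@ordA_vX F n m); have cY := cmp _ _ (@ordA_vY F n m).
rewrite thX in cX; rewrite thY in cY.
exists psi; split=> //.
  apply: (@lead_of phi _ e) => //.
    have cX' := flW (_ : n + e.+1 <= n + e.+2)%N cX.
    by have := flD (cX' _) Wt1; move=> /(_ ltac:(lia)); congr (WB _ _); ring.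
  have cY' := flW (_ : m + e.+1 <= m + e.+2)%N cY.
  by have := flD (cY' _) Wt2; move=> /(_ ltac:(lia)); congr (WB _ _); ring.
exists S, S', R, R'; split=> // h.
by rewrite /psi /= R'K.
Qed.
End FormalBranches.

(** * Removal of one coefficient, and the differential behind the Zariski invariant *)

Section FormalReduction.
Variable F : fieldType.
Hypothesis nat0 : forall k, (0 < k)%N -> k%:R != 0 :> F.
Variables n m : nat.
Hypotheses (n0 : (0 < n)%N) (nm : (n < m)%N).
Notation B := (fps F).
Notation A := (fps (fps F)).
Notation WB := (filtB F).
Notation WA := (filtA F n m).
Notation t := (fpsX : fps F).
Implicit Types (phi psi : {rmorphism A -> B}).
Notation lead := (@lead F n m).
Notation fequiv := (@fequiv F n m).

Let m0 : (0 < m)%N := ltn_trans n0 nm.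

Lemma lead_dX phi : lead phi -> ordB n.-1 (fderiv (phi vX)) /\ fderiv (phi vX) n.-1 = n%:R.
Proof.
move=> lphi; split; first by apply: fderiv_ord; rewrite prednK //; apply: ordB_leadX lphi.
by rewrite fderivE prednK // (leadX_coef lphi).
Qed.

Lemma lead_dY phi : lead phi -> ordB m.-1 (fderiv (phi vY)).
Proof. by move=> lphi; apply: fderiv_ord; rewrite prednK //; apply: ordB_leadY lphi. Qed.

(** A reparametrization alone does it. It moves Y only from order m + e + 1 on, so the coefficients
    of Y normalized so far survive. *)
Lemma eliminateX phi e : lead phi -> WB (n + e.+1)%N (phi vX - t ^+ n) ->
  exists psi, [/\ lead psi, fequiv phi psi,
    WB (n + e.+2)%N (psi vX - t ^+ n) & WB (m + e.+1)%N (psi vY - phi vY)].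
Proof.
move=> lphi hX; have [dX0 dXn] := lead_dX lphi; have dY0 := lead_dY lphi.
pose c := phi vX (n + e.+1)%N.
(* The derivative of [phi vX] starts with n t^(n-1), so its product with [eps] starts with c
   t^(n+e+1), the term to be removed. *)
pose eps : B := fps_cst (c / n%:R) * t ^+ e.+2.
have heps : ordB e.+2 eps by apply: (flMl (W := WB)); apply: ordB_Xn.
have epse : eps e.+2 = c / n%:R by rewrite /eps fpsCM fpsXn eqxx mulr1.
have ordXe : ordB (n + e.+1) (eps * fderiv (phi vX)).
  by have := ordB_M heps dX0; congr ordB; lia.
have coefXe : (eps * fderiv (phi vX)) (n + e.+1)%N = c.
  have -> : (n + e.+1 = e.+2 + n.-1)%N by lia.
  by rewrite coefM_lead // dXn epse divfK ?nat0.
have ordYe : ordB (m + e.+1) (eps * fderiv (phi vY)).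
  by have := ordB_M heps dY0; congr ordB; lia.
have [|||||psi [lpsi fe cX cY]] := @flow_step F nat0 n m n0 nm phi 0 0 eps e lphi.
- exact: ordA_zero.
- exact: ordA_zero.
- by apply: (flW (W := WB) _ heps).
- by rewrite rmorph0 sub0r; apply: (flN (W := WB)).
- by rewrite rmorph0 sub0r; apply: (flN (W := WB)).
rewrite !rmorph0 !sub0r in cX cY.
exists psi; split=> //.
  apply: (fl_trans (W := WB) cX); rewrite addrAC addnS; apply: ordB_S.
    exact: (flB WB hX ordXe).
  rewrite !fpsB fpsXn coefXe /c.
  by case: eqP => [|_]; [lia|rewrite subr0 subrr].
have h1 := flD (flW (W := WB) (_ : m + e.+1 <= m + e.+2)%N cY) (flN (W := WB) ordYe).
by have := h1 ltac:(lia); congr (WB _ _); ring.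
Qed.

(** With [eps] the quotient of [phi g1] by x', the infinitesimal motion of X is zero. That of Y is
    the pull-back of g2 dX - g1 dY divided by x', of order n + m + e - (n - 1) = m + e + 1, and the
    factor [s] makes it cancel the coefficient of Y there. *)
Lemma eliminateY phi g1 g2 e : lead phi -> WA n.+1 g1 -> WA m.+1 g2 ->
  hasord (pform phi g2 (- g1)) (n + m + e) ->
  exists psi, [/\ lead psi, fequiv phi psi,
    WB (n + e.+2)%N (psi vX - phi vX), WB (m + e.+1)%N (psi vY - phi vY)
    & psi vY (m + e.+1)%N = 0].
Proof.
move=> lphi Wg1 Wg2 hw; have [dX0 dXn] := lead_dX lphi.
have [hphi _ _] := lphi.
have hdX : hasord (fderiv (phi vX)) n.-1 by split=> //; rewrite dXn nat0.
have hg1 : ordB (n.-1 + 2) (phi g1).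
  by apply: (flW (W := WB) _ (hphi.2 _ _ Wg1)); lia.
have [eps epsE heps] := ordB_divide hdX hg1.
pose th2 := phi g2 - eps * fderiv (phi vY).
have hth2 : hasord th2 (m + e.+1).
  apply: (hasord_divl hdX); have -> : (n.-1 + (m + e.+1) = n + m + e)%N by lia.
  suff -> : fderiv (phi vX) * th2 = pform phi g2 (- g1) by [].
  rewrite /pform rmorphN epsE /th2; ring.
have [th20 th2o] := hth2.
pose s := - phi vY (m + e.+1)%N / th2 (m + e.+1)%N.
have phis g : phi (scA s * g) = fps_cst s * phi g by rewrite rmorphM hphi.1.
have e1 : phi (scA s * g1) - fps_cst s * eps * fderiv (phi vX) = 0.
  by rewrite phis epsE; ring.
have e2 : phi (scA s * g2) - fps_cst s * eps * fderiv (phi vY) = fps_cst s * th2.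
  by rewrite phis /th2; ring.
have [|||||psi [lpsi fe cX cY]] := @flow_step F nat0 n m n0 nm phi (scA s * g1) (scA s * g2) (fps_cst s * eps) e lphi.
- exact: (flMl (W := WA)).
- exact: (flMl (W := WA)).
- exact: (flMl (W := WB)).
- by rewrite e1; apply: fl_zero.
- by rewrite e2; apply: (flMl (W := WB)).
rewrite e1 addr0 in cX; rewrite e2 in cY.
have hs : ordB (m + e.+1) (fps_cst s * th2) by apply: (flMl (W := WB)).
exists psi; split=> //.
  have h1 := flD (flW (W := WB) (_ : m + e.+1 <= m + e.+2)%N cY) hs.
  by have := h1 ltac:(lia); congr (WB _ _); ring.
have := cY (m + e.+1)%N; rewrite fpsB fpsD fpsCM /s divfK // subrr subr0; apply; lia.
Qed.

(** The coefficient of [dt] in the pull-back of [m Y dX - n X dY]. *)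
Definition zar0 phi : B := m%:R * phi vY * fderiv (phi vX) - n%:R * phi vX * fderiv (phi vY).

(** On quasi-homogeneous monomials this is a 2 by 2 linear system. *)
Lemma form_decomposition (a b : A) : exists h k : A,
  [/\ a = dX h + m%:R * vY * k, b = dY h - n%:R * vX * k
    & k 0%N 0%N = (a 0%N 1%N - b 1%N 0%N) / (n + m)%:R].
Proof.
(* Contraction of a dX + b dY with the Euler field n X d/dX + m Y d/dY, divided by the weight as in
   Cartan's formula. The constant term is 0 / 0 = 0. *)
pose h : A := Fps (fun p => Fps (fun q =>
  (n%:R * (if p is p'.+1 then a p' q else 0) + m%:R * (if q is q'.+1 then b p q' else 0))
  / (n * p + m * q)%:R)).
(* The Y-derivative of a minus the X-derivative of b, each coefficient divided by the weight of
   X^(p+1) Y^(q+1). *)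
pose k : A := Fps (fun p => Fps (fun q =>
  (q.+1%:R * a p q.+1 - p.+1%:R * b p.+1 q) / (n * p.+1 + m * q.+1)%:R)).
have nat1 r s : (0 < r + s)%N -> (n * r + m * s)%:R != 0 :> F.
  by move=> rs; rewrite nat0 // addn_gt0 !muln_gt0 n0 m0 -addn_gt0.
have natM (x : A) r i j : (r%:R * x) i j = r%:R * x i j.
  by rewrite mulr_natl !fpsMn mulr_natl.
have vYM (x : A) i j : (vY * x) i j = if j is j'.+1 then x i j' else 0.
  by rewrite fpsCM fpsXM.
have vXM (x : A) i j : (vX * x) i j = if i is i'.+1 then x i' j else 0.
  by rewrite fpsXM; case: i.
exists h, k; split.
- apply: fpsP => p; apply: fpsP => q; rewrite !fpsD dXE -mulrA natM vYM /=.
  have := nat1 p.+1 q isT.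
  case: q => [|q] h1.
    rewrite mulr0 !addr0 muln0 addn0 natrM.
    have h2 := @nat0 n n0; have h3 := @nat0 p.+1 isT.
    by field; rewrite h2 nat1r h3.
  rewrite -!natr1; rewrite !natrD !natrM -!natr1 in h1 *; field.
  by [].
- apply: fpsP => p; apply: fpsP => q; rewrite !fpsB dYE -mulrA natM vXM /=.
  have := nat1 p q.+1; rewrite addnS => /(_ isT).
  case: p => [|p] h1.
    rewrite mulr0 subr0 add0r muln0 add0n natrM.
    have h2 := @nat0 m m0; have h3 := @nat0 q.+1 isT.
    by field; rewrite h2 nat1r h3.
  rewrite -!natr1; rewrite !natrD !natrM -!natr1 in h1 *; field.
  by [].
- by rewrite /= !mul1r !muln1.
Qed.

Lemma pform_decomposition phi (a b : A) : fhom WA WB phi ->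
  exists h k : A, [/\ a = dX h + m%:R * vY * k, b = dY h - n%:R * vX * k,
    k 0%N 0%N = (a 0%N 1%N - b 1%N 0%N) / (n + m)%:R
  & pform phi a b = fderiv (phi h) + phi k * zar0 phi].
Proof.
move=> hphi; have [h [k [aE bE kE]]] := form_decomposition a b.
exists h, k; split=> //.
rewrite (pform_chain n0 nm hphi) /pform aE bE /zar0 rmorphD rmorphB !rmorphM !rmorph_nat.
by ring.
Qed.

Lemma mon_lead phi i j : lead phi ->
  ordB (n * i + m * j) (phi (vX ^+ i * vY ^+ j)) /\ phi (vX ^+ i * vY ^+ j) (n * i + m * j)%N = 1.
Proof.
move=> lphi; have hX := ordB_leadX lphi; have hY := ordB_leadY lphi.
have pw (f : B) a k : ordB a f -> f a = 1 -> ordB (a * k) (f ^+ k) /\ (f ^+ k) (a * k)%N = 1.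
  move=> hf f1; elim: k => [|k [IH1 IH2]]; first by rewrite muln0 fps1; split.
  by rewrite exprS mulnS; split; [apply: ordB_M|rewrite coefM_lead // f1 IH2 mulr1].
have [x1 x2] := pw _ _ i hX (leadX_coef lphi).
have [y1 y2] := pw _ _ j hY (leadY_coef lphi).
rewrite rmorphM !rmorphXn; split; first exact: ordB_M.
by rewrite coefM_lead // x2 y2 mulr1.
Qed.

(** With [th] = t d/dt, which multiplies t^k by k, the leading terms n m t^(n+m) cancel. The next
    term has coefficient n m b - n (m + e + 1) b = - n (e + 1) b at t^(n+m+e+1), nonzero in
    characteristic zero. *)
Lemma zar0_ord phi e b : lead phi -> b != 0 ->
  WB (n + e.+2)%N (phi vX - t ^+ n) ->
  WB (m + e.+2)%N (phi vY - (t ^+ m + fps_cst b * t ^+ (m + e.+1))) ->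
  hasord (zar0 phi) (n + m + e).
Proof.
move=> lphi b0 hx hy; pose th (f : B) : B := t * fderiv f.
have thE f k : th f k = k%:R * f k.
  by rewrite /th fpsXM; case: k => [|k]; rewrite ?mul0r // fderivE mulr_natl.
have thz : zmod_morphism th by move=> f g; rewrite /th fderiv_zmod mulrBr.
have thW k f : WB k f -> WB k (th f) by move=> h i lt; rewrite thE h ?mulr0.
have thX k : th (t ^+ k) = k%:R * t ^+ k.
  apply: fpsP => i; rewrite thE fps_natM fpsXn.
  by case: eqP => [->|_]; rewrite ?mulr0.
have ht : hasord t 1 by split; [rewrite /= oner_neq0|case].
apply: (hasord_divl ht).
have zE : t * zar0 phi = m%:R * phi vY * th (phi vX) - n%:R * phi vX * th (phi vY).
  by rewrite /zar0 /th; ring.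
pose x1 := phi vX - t ^+ n; pose y1 := phi vY - (t ^+ m + fps_cst b * t ^+ (m + e.+1)).
have xE : phi vX = t ^+ n + x1 by rewrite /x1; ring.
have yE : phi vY = t ^+ m + fps_cst b * t ^+ (m + e.+1) + y1 by rewrite /y1; ring.
have thC k : th (fps_cst b * t ^+ k) = fps_cst b * (k%:R * t ^+ k).
  by apply: fpsP => i; rewrite thE !fpsCM -thX thE; ring.
have tx : th (phi vX) = n%:R * t ^+ n + th x1 by rewrite xE (zmD thz) thX.
have ty : th (phi vY) = m%:R * t ^+ m + fps_cst b * ((m + e.+1)%:R * t ^+ (m + e.+1)) + th y1.
  by rewrite yE !(zmD thz) thX thC.
have tX k : ordB k (t ^+ k) by apply: ordB_Xn.
have hx' : WB (n + e.+2)%N (th x1) by apply: thW.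
have hy' : WB (m + e.+2)%N (th y1) by apply: thW.
have big k l (f g : B) : (n + m + e.+2 <= k + l)%N -> WB k f -> WB l g -> WB (n + m + e.+2)%N (f * g).
  by move=> le hf hg; apply: flW le (flM WB hf hg).
have hY := ordB_leadY lphi; have hX := ordB_leadX lphi.
apply: (@hasord_congr _ _ (fps_cst (- (n * e.+1)%:R * b) * t ^+ (n + m + e.+1)) _ (n + m + e.+2)).
- by lia.
- have -> : t * zar0 phi - fps_cst (- (n * e.+1)%:R * b) * t ^+ (n + m + e.+1)
    = m%:R * (phi vY * th x1) - n%:R * (x1 * th (phi vY))
      + n%:R * m%:R * (y1 * t ^+ n) - n%:R * (t ^+ n * th y1).
    have -> : fps_cst (- (n * e.+1)%:R * b) = - (n%:R * e.+1%:R) * fps_cst b.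
      by rewrite rmorphM rmorphN natrM rmorphM !rmorph_nat.
    rewrite zE tx ty xE yE natrD.
    rewrite (_ : (n + m + e.+1 = n + (m + e.+1))%N); last by lia.
    by rewrite [_ ^+ (n + _)]exprD; ring.
  apply: (flB WB); last by apply: (flMl (W := WB)); apply: (big _ _ _ _ _ (tX n) hy'); lia.
  apply: (flD (W := WB)); last by apply: (flMl (W := WB)); apply: (big _ _ _ _ _ hy (tX n)); lia.
  apply: (flB WB); first by apply: (flMl (W := WB)); apply: (big _ _ _ _ _ hY hx'); lia.
  by apply: (flMl (W := WB)); apply: (big _ _ _ _ _ hx (thW _ _ hY)); lia.
- have -> : (1 + (n + m + e) = n + m + e.+1)%N by lia.
  split; last by apply: (flMl (W := WB)); apply: ordB_Xn.
  rewrite fpsCM fpsXn eqxx mulr1 mulf_neq0 // oppr_eq0 nat0 //.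
  by rewrite muln_gt0 n0.
Qed.
Hypothesis ndvd : ~~ (n %| m)%N.

(** Distinct monomials of weight at most [n + m] have distinct weights. *)
Lemma small_weight_vanish phi (h : A) l : lead phi -> h 0%N 0%N = 0 ->
  (l <= (n + m).+1)%N -> ordB l (phi h) -> WA l h.
Proof.
move=> lphi h00 lnm hh; have [hphi _ _] := lphi.
suff H w : (w <= l)%N -> WA w h by apply: H.
elim: w => [|w IH] le; first exact: fl_all.
have Ww := IH (ltnW le); move=> i j; rewrite ltnS leq_eqVlt => /orP[/eqP wE|]; last exact: Ww.
pose mn : A := vX ^+ i * vY ^+ j.
have Wd : WA w.+1 (h - scA (h i j) * mn).
  move=> p q; rewrite ltnS leq_eqVlt => /orP[/eqP wE'|lt]; rewrite !fpsB scAM /mn monA_coef.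
    suff [-> ->] : p = i /\ q = j by rewrite !eqxx mulr1 subrr.
    have hq : (q <= 1)%N by rewrite leqNgt; apply/negP => ?; nia.
    have hj : (j <= 1)%N by rewrite leqNgt; apply/negP => ?; nia.
    have nd r s : (n * r = n * s + m)%N -> False.
      by move=> e; move/negP: ndvd; apply; rewrite -(dvdn_addr m (dvdn_mulr s (dvdnn n))) -e dvdn_mulr.
    have inj r s : (n * r = n * s)%N -> r = s by move/eqP; rewrite eqn_pmul2l // => /eqP.
    case: q j hq hj wE wE' {mn} => [|[|//]] [|[|//]] _ _ wE wE'.
    - by split=> //; apply: inj; lia.
    - by case: (nd p i); lia.
    - by case: (nd i p); lia.
    - by split=> //; apply: inj; lia.
  rewrite (Ww p q lt) sub0r; case: eqP => [ep|_]; case: eqP => [eq|_]; rewrite ?mulr0 ?oppr0 //.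
  by move: lt; rewrite ep eq wE ltnn.
have := hphi.2 _ _ Wd w (ltnSn w); rewrite rmorphB rmorphM hphi.1 fpsB fpsCM.
have [_ mnw] := mon_lead i j lphi; rewrite wE in mnw; rewrite mnw mulr1 hh //.
by move/eqP; rewrite sub0r oppr_eq0 => /eqP.
Qed.

End FormalReduction.

(** * Homotheties of the parameter *)

Section Scaling.
Variable F : fieldType.
Notation B := (fps F).

Definition fps_scale (s : F) (f : B) : B := Fps (fun k => s ^+ k * f k).

Fact fps_scale_zmod s : zmod_morphism (fps_scale s).
Proof. by move=> f g; apply: fpsP => k /=; rewrite mulrBr. Qed.
Fact fps_scale_mon s : monoid_morphism (fps_scale s).
Proof.
split=> [|f g]; apply: fpsP => k.
  by case: k => [|k] /=; rewrite ?mulr1 ?mulr0.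
rewrite [LHS]/= !fpsM mulr_sumr; apply: eq_bigr => i _ /=.
have le : (i <= k)%N by rewrite -ltnS.
by rewrite -{1}(subnKC le) exprD mulrACA.
Qed.
HB.instance Definition _ s := GRing.isZmodMorphism.Build B B (fps_scale s) (fps_scale_zmod s).
HB.instance Definition _ s := GRing.isMonoidMorphism.Build B B (fps_scale s) (fps_scale_mon s).

Lemma fps_scale_fhom s : fhom (filtB F) (filtB F) (fps_scale s).
Proof.
split=> [c|k f hf]; first by apply: fpsP => -[|k] /=; rewrite ?mul1r ?mulr0.
by move=> i lt; rewrite /= hf ?mulr0.
Qed.

Lemma fps_scale_X s : fps_scale s fpsX = fps_cst s * fpsX.
Proof. by apply: fpsP => -[|[|i]]; rewrite fpsCM /= ?expr1 ?mulr0 ?mulr1. Qed.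

Lemma fps_scaleK s : s != 0 -> cancel (fps_scale s) (fps_scale s^-1).
Proof.
by move=> s0 f; apply: fpsP => k /=; rewrite mulrA -exprMn mulVf // expr1n mul1r.
Qed.

Lemma fps_scaleVK s : s != 0 -> cancel (fps_scale s^-1) (fps_scale s).
Proof. by move=> s0; have := fps_scaleK (invr_neq0 s0); rewrite invrK. Qed.
End Scaling.

(** * Removable coefficients, the Zariski invariant and the formal reduction *)

Section FormalReduction.
Variable F : fieldType.
Hypothesis nat0 : forall k, (0 < k)%N -> k%:R != 0 :> F.
Variables n m : nat.
Hypotheses (n0 : (0 < n)%N) (nm : (n < m)%N).
Notation B := (fps F).
Notation A := (fps (fps F)).
Notation WB := (filtB F).
Notation WA := (filtA F n m).
Notation t := (fpsX : fps F).
Implicit Types (phi psi : {rmorphism A -> B}).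
Notation lead := (@lead F n m).
Notation fequiv := (@fequiv F n m).

Let m0 : (0 < m)%N := ltn_trans n0 nm.
Notation genA' := (genA_generated F n0 (ltn_trans n0 nm)).

Lemma scaleA_faut (a b : F) : a != 0 -> b != 0 -> exists S S' : {rmorphism A -> A},
  [/\ faut WA S S', S vX = scA a * vX, S vY = scA b * vY,
      S' vX = scA a^-1 * vX & S' vY = scA b^-1 * vY].
Proof.
have half c d : exists S : {rmorphism A -> A},
    [/\ fhom WA WA S, S vX = scA c * vX & S vY = scA d * vY].
  have hX : WA n (scA c * vX) by apply: flMl; apply: ordA_vX.
  have hY : WA m (scA d * vY) by apply: flMl; apply: ordA_vY.
  have [S [SX SY hS]] := subst2_ex (flW n0 hX) (flW m0 hY).
  by exists S; split=> //; apply: hS.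
have [S [hS SX SY]] := half a b; have [S' [hS' SX' SY']] := half a^-1 b^-1.
move=> a0 b0.
have scS : forall c, S (scA c) = scA c := hS.1.
have scS' : forall c, S' (scA c) = scA c := hS'.1.
exists S, S'; split=> //; split=> //.
  apply: (@hom_uniq _ _ _ _ _ _ genA' (S' \o S) idfun); [exact: fhom_comp hS hS'|exact: fhom_id|].
  by move=> k x [[_ ->]|[_ ->]] /=; rewrite ?SX ?SY rmorphM scS' ?SX' ?SY' mulrA -rmorphM
    mulfV // rmorph1 mul1r.
apply: (@hom_uniq _ _ _ _ _ _ genA' (S \o S') idfun); [exact: fhom_comp hS' hS|exact: fhom_id|].
by move=> k x [[_ ->]|[_ ->]] /=; rewrite ?SX' ?SY' rmorphM scS ?SX ?SY mulrA -rmorphM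
  mulVf // rmorph1 mul1r.
Qed.

(** The homotheties (s^n X, s^m Y) and s t keep the leading coefficients and multiply the
    coefficient of t^(m+j) in Y by s^(-j). *)
Lemma scaling phi s : lead phi -> s != 0 ->
  exists psi, [/\ lead psi, fequiv phi psi,
    forall k, psi vX k = s ^+ n * (s ^- k * phi vX k)
  & forall k, psi vY k = s ^+ m * (s ^- k * phi vY k)].
Proof.
move=> lphi s0.
have [S [S' [hSS SX SY _ _]]] := scaleA_faut (expf_neq0 n s0) (expf_neq0 m s0).
have [hS hS' SK S'K] := hSS.
pose R : {rmorphism B -> B} := fps_scale s; pose R' : {rmorphism B -> B} := fps_scale s^-1.
have hR : fhom WB WB R := fps_scale_fhom s; have hR' : fhom WB WB R' := fps_scale_fhom s^-1.
have RK : cancel R R' := fps_scaleK s0; have R'K : cancel R' R := fps_scaleVK s0.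
have u k : s ^- k * s ^+ k = 1 by rewrite mulVf // expf_neq0.
have [hphi hX hY] := lphi.
pose psi : {rmorphism A -> B} := R' \o phi \o S.
have hpsi : fhom WA WB psi := fhom_comp hS (fhom_comp hphi hR').
have psiX k : psi vX k = s ^+ n * (s ^- k * phi vX k).
  by rewrite /psi /= SX rmorphM hphi.1 fpsCM exprVn mulrCA.
have psiY k : psi vY k = s ^+ m * (s ^- k * phi vY k).
  by rewrite /psi /= SY rmorphM hphi.1 fpsCM exprVn mulrCA.
have lcoef (f g : B) k : (forall i, g i = s ^+ k * (s ^- i * f i)) ->
    ordB k.+1 (f - t ^+ k) -> ordB k.+1 (g - t ^+ k).
  move=> gE hf i lt; rewrite fpsB gE fpsXn.
  have := hf i lt; rewrite fpsB fpsXn => /eqP; rewrite subr_eq0 => /eqP ->.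
  by case: eqP => [->|_]; rewrite ?mulr0 ?subr0 // mulr1 mulrC u subrr.
exists psi; split=> //; first by split=> //; [apply: lcoef hX|apply: lcoef hY].
exists S, S', R, R'; split=> // h.
by rewrite /psi /= R'K.
Qed.

Lemma phi_const phi h : fhom WA WB phi -> phi h 0%N = h 0%N 0%N.
Proof.
move=> hphi.
have Wh : WA 1 (h - scA (h 0%N 0%N)).
  move=> i j lt; have [-> ->] : i = 0%N /\ j = 0%N by split; nia.
  by rewrite !fpsB /= subrr.
have := hphi.2 _ _ Wh 0%N isT; rewrite rmorphB hphi.1 fpsB /= => /eqP.
by rewrite subr_eq0 => /eqP.
Qed.

Lemma exact_Gam phi h o : fhom WA WB phi -> hasord (fderiv (phi h)) o -> Gam phi o.+1.
Proof.
move=> hphi /(fderiv_hasord_inv nat0) hh; exists (h - scA (phi h 0%N)).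
by rewrite rmorphB hphi.1.
Qed.

Definition zariski phi lam :=
  [/\ Lam phi (lam + n)%N, ~ Gam phi (lam + n)%N
    & forall v, Lam phi v -> ~ Gam phi v -> (lam + n <= v)%N].

(** Write a form as dh plus k times the form behind [zar0]. If its value is below that of [zar0],
    then dh has the same value, and the value of an exact form is the value of a function. *)
Lemma zariski_zar0 phi e : lead phi -> hasord (zar0 n m phi) (n + m + e) ->
  ~ Gam phi (m + e.+1 + n)%N -> zariski phi (m + e.+1).
Proof.
move=> lphi hz nG; have [hphi _ _] := lphi; split=> //.
  exists (m%:R * vY), (- (n%:R * vX)), (n + m + e)%N; split; last by lia.
  suff -> : pform phi (m%:R * vY) (- (n%:R * vX)) = zar0 n m phi by [].
  by rewrite /pform /zar0 rmorphN !rmorphM !rmorph_nat; ring.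
move=> v [a [b [o [ho ->]]]] nGv; rewrite leqNgt; apply/negP => lt; apply: nGv.
have [h [k [_ _ _ pE]]] := pform_decomposition nat0 n0 nm a b hphi.
apply: (@exact_Gam _ h _ hphi); apply: (hasord_congr (l := (n + m + e)%N) _ _ ho).
  by lia.
have -> : fderiv (phi h) - pform phi a b = - (phi k * zar0 n m phi) by rewrite pE; ring.
by apply: (flN (W := WB)); apply: (flMl (W := WB)); case: hz.
Qed.

Hypothesis ndvd : ~~ (n %| m)%N.

(** A function of value above n + m has, by [small_weight_vanish], only monomials of weight above n
    + m. Its differential is the required form, and the vector field is the Hamiltonian field of h
    up to sign. *)
Lemma unipotent_of_Gam phi e : lead phi -> Gam phi (m + e.+1 + n)%N ->
  exists g1 g2, [/\ WA n.+1 g1, WA m.+1 g2 & hasord (pform phi g2 (- g1)) (n + m + e)].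
Proof.
move=> lphi [h hh]; have [hphi _ _] := lphi.
have h00 : h 0%N 0%N = 0 by rewrite -(phi_const h hphi); case: hh => _; apply; lia.
have hE : (m + e.+1 + n = (n + m + e).+1)%N by lia.
rewrite hE in hh.
have Wh : WA (n + m).+1 h.
  apply: (small_weight_vanish n0 nm ndvd lphi h00 (leqnn _)).
  by case: hh => _ hh; apply: (flW (W := WB) _ hh); lia.
exists (- dY h), (dX h); split.
- apply: (flN (W := WA)) => i j lt; rewrite dYE Wh ?mul0rn //; lia.
- by move=> i j lt; rewrite dXE Wh ?mul0rn //; lia.
- by rewrite opprK -(pform_chain n0 nm hphi); apply: fderiv_hasord.
Qed.

(** If k did not vanish at the origin, dh would have to cancel k times the form of [zar0] to leading
    order and would share its value, which is not in [Gam]. So k has weight at least n, the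
    pull-back of dh has order at least n + m, and h without its constant term has weight above n +
    m. *)
Lemma unipotent_of_Lam phi e e' : lead phi -> hasord (zar0 n m phi) (n + m + e') ->
  ~ Gam phi (m + e'.+1 + n)%N -> (e' < e)%N -> Lam phi (m + e.+1 + n)%N ->
  exists g1 g2, [/\ WA n.+1 g1, WA m.+1 g2 & hasord (pform phi g2 (- g1)) (n + m + e)].
Proof.
move=> lphi hz nG lt [a [b [o [ho oE]]]]; have [hphi _ _] := lphi.
have {}oE : o = (n + m + e)%N by lia.
rewrite {}oE in ho.
have [h [k [aE bE _ pE]]] := pform_decomposition nat0 n0 nm a b hphi.
have k00 : k 0%N 0%N = 0.
  apply/eqP/negPn/negP => k0; apply: nG.
  have -> : (m + e'.+1 + n = (n + m + e').+1)%N by lia.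
  apply: (@exact_Gam _ h _ hphi).
  have hk : hasord (phi k) 0 by split; rewrite ?phi_const.
  have [kz0 kz] := hasordM hk hz; rewrite add0n in kz0 kz.
  apply: (@hasord_congr _ _ (- (phi k * zar0 n m phi)) _ (n + m + e)) => //.
  - by lia.
  - have -> : fderiv (phi h) - - (phi k * zar0 n m phi) = pform phi a b by rewrite pE; ring.
    by case: ho.
  - by split; [rewrite fpsN oppr_eq0|apply: (flN (W := WB))].
have Wk : WA n k.
  move=> i j lt'; have [-> ->] : i = 0%N /\ j = 0%N by split; nia.
  exact: k00.
pose h0 := h - scA (h 0%N 0%N).
have Wh : WA (n + m).+1 h0.
  apply: (small_weight_vanish n0 nm ndvd lphi) => //; first by rewrite !fpsB /= subrr.
  rewrite rmorphB hphi.1 -(phi_const h hphi); apply: (fderiv_ord_inv nat0).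
  have -> : fderiv (phi h) = pform phi a b - phi k * zar0 n m phi by rewrite pE; ring.
  case: ho => _ ho; case: hz => _ hz.
  apply: (flB WB); first by apply: (flW (W := WB) _ ho); lia.
  by apply: (flW (W := WB) _ (flM WB (hphi.2 _ _ Wk) hz)); lia.
have [dXz _ dXc _] := dX_isder F n m; have [dYz _ dYc _] := dY_isder F n m.
have dX0 : dX h0 = dX h by rewrite /h0 dXz dXc subr0.
have dY0 : dY h0 = dY h by rewrite /h0 dYz dYc subr0.
have WX := @ordA_vX F n m; have WY := @ordA_vY F n m.
exists (- b), a; split; rewrite ?opprK //.
- apply: (flN (W := WA)); rewrite bE -dY0; apply: (flB WA).
    by move=> i j lt'; rewrite dYE Wh ?mul0rn //; lia.
  by rewrite -mulrA; apply: (flMl (W := WA)); apply: (flW (W := WA) _ (flM WA WX Wk)); lia.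
- rewrite aE -dX0; apply: (flD (W := WA)).
    by move=> i j lt'; rewrite dXE Wh ?mul0rn //; lia.
  by rewrite -mulrA; apply: (flMl (W := WA)); apply: (flW (W := WA) _ (flM WA WY Wk)); lia.
Qed.

(* The reduction first clears the coefficients beyond [t ^+ m] as long as no Zariski
   invariant shows up, then the coefficients beyond the invariant. *)
Definition straightened_upto phi N := exists psi, [/\ lead psi, fequiv phi psi,
  WB (n + N.+1)%N (psi vX - t ^+ n) & WB (m + N.+1)%N (psi vY - t ^+ m)].

Definition normal_upto phi N := exists lam psi, [/\ (m < lam <= m + N)%N /\ zariski phi lam,
  lead psi, fequiv phi psi, WB (n + N.+1)%N (psi vX - t ^+ n)
  & forall k, (k < m + N.+1)%N -> ~ ((lam < k)%N /\ ~ Lam phi (k + n)%N) ->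
      psi vY k = (k == m)%:R + (k == lam)%:R].

Lemma coefs_of_ordB k (f g : B) i : ordB k (f - g) -> (i < k)%N -> f i = g i.
Proof. by move=> h lt; have /eqP := h i lt; rewrite fpsB subr_eq0 => /eqP. Qed.

Lemma fequiv_zariski phi psi lam : lead phi -> lead psi -> fequiv phi psi ->
  zariski psi lam -> zariski phi lam.
Proof.
move=> [h1 _ _] [h2 _ _] fe.
have G v := fequiv_Gam v fe; have L v := fequiv_Lam nat0 n0 nm v h1 h2 fe.
by move=> [a b c]; split=> [||v /L Lv nG]; [apply/L|move/G|apply: c => // /G].
Qed.

Hypothesis root_ex : forall (b : F) k, exists s, s ^+ k.+1 = b.

Lemma reduction phi N : lead phi -> straightened_upto phi N \/ normal_upto phi N.
Proof.
move=> lphi; have [hphi hX hY] := lphi.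
elim: N => [|N [[psi [lpsi fe pX pY]]|[lam [psi [[lamN zar] lpsi fe pX pY]]]]].
- by left; exists phi; split; rewrite ?addn1 //; apply: fequiv_refl.
- have [psi1 [l1 fe1 X1 Y1]] := eliminateX nat0 n0 nm lpsi pX.
  have {}fe1 := fequiv_trans fe fe1.
  have {Y1}pY : WB (m + N.+1)%N (psi1 vY - t ^+ m) := fl_trans (W:=WB) Y1 pY.
  have [h1 _ _] := l1.
  have Geq v := fequiv_Gam v fe1.
  (* Three cases for the next coefficient of Y: its index plus n is the value of a function and the
     coefficient can be removed; or it is already zero; or its index is the Zariski invariant. *)
  case: (pselect (Gam psi1 (m + N.+1 + n)%N)) => [G|nG].
    have [g1 [g2 [Wg1 Wg2 hg]]] := unipotent_of_Gam l1 G.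
    have [psi2 [l2 fe2 X2 Y2 Y2c]] := eliminateY nat0 n0 nm l1 Wg1 Wg2 hg.
    left; exists psi2; split=> //; first exact: fequiv_trans fe1 fe2.
      exact: (fl_trans (W := WB) X2 X1).
    rewrite addnS; apply: ordB_S; first exact: (fl_trans (W := WB) Y2 pY).
    by rewrite fpsB Y2c fpsXn sub0r; case: eqP => [|_]; [lia|rewrite oppr0].
  have [b0|b0] := eqVneq (psi1 vY (m + N.+1)%N) 0.
    left; exists psi1; split=> //; rewrite addnS; apply: ordB_S => //.
    by rewrite fpsB b0 fpsXn sub0r; case: eqP => [|_]; [lia|rewrite oppr0].
  right; set b := psi1 vY _ in b0.
  have hz : hasord (zar0 n m psi1) (n + m + N).
    apply: (@zar0_ord F nat0 n m n0 nm psi1 N b) => //.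
    rewrite addnS; apply: ordB_S.
      rewrite opprD addrA; apply: (flB WB pY); apply: (flMl (W := WB)); exact: ordB_Xn.
    rewrite fpsB fpsD fpsCM !fpsXn eqxx mulr1 -/b.
    by case: eqP => [|_]; [lia|rewrite add0r subrr].
  have zar1 := zariski_zar0 l1 hz nG.
  (* With s^(N+1) = b, the homothety turns the coefficient b of t^(m+N+1) into 1. *)
  have [s sE] := root_ex b N.
  have s0 : s != 0 by apply: contraNneq b0 => s0; rewrite -sE s0 expr0n.
  have [psi2 [l2 fe2 X2 Y2]] := scaling l1 s0.
  have fe12 := fequiv_trans fe1 fe2.
  exists (m + N.+1)%N, psi2; split=> //.
  - split; first by lia.
    exact: fequiv_zariski fe1 zar1.
  - move=> i lt; rewrite fpsB X2 (coefs_of_ordB X1 lt) fpsXn.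
    by case: eqP => [->|_]; rewrite ?mulr0 ?subr0 // mulr1 mulfV ?subrr // expf_neq0.
  - move=> k lt _; rewrite Y2.
    case: (ltngtP k (m + N.+1)) => [lt'|gt|->].
    + rewrite (coefs_of_ordB pY lt') fpsXn addr0.
      by case: eqP => [->|_]; rewrite ?mulr0 // mulr1 mulfV // expf_neq0.
    + by lia.
    + rewrite -/b -sE mulrCA -exprD mulVf ?expf_neq0 //.
      by case: eqP => [|_]; [lia|rewrite add0r].
- have [psi1 [l1 fe1 X1 Y1]] := eliminateX nat0 n0 nm lpsi pX.
  have {}fe1 := fequiv_trans fe fe1.
  have {Y1}pY k : (k < m + N.+1)%N -> ~ ((lam < k)%N /\ ~ Lam phi (k + n)%N) ->
      psi1 vY k = (k == m)%:R + (k == lam)%:R.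
    by move=> lt; rewrite (coefs_of_ordB Y1 lt); apply: pY.
  have [h1 _ _] := l1.
  have Leq v := fequiv_Lam nat0 n0 nm v hphi h1 fe1.
  (* Beyond the invariant, a coefficient is left free when its index plus n is not in Lambda, and
     removed otherwise. *)
  case: (pselect (Lam phi (m + N.+1 + n)%N)) => [/Leq L|nL]; last first.
    right; exists lam, psi1; split=> //; first by split=> //; lia.
    move=> k; rewrite addnS ltnS leq_eqVlt => /orP[/eqP ->|lt]; last exact: pY.
    by case; split=> //; lia.
  pose e' := (lam - m.+1)%N; have lamE : lam = (m + e'.+1)%N by rewrite /e'; lia.
  have [zL zG zmin] := zar.
  have hz : hasord (zar0 n m psi1) (n + m + e').
    apply: (@zar0_ord F nat0 n m n0 nm psi1 e' 1) => //; first exact: oner_neq0.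
      by apply: (flW (W := WB) _ X1); lia.
    rewrite rmorph1 mul1r => i lt; rewrite fpsB fpsD !fpsXn pY; first by rewrite -lamE subrr.
      by lia.
    by case; lia.
  have [| |g1 [g2 [Wg1 Wg2 hg]]] := unipotent_of_Lam l1 hz _ _ L.
  - by rewrite -lamE => /(fequiv_Gam _ fe1).
  - by lia.
  have [psi2 [l2 fe2 X2 Y2 Y2c]] := eliminateY nat0 n0 nm l1 Wg1 Wg2 hg.
  right; exists lam, psi2; split=> //.
  + by split=> //; lia.
  + exact: fequiv_trans fe1 fe2.
  + exact: (fl_trans (W := WB) X2 X1).
  + move=> k; rewrite addnS ltnS leq_eqVlt => /orP[/eqP -> _|lt].
      by rewrite Y2c; case: eqP => [|_]; [lia|case: eqP => [|_]; [lia|rewrite addr0]].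
    by rewrite (coefs_of_ordB Y2 lt); apply: pY.
Qed.
End FormalReduction.

(** * Uniqueness of the formal normal form *)

Section FormalUniqueness.
Variable F : fieldType.
Hypothesis nat0 : forall k, (0 < k)%N -> k%:R != 0 :> F.
Variables n m : nat.
Hypotheses (n0 : (0 < n)%N) (nm : (n < m)%N).
Notation B := (fps F).
Notation A := (fps (fps F)).
Notation WB := (filtB F).
Notation WA := (filtA F n m).
Notation t := (fpsX : fps F).
Implicit Types (phi psi : {rmorphism A -> B}).
Notation lead := (@lead F n m).

Notation genA' := (genA_generated F n0 (ltn_trans n0 nm)).

(** If [psi] is obtained from [phi] by a unipotent equivalence, the logarithms of the two
    automorphisms yield a differential whose value is read off the first coefficient where
    [psi] and [phi] differ. *)
Lemma log_variation phi psi (S : {rmorphism A -> A}) (R : {rmorphism B -> B}) e b :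
  lead phi -> fhom WA WB psi -> fhom WA WA S -> fhom WB WB R ->
  (forall k h, WA k h -> WA k.+1 (S h - h)) ->
  (forall k f, WB k f -> WB k.+1 (R f - f)) ->
  (forall h, phi (S h) = R (psi h)) ->
  psi vX = phi vX -> WB (m + e.+2)%N (psi vY - phi vY - fps_cst b * t ^+ (m + e.+1)) ->
  b != 0 ->
  exists g1 g2, [/\ WA n.+1 g1, WA m.+1 g2 & hasord (pform phi g2 (- g1)) (n + m + e)].
Proof.
move=> lphi hpsi hS hR S1 R1 E eX eY b0; have [hphi _ _] := lphi.
pose U (h : A) := S h - h; pose V (f : B) := R f - f.
have hU : raises WA 1 U.
  by split=> [x y|k x Wx]; [rewrite /U rmorphB; ring|rewrite addn1; apply: S1].
have hV : raises WB 1 V.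
  by split=> [x y|k x Wx]; [rewrite /V rmorphB; ring|rewrite addn1; apply: R1].
have thE h : phi (U h) - V (phi h) = R (psi h - phi h).
  by rewrite /U /V !rmorphB E; ring.
have be : WB (m + e.+1)%N (fps_cst b * t ^+ (m + e.+1)).
  by apply: (flMl (W := WB)); apply: ordB_Xn.
have dif : WB (m + e.+1)%N (psi vY - phi vY).
  by apply: (fl_congr _ be); apply: (flW (W := WB) _ eY); lia.
have th w h : WA w h -> WB (w + e.+1)%N (phi (U h) - V (phi h)).
  move=> Wh; rewrite thE; apply: hR.2.
  apply: (hom_diff_raise genA' hpsi hphi _ Wh) => k x [[-> ->]|[-> ->]] //.
  by rewrite eX subrr; apply: fl_zero.
have phiZ x a : phi (sc WA x * a) = sc WB x * phi a by rewrite rmorphM hphi.1.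
have cmp := opser_compare (@log_coef F) hphi (rmorphB phi) phiZ hU hV th.
(* On the plane only the values of log S on X and Y enter. On the line log R has to be a derivation,
   so that it is [eps] times d/dt. *)
pose g1 := opser WA U (@log_coef F) vX; pose g2 := opser WA U (@log_coef F) vY.
pose eps := opser WB V (@log_coef F) t.
have dlog : isder WB (opser WB V (@log_coef F)) := log_isder nat0 hR R1.
have epsE (f : B) : opser WB V (@log_coef F) f = fderiv f * eps.
  exact: (chainB dlog (f := idfun) (fhom_id WB)).
have c1 : sc WB (log_coef F 1) = 1 by rewrite /log_coef expr0 divr1 rmorph1.
have th1 : WB (n + e.+2)%N (phi g1 - eps * fderiv (phi vX)).
  have := cmp _ _ (@ordA_vX F n m); rewrite c1 mul1r thE eX subrr raddf0 subr0 epsE.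
  by rewrite mulrC -addnS.
have th2 : WB (m + e.+2)%N (phi g2 - eps * fderiv (phi vY) - fps_cst b * t ^+ (m + e.+1)).
  have h1 := cmp _ _ (@ordA_vY F n m); rewrite c1 mul1r thE epsE mulrC -addnS in h1.
  apply: (fl_trans (W := WB) h1).
  have h2 := R1 _ _ dif; rewrite -addnS in h2.
  exact: (fl_trans (W := WB) h2 eY).
have low w (h : A) : WA w h -> WA w.+1 (opser WA U (@log_coef F) h).
  by move=> Wh; have := opser_lead hU (@log_coef F) Wh; rewrite /= rmorph0 mul0r subr0.
exists g1, g2; split; [exact/low/ordA_vX|exact/low/ordA_vY|].
clear epsE; clearbody g1 g2 eps.
have [dX0 dXn] := lead_dX n0 lphi; have dY0 := lead_dY n0 nm lphi.
have hdX : hasord (fderiv (phi vX)) n.-1 by split=> //; rewrite dXn nat0.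
have h2 : hasord (phi g2 - eps * fderiv (phi vY)) (m + e.+1).
  apply: (hasord_congr _ th2); first by lia.
  by split=> //; rewrite fpsCM fpsXn eqxx mulr1.
have h3 := hasordM h2 hdX.
have -> : (n + m + e = m + e.+1 + n.-1)%N by lia.
apply: (@hasord_congr _ _ _ _ (n + m + e.+1) _ _ h3); first by lia.
have -> : pform phi g2 (- g1) - (phi g2 - eps * fderiv (phi vY)) * fderiv (phi vX)
    = - ((phi g1 - eps * fderiv (phi vX)) * fderiv (phi vY)).
  by rewrite /pform rmorphN; ring.
by apply: (flN (W := WB)); apply: (flW (W := WB) _ (flM WB th1 dY0)); lia.
Qed.

Definition normal_form (lam : nat) (L : nat -> Prop) (y : B) :=
  forall k, ~ ((lam < k)%N /\ ~ L (k + n)%N) -> y k = (k == m)%:R + (k == lam)%:R.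

(** If lam <= m, then y has order lam, with leading coefficient 1, or 2 when lam = m, and XY has the
    value lam + n. *)
Lemma lam_gt phi lam L : phi vX = t ^+ n -> normal_form lam L (phi vY) ->
  ~ Gam phi (lam + n)%N -> (m < lam)%N.
Proof.
move=> hX hY nG; rewrite ltnNge; apply/negP => le; apply: nG.
exists (vY * vX); rewrite rmorphM; apply: hasordM; last first.
  by rewrite hX; split; [rewrite fpsXn eqxx oner_neq0|apply: ordB_Xn].
split=> [|k lt]; rewrite hY.
- by rewrite eqxx -natrD nat0 // addn_gt0 orbT.
- by case; lia.
- by case: eqP => [|_]; [lia|case: eqP => [|_]; [lia|rewrite addr0]].
- by case; lia.
Qed.

Hypothesis ndvd : ~~ (n %| m)%N.

(** That [S] is filtered for the weights (n, m) is derived here, not assumed. The orders of phi (S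
    X) = R (t^n) and phi (S Y) = R (psi Y) show through [small_weight_vanish] that S X is r^n X and
    S Y is r^m Y up to higher weights, where r is the linear coefficient of [R t]. *)
Lemma formal_uniqueness phi psi (S : {rmorphism A -> A}) (R : {rmorphism B -> B}) lam L :
  lead phi -> lead psi -> phi vX = t ^+ n -> psi vX = t ^+ n ->
  normal_form lam L (phi vY) -> normal_form lam L (psi vY) ->
  (forall v, L v <-> Lam phi v) -> ~ Gam phi (lam + n)%N ->
  (S vX) 0%N 0%N = 0 -> (S vY) 0%N 0%N = 0 ->
  (WA n (S vX) -> WA m (S vY) -> fhom WA WA S) ->
  fhom WB WB R -> R t 1%N != 0 ->
  (forall h, phi (S h) = R (psi h)) ->
  exists r, [/\ r != 0, r ^+ (lam - m) = 1 &
    forall i, (lam < i)%N -> phi vY i = r ^+ (i - m) * psi vY i].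
Proof.
move=> lphi lpsi eX eX' nf nf' LL nG SX0 SY0 hS hR; set r := R t 1%N => r0 E.
have [hphi _ _] := lphi; have [hpsi _ _] := lpsi.
have lt_mlam := lam_gt eX nf nG.
have ht : hasord (R t) 1 by split=> //; apply/hR.2/ordB_X.
have Rlead k : ordB k.+1 (R (t ^+ k) - fps_cst (r ^+ k) * t ^+ k).
  have hk : ordB k ((R t) ^+ k) /\ ((R t) ^+ k) k = r ^+ k.
    elim: k => [|k [IH1 IH2]]; first by rewrite fps1.
    rewrite !exprS -add1n; split; first by apply: ordB_M IH1; case: ht.
    by rewrite coefM_lead //; [rewrite IH2|case: ht].
  rewrite rmorphXn; apply: ordB_S.
    by apply: (flB WB hk.1); apply: (flMl (W := WB)); apply: ordB_Xn.
  by rewrite fpsB fpsCM fpsXn eqxx mulr1 hk.2 subrr.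
have hX1 : WA n.+1 (S vX - scA (r ^+ n) * vX).
  apply: (small_weight_vanish n0 nm ndvd lphi).
  - by rewrite !fpsB scAM vX_coef SX0 mulr0 subrr.
  - by lia.
  - by rewrite rmorphB E eX' rmorphM hphi.1 eX; apply: Rlead.
have hY1 : WA m.+1 (S vY - scA (r ^+ m) * vY).
  apply: (small_weight_vanish n0 nm ndvd lphi).
  - by rewrite !fpsB scAM vY_coef SY0 mulr0 subrr.
  - by lia.
  - rewrite rmorphB E rmorphM hphi.1.
    have [_ _ y1] := lphi; have [_ _ y2] := lpsi.
    have h1 := hR.2 _ _ y2; rewrite rmorphB in h1.
    have h2 := fl_trans (W := WB) h1 (Rlead m).
    apply: (fl_trans (W := WB) h2); rewrite -mulrBr.
    by apply: (flMl (W := WB)); apply: (fl_sym (W := WB)).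
have {}hS : fhom WA WA S.
  apply: hS; [apply: (fl_congr (flW (W := WA) (leqnSn _) hX1))
             |apply: (fl_congr (flW (W := WA) (leqnSn _) hY1))]; apply: flMl.
    exact: ordA_vX.
  exact: ordA_vY.
have [H [H' [[hH _ _ _] HX HY _ _]]] := scaleA_faut n0 nm (invr_neq0 (expf_neq0 n r0)) (invr_neq0 (expf_neq0 m r0)).
pose T : {rmorphism B -> B} := fps_scale r^-1; pose T' : {rmorphism B -> B} := fps_scale r.
have hT : fhom WB WB T := fps_scale_fhom r^-1; have hT' : fhom WB WB T' := fps_scale_fhom r.
have TK : cancel T' T := fps_scaleK r0.
pose S1 : {rmorphism A -> A} := S \o H.
pose R1 : {rmorphism B -> B} := R \o T.
pose chi : {rmorphism A -> B} := T' \o psi \o H.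
have hS1 : fhom WA WA S1 := fhom_comp hH hS.
have hR1 : fhom WB WB R1 := fhom_comp hT hR.
have hchi : fhom WA WB chi := fhom_comp hH (fhom_comp hpsi hT').
have chiX : chi vX = t ^+ n.
  rewrite /chi /= HX rmorphM hpsi.1 eX'; apply: fpsP => k.
  rewrite /= fpsCM mulrCA fpsXn; case: eqP => [->|_]; rewrite ?mulr0 //.
  by rewrite mulr1 mulVf // expf_neq0.
have chiY k : chi vY k = r ^- m * (r ^+ k * psi vY k).
  by rewrite /chi /= HY rmorphM hpsi.1 fpsCM mulrCA.
have E1 h : phi (S1 h) = R1 (chi h) by rewrite /S1 /R1 /chi /= TK E.
have u k : r ^- k * r ^+ k = 1 by rewrite mulVf // expf_neq0.
have S1S k h : WA k h -> WA k.+1 (S1 h - h).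
  move=> Wh; rewrite -addn1.
  apply: (hom_diff_raise genA' (g := idfun) hS1 (fhom_id WA) _ Wh).
  have aux w v c (x : A) : v * c = 1 -> WA w (S x - scA c * x) -> WA w (S (scA v * x) - x).
    move=> vc Wx; have := flMl (W := WA) (scA v) Wx; rewrite mulrBr mulrA -rmorphM vc.
    by rewrite rmorph1 mul1r rmorphM hS.1.
  move=> l x [[-> ->]|[-> ->]]; rewrite addn1 /S1 /=.
    by rewrite HX; apply: aux hX1.
  by rewrite HY; apply: aux hY1.
have R1R k f : WB k f -> WB k.+1 (R1 f - f).
  move=> Wf; rewrite -addn1.
  apply: (hom_diff_raise (genB_generated F) (g := idfun) hR1 (fhom_id WB) _ Wf).
  move=> l x [-> ->]; rewrite /R1 /= fps_scale_X rmorphM hR.1 => -[|[|//]] _; rewrite fpsB fpsCM /=.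
    by case: ht => _ -> //; rewrite mulr0 subrr.
  by rewrite mulVf // subrr.
have key : forall k, phi vY k = chi vY k.
  apply: contrapT => /existsNP neq.
  have ex : exists k, phi vY k != chi vY k by case: neq => k /eqP; exists k.
  case: (ex_minnP ex) => i ne imin {neq ex}.
  have below k : (k < i)%N -> phi vY k = chi vY k.
    by move=> lt; apply/eqP/negPn/negP => /imin; lia.
  have gt_im : (m < i)%N.
    rewrite ltnNge; apply/negP => le; case/eqP: ne; rewrite chiY.
    move: le; rewrite leq_eqVlt => /orP[/eqP ->|lt].
      by rewrite !(leadY_coef lphi, leadY_coef lpsi) mulr1 u.
    by rewrite (ordB_leadY lphi lt) (ordB_leadY lpsi lt) !mulr0.
  pose e := (i - m.+1)%N; have iE : i = (m + e.+1)%N by rewrite /e; lia.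
  pose b := chi vY i - phi vY i.
  have b0 : b != 0 by rewrite subr_eq0 eq_sym.
  have eY : WB (m + e.+2)%N (chi vY - phi vY - fps_cst b * t ^+ (m + e.+1)).
    rewrite addnS -iE => k; rewrite ltnS leq_eqVlt !fpsB fpsCM fpsXn => /orP[/eqP ->|lt].
      by rewrite eqxx mulr1 subrr.
    by rewrite below // subrr; case: eqP lt => [->|_ _]; rewrite ?ltnn ?mulr0 ?subr0.
  have [|g1 [g2 [Wg1 Wg2 hg]]] := log_variation lphi hchi hS1 hR1 S1S R1R E1 _ eY b0.
    by rewrite chiX eX.
  have Li : Lam phi (i + n)%N by exists g2, (- g1), (n + m + e)%N; split=> //; lia.
  (* For i other than lambda, membership of i + n in Lambda forces the coefficient at i to be 0 in
     both normal forms. *)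
  have [ilam|ilam] := eqVneq i lam; last first.
    case/eqP: ne; rewrite chiY.
    have nin : ~ ((lam < i)%N /\ ~ L (i + n)%N) by case=> _; apply; apply/LL.
    rewrite nf // nf' // (negPf ilam); case: eqP => [e1|_]; first by lia.
    by rewrite addr0 !mulr0.
  have hz : hasord (zar0 n m phi) (n + m + e).
    apply: (@zar0_ord F nat0 n m n0 nm phi e 1) => //; first exact: oner_neq0.
      by rewrite eX subrr; apply: fl_zero.
    rewrite rmorph1 mul1r -iE addnS -iE ilam => k lt; rewrite fpsB fpsD !fpsXn nf ?subrr //.
    by case; lia.
  have [h [k [_ _ kE pE]]] := pform_decomposition nat0 n0 nm g2 (- g1) hphi.
  (* The constant term of k is a multiple of the coefficient of Y in g2 plus that of X in g1, and
     both vanish for weight reasons. So k times the form of [zar0] has larger order, dh alone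
     carries the value, and lambda + n would be in [Gam]. *)
  have k00 : k 0%N 0%N = 0.
    have e1 : g2 0%N 1%N = 0 by apply: Wg2; rewrite muln0 muln1.
    have e2 : g1 1%N 0%N = 0 by apply: Wg1; rewrite muln0 muln1 addn0.
    by rewrite kE !fpsN e1 e2 oppr0 subrr mul0r.
  have Wk : ordB 1 (phi k) by case=> // _; rewrite (phi_const n0 nm k hphi).
  apply: nG; rewrite -ilam iE; have -> : (m + e.+1 + n = (n + m + e).+1)%N by lia.
  apply: (@exact_Gam _ nat0 n m phi h _ hphi).
  apply: (hasord_congr (l := (n + m + e).+1) _ _ hg) => //.
  have -> : fderiv (phi h) - pform phi g2 (- g1) = - (phi k * zar0 n m phi) by rewrite pE; ring.
  by apply: (flN (W := WB)); have := flM WB Wk (_ : WB (n + m + e)%N (zar0 n m phi)); apply; case: hz.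
have rE k : (m <= k)%N -> r ^- m * r ^+ k = r ^+ (k - m).
  by move=> le; rewrite -{1}(subnKC le) exprD mulrA u mul1r.
exists r; split=> //.
  have := key lam; rewrite chiY nf ?nf'; try by case; lia.
  rewrite eqxx; case: eqP => [|_]; first by lia.
  by rewrite add0r mulr1 rE ?(ltnW lt_mlam).
by move=> i lt; rewrite key chiY mulrA rE // ltnW // (ltn_trans lt_mlam).
Qed.
End FormalUniqueness.

(** * Convergence and analytic inverses *)

Section Convergence.
Variable F : numFieldType.
Notation B := (fps F).
Notation A := (fps (fps F)).

Definition cb1 (f : B) := exists M K : F, [/\ 0 < M, 0 < K & forall i, `|f i| <= M * K ^+ i].
Definition cb2 (h : A) :=
  exists M K : F, [/\ 0 < M, 0 < K & forall i j, `|h i j| <= M * K ^+ (i + j)].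

Lemma cb_mono (M1 K1 M2 K2 : F) n : 0 <= M1 -> M1 <= M2 -> 0 <= K1 -> K1 <= K2 ->
  M1 * K1 ^+ n <= M2 * K2 ^+ n.
Proof.
move=> m0 mm k0 kk; apply: ler_pM => //; first exact: exprn_ge0.
by apply: lerXn2r => //; rewrite nnegrE // (le_trans k0).
Qed.

Lemma bound_add (M1 K1 M2 K2 : F) n : 0 < M1 -> 0 < K1 -> 0 < M2 -> 0 < K2 ->
  M1 * K1 ^+ n + M2 * K2 ^+ n <= (M1 + M2) * (K1 + K2) ^+ n.
Proof.
move=> m1 k1 m2 k2; rewrite mulrDl; apply: lerD; apply: cb_mono => //; rewrite ?lerDl ?lerDr; exact: ltW.
Qed.

Lemma cb1D f g : cb1 f -> cb1 g -> cb1 (f + g).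
Proof.
move=> [M1 [K1 [m1 k1 h1]]] [M2 [K2 [m2 k2 h2]]].
exists (M1 + M2), (K1 + K2); split; try exact: addr_gt0.
move=> i; apply: le_trans (bound_add i m1 k1 m2 k2).
by apply: (le_trans (ler_normD _ _)); apply: lerD.
Qed.
Lemma cb1N f : cb1 f -> cb1 (- f).
Proof. by move=> [M [K [m k h]]]; exists M, K; split=> // i; rewrite fpsN normrN. Qed.
Lemma cb2D f g : cb2 f -> cb2 g -> cb2 (f + g).
Proof.
move=> [M1 [K1 [m1 k1 h1]]] [M2 [K2 [m2 k2 h2]]].
exists (M1 + M2), (K1 + K2); split; try exact: addr_gt0.
move=> i j; apply: le_trans (bound_add (i + j) m1 k1 m2 k2).
by apply: (le_trans (ler_normD _ _)); apply: lerD.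
Qed.
Lemma cb2N f : cb2 f -> cb2 (- f).
Proof. by move=> [M [K [m k h]]]; exists M, K; split=> // i j; rewrite !fpsN normrN. Qed.

Lemma cb1M f g : cb1 f -> cb1 g -> cb1 (f * g).
Proof.
move=> [M1 [K1 [m1 k1 h1]]] [M2 [K2 [m2 k2 h2]]].
have kk : 0 < K1 + K2 by apply: addr_gt0.
(* The factor 2 absorbs the n + 1 terms of the convolution, as n + 1 <= 2^n. *)
exists (M1 * M2), (2%:R * (K1 + K2)); split; rewrite ?mulr_gt0 ?ltr0n //.
move=> n; rewrite fpsM; apply: (le_trans (ler_norm_sum _ _ _)).
apply: (@le_trans _ _ (\sum_(i < n.+1) M1 * M2 * (K1 + K2) ^+ n)).
  apply: ler_sum => i _; have le : (i <= n)%N by rewrite -ltnS.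
  rewrite normrM -[X in _ ^+ X](subnKC le) exprD mulrACA; apply: ler_pM => //.
    by apply: le_trans (h1 i) _; apply: cb_mono => //; rewrite ?lerDl; exact: ltW.
  by apply: le_trans (h2 _) _; apply: cb_mono => //; rewrite ?lerDr; exact: ltW.
rewrite sumr_const card_ord exprMn -[X in X <= _]mulr_natr -mulrA ler_pM2l ?mulr_gt0 //.
rewrite mulrC ler_pM2r ?exprn_gt0 // -natrX ler_nat.
by elim: n => // n IH; rewrite expnS; lia.
Qed.

Lemma le_term_sum (f : nat -> F) N i : (forall j, 0 <= f j) -> (i < N)%N ->
  f i <= \sum_(j < N) f j.
Proof.
move=> f0 lt; rewrite (bigD1 (Ordinal lt)) //= lerDl.
by apply: sumr_ge0 => j _; apply: f0.
Qed.

Lemma cb1_finite (f : B) N : (forall i, (N <= i)%N -> f i = 0) -> cb1 f.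
Proof.
move=> h; exists (1 + \sum_(i < N) `|f i|), 1.
have pos : 0 <= \sum_(i < N) `|f i| by apply: sumr_ge0.
split; rewrite ?ltr01 ?ltr_wpDr // => i; rewrite expr1n mulr1.
case: (ltnP i N) => [lt|/h ->]; last by rewrite normr0 addr_ge0.
by apply: le_trans (le_term_sum (fun j => normr_ge0 (f j)) lt) _; rewrite lerDr.
Qed.
Lemma cb1_cst c : cb1 (fps_cst c).
Proof. by apply: (@cb1_finite _ 1) => -[]. Qed.
Lemma cb1_Xn k : cb1 (fpsX ^+ k).
Proof. by apply: (@cb1_finite _ k.+1) => i; rewrite fpsXn; case: eqP => // ->; rewrite ltnn. Qed.
Lemma cb1X f k : cb1 f -> cb1 (f ^+ k).
Proof.
move=> hf; elim: k => [|k IH]; last by rewrite exprS; apply: cb1M.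
exact: cb1_cst.
Qed.
Lemma cb1_sum I (r : seq I) (P : pred I) (f : I -> B) :
  (forall i, P i -> cb1 (f i)) -> cb1 (\sum_(i <- r | P i) f i).
Proof. by move=> h; apply: big_ind => //; [exact: (@cb1_finite 0 0)|apply: cb1D]. Qed.

Lemma cb2_finite (h : A) N : (forall i j, (N <= i)%N || (N <= j)%N -> h i j = 0) -> cb2 h.
Proof.
move=> hN; exists (1 + \sum_(i < N) \sum_(j < N) `|h i j|), 1.
have pos : 0 <= \sum_(i < N) \sum_(j < N) `|h i j|.
  by apply: sumr_ge0 => i _; apply: sumr_ge0.
split; rewrite ?ltr01 ?ltr_wpDr // => i j; rewrite expr1n mulr1.
case: (ltnP i N) => [lti|le]; last by rewrite hN ?le // normr0 addr_ge0.
case: (ltnP j N) => [ltj|le]; last by rewrite hN ?le ?orbT // normr0 addr_ge0.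
apply: le_trans (le_term_sum (fun j => normr_ge0 (h i j)) ltj) _.
apply: (@le_trans _ _ (\sum_(i < N) \sum_(j < N) `|h i j|)); last by rewrite lerDr.
apply: (le_term_sum (f := fun i => \sum_(j < N) `|h i j|)) lti => k.
exact: sumr_ge0.
Qed.

Definition trunc2 N (h : A) : A :=
  \sum_(i < N) \sum_(j < N) scA (h i j) * (vX ^+ i * vY ^+ j).

Lemma cb2_trunc2 N h : cb2 (trunc2 N h).
Proof.
apply: (@cb2_finite _ N) => i j ij; rewrite /trunc2 !fps_sum big1 // => i' _.
rewrite !fps_sum big1 // => j' _; rewrite scAM monA_coef.
case: eqP => [e1|_]; case: eqP => [e2|_]; rewrite ?mulr0 //.
by move: ij; rewrite e1 e2 leqNgt ltn_ord leqNgt ltn_ord.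
Qed.

Lemma geom_le2 (x : F) k : 0 <= x -> x <= 2%:R^-1 -> \sum_(i < k) x ^+ i <= 2%:R.
Proof.
move=> x0 x1; elim: k => [|k IH]; first by rewrite big_ord0.
rewrite big_ord_recl expr0.
under eq_bigr => i _ do rewrite lift0 exprS.
rewrite -mulr_sumr (_ : 2%:R = 1 + 2%:R^-1 * 2%:R); last by rewrite mulVf // pnatr_eq0.
rewrite lerD2l; apply: ler_pM => //; apply: sumr_ge0 => i _; exact: exprn_ge0.
Qed.

(** * Weighted l1 norms of truncated series *)

Section BoxNorm.
Variables (R : comNzRingType) (nu : R -> F).
Record seminorm := Seminorm {
  sn_ge0 : forall a, 0 <= nu a;
  sn_0 : nu 0 = 0;
  sn_D : forall a b, nu (a + b) <= nu a + nu b;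
  sn_M : forall a b, nu (a * b) <= nu a * nu b }.
Hypothesis hnu : seminorm.

Lemma sn_sum I (s : seq I) (P : pred I) (f : I -> R) :
  nu (\sum_(i <- s | P i) f i) <= \sum_(i <- s | P i) nu (f i).
Proof.
apply: (big_ind2 (fun x y => nu x <= y)) => //; first by rewrite sn_0.
by move=> a b c d h1 h2; apply: (le_trans (sn_D hnu _ _)); apply: lerD.
Qed.

Variables (r : F) (k : nat).
Hypothesis r0 : 0 < r.
(** Weighted l1 norm of the first k coefficients at radius r. Being a finite sum, it raises no
    question of convergence; geometric bounds follow from estimates uniform in k. *)
Definition bnorm (f : fps R) : F := \sum_(i < k) nu (f i) * r ^+ i.
End BoxNorm.

(** The left side runs over a triangle inside the square of the right side. This makes the truncated
    norm submultiplicative. *)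
Lemma triangular_sum (a b : nat -> F) k : (forall i, 0 <= a i) -> (forall i, 0 <= b i) ->
  \sum_(n < k) \sum_(i < n.+1) a i * b (n - i)%N <= (\sum_(i < k) a i) * (\sum_(i < k) b i).
Proof.
move=> a0 b0; have b00 l (P : pred 'I_l) : 0 <= \sum_(j < l | P j) b j by apply: sumr_ge0.
have -> : \sum_(n < k) \sum_(i < n.+1) a i * b (n - i)%N =
    \sum_(i < k) a i * \sum_(j < k - i) b j.
  elim: k => [|k IH]; first by rewrite !big_ord0.
  transitivity (\sum_(i < k.+1) (a i * (\sum_(j < k - i) b j) + a i * b (k - i)%N)).
    by rewrite big_split /= big_ord_recr IH [X in _ = X + _]big_ord_recr /= subnn big_ord0 mulr0 addr0.
  by apply: eq_bigr => i _; rewrite -mulrDr subSn ?big_ord_recr // -ltnS.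
rewrite mulr_suml; apply: ler_sum => i _; apply: ler_wpM2l => //.
rewrite -(big_mkord xpredT b) -[leRHS](big_mkord xpredT b).
rewrite [leRHS](@big_cat_nat _ _ _ (k - i)) ?leq_subr //= lerDl.
by apply: sumr_ge0.
Qed.

Lemma bnorm_seminorm (R : comNzRingType) (nu : R -> F) r k : seminorm nu -> 0 < r ->
  seminorm (bnorm nu r k).
Proof.
move=> hnu r0; have rk i : 0 <= r ^+ i by apply: exprn_ge0; rewrite ltW.
have nr a i : 0 <= nu a * r ^+ i by apply: mulr_ge0 => //; apply: sn_ge0.
split=> [a||a b|a b].
- by apply: sumr_ge0.
- by rewrite /bnorm big1 // => i _; rewrite fps0 sn_0 // mul0r.
- rewrite /bnorm -big_split; apply: ler_sum => i _ /=.
  by rewrite -mulrDl; apply: ler_wpM2r => //; apply: sn_D.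
- apply: le_trans (triangular_sum k (fun i => nr (a i) i) (fun i => nr (b i) i)).
  apply: ler_sum => n _; rewrite fpsM.
  apply: (@le_trans _ _ ((\sum_(i < n.+1) nu (a i) * nu (b (n - i)%N)) * r ^+ n)).
    apply: ler_wpM2r => //; apply: (le_trans (sn_sum hnu _ _ _)).
    by apply: ler_sum => i _; apply: sn_M.
  rewrite mulr_suml; apply: ler_sum => i _; have le : (i <= n)%N by rewrite -ltnS.
  by rewrite -[X in _ ^+ X](subnKC le) exprD mulrACA.
Qed.

Lemma norm_seminorm : seminorm (fun x : F => `|x|).
Proof.
by split=> [a||a b|a b]; rewrite ?normr_ge0 ?normr0 ?ler_normD ?normrM.
Qed.

(** Write v = (1 - w v) / u(0) with w = u - u(0). At a radius where w has norm at most |u(0)| / 2,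
    this bounds the norm of every truncation of v by 2 / |u(0)|. *)
Lemma cb1_inv (u v : B) : cb1 u -> u * v = 1 -> cb1 v.
Proof.
move=> [M [K [m0 k0 hu]]] uv.
have u0 : u 0%N != 0.
  apply: contraTneq isT => u00; have := congr1 (fun f : B => f 0%N) uv.
  by rewrite fpsM big_ord1 u00 mul0r fps1 => /eqP; rewrite eq_sym oner_eq0.
have nu0 : 0 < `|u 0%N| by rewrite normr_gt0.
(* Inverse of the radius r, chosen so that K r <= 1/2 and 2 M K r <= |u(0)| / 2. *)
pose d := 2%:R * K * (1 + 2%:R * M / `|u 0%N|).
have two : 0 < 2%:R :> F by rewrite ltr0n.
have d1 : 1 <= 1 + 2%:R * M / `|u 0%N| by rewrite lerDl divr_ge0 // ?mulr_ge0 // ltW.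
have d0 : 0 < d by rewrite /d !mulr_gt0 // (lt_le_trans ltr01).
pose r := d^-1; have r0 : 0 < r by rewrite invr_gt0.
have Kr : K * r <= 2%:R^-1.
  rewrite ler_pdivrMr // ler_pdivlMl // /d -[leLHS]mulr1; apply: ler_wpM2l => //.
  by rewrite mulr_ge0 // ltW.
have Kr' : 2%:R * M * (K * r) <= `|u 0%N| / 2%:R.
  rewrite mulrA ler_pdivrMr // /d.
  have -> : `|u 0%N| / 2%:R * (2%:R * K * (1 + 2%:R * M / `|u 0%N|)) = K * (`|u 0%N| + 2%:R * M).
    by field; rewrite ?normr_eq0 ?u0 ?pnatr_eq0.
  by rewrite mulrC; apply: ler_wpM2l; rewrite ?ltW // ltrDr.
pose w := u - fps_cst (u 0%N).
have wE i : w i = if i is 0 then 0 else u i.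
  by case: i => [|i]; rewrite fpsB /= ?subrr ?subr0.
pose N k := bnorm (fun x : F => `|x|) r k.
have hN k : seminorm (N k) := bnorm_seminorm k norm_seminorm r0.
have Nw k : N k w <= `|u 0%N| / 2%:R.
  apply: le_trans Kr'; case: k => [|k].
    by rewrite /N /bnorm big_ord0 !mulr_ge0 // ltW.
  rewrite /N /bnorm big_ord_recl wE normr0 mul0r add0r.
  apply: (@le_trans _ _ (M * (K * r) * \sum_(i < k) (K * r) ^+ i)).
    rewrite mulr_sumr; apply: ler_sum => i _.
    rewrite lift0 wE -mulrA -exprS exprMn mulrA.
    by apply: ler_wpM2r => //; rewrite exprn_ge0 // ltW.
  rewrite (_ : 2%:R * M * (K * r) = M * (K * r) * 2%:R); last by ring.
  apply: ler_wpM2l; first by rewrite !mulr_ge0 // ltW.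
  by apply: geom_le2 => //; rewrite mulr_ge0 ?ltW.
have vE : v = fps_cst (u 0%N)^-1 * (1 - w * v).
  have : (w + fps_cst (u 0%N)) * v = 1 by rewrite /w subrK.
  rewrite mulrDl => /(canRL (addKr _)) e; rewrite addrC -e mulrA -rmorphM mulVf //.
  by rewrite rmorph1 mul1r.
have Ncst k c f : N k (fps_cst c * f) = `|c| * N k f.
  by rewrite /N /bnorm mulr_sumr; apply: eq_bigr => i _; rewrite fpsCM normrM mulrA.
have N1 k : N k 1 <= 1.
  rewrite /N /bnorm; case: k => [|k]; first by rewrite big_ord0.
  rewrite big_ord_recl big1 => [|i _]; first by rewrite fps1 normr1 mulr1 addr0.
  by rewrite fps1 normr0 mul0r.
have Nv k : N k v <= 2%:R / `|u 0%N|.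
  have h1 : N k v <= `|u 0%N|^-1 * (1 + `|u 0%N| / 2%:R * N k v).
    rewrite {1}vE Ncst normfV; apply: ler_wpM2l; first by rewrite invr_ge0.
    apply: (le_trans (sn_D (hN k) _ _)); apply: lerD => //.
    rewrite -mulNr; apply: (le_trans (sn_M (hN k) _ _)); apply: ler_wpM2r; first exact: sn_ge0.
    apply: le_trans (Nw k); rewrite /N /bnorm.
    by under eq_bigr => i _ do rewrite fpsN normrN.
  have h2 : `|u 0%N|^-1 * (1 + `|u 0%N| / 2%:R * N k v) = `|u 0%N|^-1 + N k v / 2%:R.
    by field; rewrite ?normr_eq0 ?u0 ?pnatr_eq0.
  rewrite h2 -lerBlDr in h1.
  have h3 : N k v - N k v / 2%:R = N k v / 2%:R by field; rewrite ?pnatr_eq0.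
  by rewrite h3 ler_pdivrMr // mulrC in h1.
exists (2%:R / `|u 0%N|), d; split=> //; first by rewrite divr_gt0.
move=> i; have := Nv i.+1; rewrite /N /bnorm big_ord_recr /= => h.
have : `|v i| * r ^+ i <= 2%:R / `|u 0%N|.
  apply: le_trans h; rewrite lerDr; apply: sumr_ge0 => j _.
  by rewrite mulr_ge0 // exprn_ge0 // ltW.
by rewrite /r exprVn ler_pdivrMr // exprn_gt0.
Qed.

Lemma cb1_divide (f g h : B) k : hasord f k -> cb1 f -> cb1 g -> g = h * f -> cb1 h.
Proof.
have shift (x : B) : cb1 x -> cb1 (Fps (fun i => x (i + k)%N)).
  move=> [M [K [m0 k0 hx]]]; exists (M * K ^+ k), K; split=> //.
    by rewrite mulr_gt0 // exprn_gt0.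
  by move=> i /=; rewrite mulrAC -mulrA -exprD.
move=> hf cf cg gE; have [f0 kf] := hf.
pose u := Fps (fun i => f (i + k)%N).
have fE : f = fpsX ^+ k * u by apply: fpsX_divide.
have [v uv] : exists v, u * v = 1.
  have [|v uv] := @unit_inv _ _ (filtB F) (fps_cst (u 0%N)^-1 * u).
    by move=> -[|] // _; rewrite fpsB fpsCM fps1 mulVf ?subrr // /u /= add0n.
  by exists (fps_cst (u 0%N)^-1 * v); rewrite mulrCA mulrA.
have -> : h = Fps (fun i => g (i + k)%N) * v.
  transitivity (h * u * v); first by rewrite -mulrA uv mulr1.
  congr (_ * v); apply: fpsP => i /=.
  by rewrite gE fE mulrCA fpsXnM ltnNge leq_addl addnK.
by apply: cb1M; [apply: shift|apply: cb1_inv uv; apply: shift].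
Qed.
End Convergence.

(** * The inverse of a convergent automorphism of the plane *)

Section AnalyticInverse.
Variable F : numFieldType.
Variables n m : nat.
Hypotheses (n0 : (0 < n)%N) (nm : (n < m)%N).
Notation B := (fps F).
Notation A := (fps (fps F)).
Notation WB := (filtB F).
Notation WA := (filtA F n m).
Notation t := (fpsX : fps F).
Let m0 : (0 < m)%N := ltn_trans n0 nm.
Notation genA' := (genA_generated F n0 (ltn_trans n0 nm)).

(** Division by the diagonal part makes [S] unipotent for the weights. A linear term in Y is allowed
    in S X, its weight m being larger than n. *)
Lemma formal_inverse (S : {rmorphism A -> A}) (a d : F) : fhom WA WA S ->
  a != 0 -> d != 0 ->
  WA n.+1 (S vX - scA a * vX) -> WA m.+1 (S vY - scA d * vY) ->
  exists S' : {rmorphism A -> A}, faut WA S S'.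
Proof.
move=> hS a0 d0 hX hY.
have [H [H' [[hH hH' HK H'K] _ _ HX HY]]] := scaleA_faut n0 nm a0 d0.
pose S1 : {rmorphism A -> A} := S \o H'.
have hS1 : fhom WA WA S1 := fhom_comp hH' hS.
have aux w v c (x : A) : v * c = 1 -> WA w (S x - scA c * x) -> WA w (S (scA v * x) - x).
  move=> vc Wx; have := flMl (W := WA) (scA v) Wx; rewrite mulrBr mulrA -rmorphM vc.
  by rewrite rmorph1 mul1r rmorphM hS.1.
have S1S k h : WA k h -> WA k.+1 (S1 h - h).
  move=> Wh; rewrite -addn1.
  apply: (hom_diff_raise genA' (g := idfun) hS1 (fhom_id WA) _ Wh).
  move=> l x [[-> ->]|[-> ->]]; rewrite addn1 /S1 /=.
    by rewrite HX; apply: aux hX; rewrite mulVf.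
  by rewrite HY; apply: aux hY; rewrite mulVf.
have [T [hT TK KT _]] := hom_inv hS1 S1S.
pose S' : {rmorphism A -> A} := H' \o T.
exists S'; split=> //.
- exact: (fhom_comp hT hH').
- by move=> h; rewrite /S' /= -{1}(HK h) -[S (H' _)]/(S1 _) TK HK.
Qed.

Section BoxNorm.
Variables (r : F) (r0 : 0 < r).
Definition box k (h : A) : F := bnorm (bnorm (fun x : F => `|x|) r k) r k h.
Lemma box_seminorm k : seminorm (box k).
Proof. by apply: bnorm_seminorm => //; apply: bnorm_seminorm => //; apply: norm_seminorm. Qed.

Lemma boxE k h : box k h = \sum_(i < k) \sum_(j < k) `|h i j| * r ^+ (i + j).
Proof.
apply: eq_bigr => i _; rewrite mulr_suml; apply: eq_bigr => j _.
by rewrite addnC exprD mulrA.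
Qed.
Lemma box_ext k (g h : A) : (forall i j, (i < k)%N -> (j < k)%N -> g i j = h i j) ->
  box k g = box k h.
Proof.
by move=> gh; rewrite !boxE; apply: eq_bigr => i _; apply: eq_bigr => j _; rewrite gh.
Qed.
Lemma box_scA k c h : box k (scA c * h) = `|c| * box k h.
Proof.
rewrite !boxE mulr_sumr; apply: eq_bigr => i _; rewrite mulr_sumr; apply: eq_bigr => j _.
by rewrite scAM normrM mulrA.
Qed.
Lemma box_mon_le k i j : box k (vX ^+ i * vY ^+ j) <= r ^+ (i + j).
Proof.
have rk l : 0 <= r ^+ l by rewrite exprn_ge0 // ltW.
rewrite boxE; case: (ltnP i k) => [lti|le]; last first.
  rewrite big1 // => a _; rewrite big1 // => b _; rewrite monA_coef.
  case: eqP => [e|_]; last by rewrite normr0 mul0r.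
  by have := ltn_ord a; rewrite e ltnNge le.
rewrite (bigD1 (Ordinal lti)) //= [X in _ + X]big1 ?addr0; last first.
  move=> a /eqP ne; rewrite big1 // => b _; rewrite monA_coef.
  case: eqP => [e|_]; last by rewrite normr0 mul0r.
  by case: ne; apply: val_inj.
case: (ltnP j k) => [ltj|le]; last first.
  rewrite big1 // => b _; rewrite monA_coef andbC.
  case: eqP => [e|_]; last by rewrite normr0 mul0r.
  by have := ltn_ord b; rewrite e ltnNge le.
rewrite (bigD1 (Ordinal ltj)) //= [X in _ + X]big1 ?addr0; last first.
  move=> b /eqP ne; rewrite monA_coef andbC.
  case: eqP => [e|_]; last by rewrite normr0 mul0r.
  by case: ne; apply: val_inj.
by rewrite monA_coef !eqxx normr1 mul1r.
Qed.
Lemma box_exp k h i : box k (h ^+ i) <= box k h ^+ i.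
Proof.
have hs := box_seminorm k; elim: i => [|i IH].
  by have := box_mon_le k 0 0; rewrite !expr0 mulr1.
rewrite !exprS; apply: (le_trans (sn_M hs _ _)).
by apply: ler_wpM2l => //; apply: sn_ge0.
Qed.
Lemma box_coef k (h : A) i j : (i < k)%N -> (j < k)%N -> `|h i j| * r ^+ (i + j) <= box k h.
Proof.
move=> lti ltj; have pos i' j' : 0 <= `|h i' j'| * r ^+ (i' + j').
  by rewrite mulr_ge0 // exprn_ge0 // ltW.
rewrite boxE; apply: (le_trans (le_term_sum (pos i) ltj)).
apply: (le_term_sum (f := fun i => \sum_(j < k) `|h i j| * r ^+ (i + j))) lti => l.
by apply: sumr_ge0 => j' _; apply: pos.
Qed.

(** Put x = K rho <= 1/2. A term of degree i + j >= 2 is at most M x^(i+j) <= 4 M x^2 2^-(i+j), and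
    the double geometric sum is at most 4, whence the constant 16. *)
Lemma box_subst k (f : {rmorphism A -> A}) (P : A) M K rho :
  fhom WA WA f -> 0 <= M -> 0 <= K -> (forall i j, `|P i j| <= M * K ^+ (i + j)) ->
  (forall i j, (i + j < 2)%N -> P i j = 0) ->
  box k (f vX) <= rho -> box k (f vY) <= rho -> K * rho <= 2%:R^-1 ->
  box k (f P) <= 16%:R * M * (K * rho) ^+ 2.
Proof.
move=> hf M0 K0 hP P0 hu hv hx; have hs := box_seminorm k.
have rho0 : 0 <= rho by apply: le_trans hu; apply: sn_ge0.
set x := K * rho in hx *; have x0 : 0 <= x by rewrite mulr_ge0.
pose L := (n * k + m * k)%N.
have -> : box k (f P) = box k (\sum_(i < L) \sum_(j < L) scA (P i j) * (f vX ^+ i * f vY ^+ j)).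
  have h := hf.2 _ _ (@ordA_trunc F n m n0 m0 L P).
  have e : f (\sum_(i < L) \sum_(j < L) scA (P i j) * (vX ^+ i * vY ^+ j)) =
      \sum_(i < L) \sum_(j < L) scA (P i j) * (f vX ^+ i * f vY ^+ j).
    rewrite rmorph_sum; apply: eq_bigr => i _; rewrite rmorph_sum; apply: eq_bigr => j _.
    by rewrite !rmorphM !rmorphXn hf.1.
  rewrite rmorphB e in h.
  apply: box_ext => i j lti ltj; have lt : (n * i + m * j < L)%N.
    by rewrite /L; have := leq_mul (leqnn n) lti; have := leq_mul (leqnn m) ltj; rewrite !mulnS; lia.
  by have := h i j lt; rewrite !fpsB => /eqP; rewrite subr_eq0 => /eqP ->.
have c4 : 0 <= 4%:R * M * x ^+ 2.
  by apply: mulr_ge0; [apply: mulr_ge0 => //; rewrite ler0n|apply: exprn_ge0].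
have half0 l : 0 <= (2%:R^-1 : F) ^+ l by rewrite exprn_ge0 // invr_ge0 ler0n.
apply: (@le_trans _ _ (\sum_(i < L) \sum_(j < L) 4%:R * M * x ^+ 2 * (2%:R^-1 ^+ i * 2%:R^-1 ^+ j))).
  apply: (le_trans (sn_sum hs _ _ _)); apply: ler_sum => i _.
  apply: (le_trans (sn_sum hs _ _ _)); apply: ler_sum => j _.
  rewrite box_scA; case: (ltnP (i + j) 2) => [lt|le].
    by rewrite P0 // normr0 mul0r; apply: mulr_ge0 => //; apply: mulr_ge0.
  apply: (@le_trans _ _ (M * x ^+ (i + j))).
    rewrite /x exprMn mulrA; apply: ler_pM => //; first exact: sn_ge0.
    apply: (le_trans (sn_M hs _ _)); rewrite exprD.
    have X l (w : A) : box k w <= rho -> box k (w ^+ l) <= rho ^+ l.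
      move=> hw; apply: (le_trans (box_exp k w l)); apply: lerXn2r => //; rewrite nnegrE //.
      exact: sn_ge0.
    by apply: ler_pM; rewrite ?X //; apply: sn_ge0.
  have -> : 4%:R * M * x ^+ 2 * (2%:R^-1 ^+ i * 2%:R^-1 ^+ j) = M * (x ^+ 2 * 2%:R^-1 ^+ (i + j - 2)).
    rewrite -exprD -{1}(subnKC le) exprD.
    by field; rewrite ?pnatr_eq0.
  apply: ler_wpM2l => //; rewrite -{1}(subnKC le) exprD; apply: ler_wpM2l; first exact: exprn_ge0.
  by apply: lerXn2r => //; rewrite nnegrE // invr_ge0 ler0n.
have -> : \sum_(i < L) \sum_(j < L) 4%:R * M * x ^+ 2 * (2%:R^-1 ^+ i * 2%:R^-1 ^+ j)
   = 4%:R * M * x ^+ 2 * ((\sum_(i < L) 2%:R^-1 ^+ i) * (\sum_(j < L) 2%:R^-1 ^+ j)).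
  rewrite mulr_suml mulr_sumr; apply: eq_bigr => i _.
  by rewrite mulr_sumr mulr_sumr; apply: eq_bigr.
have -> : 16%:R * M * x ^+ 2 = 4%:R * M * x ^+ 2 * (2%:R * 2%:R) by ring.
apply: ler_wpM2l => //.
have h2 : 0 <= 2%:R^-1 :> F by rewrite invr_ge0 ler0n.
by apply: ler_pM; rewrite ?geom_le2 //; apply: sumr_ge0.
Qed.
End BoxNorm.

(** The Picard iterates of the fixed point equation for the inverse are bounded in box
    norm, uniformly in the box, and converge coefficientwise to the formal inverse. *)
Lemma analytic_inverse (S S' : {rmorphism A -> A}) (a d : F) : faut WA S S' ->
  a != 0 -> d != 0 ->
  WA n.+1 (S vX - scA a * vX) -> WA m.+1 (S vY - scA d * vY) ->
  cb2 (S vX) -> cb2 (S vY) -> cb2 (S' vX) /\ cb2 (S' vY).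
Proof.
move=> [hS hS' SK S'K] a0 d0 hX hY cX cY.
(* S X may contain a linear term b Y, since m > n. It is split off so that [P2], like [Q], starts in
   degree 2 and [box_subst] applies. *)
pose b := (S vX) 0%N 1%N.
pose Q := S vY - scA d * vY.
pose P := S vX - scA a * vX; pose P2 := P - scA b * vY.
have cpoly (i j : nat) : cb2 (vX ^+ i * vY ^+ j : A).
  apply: (@cb2_finite F _ (i + j).+1) => i' j'; rewrite monA_coef.
  by case: eqP => [->|_] //; case: eqP => [->|_] // /orP[]; lia.
have cc c (h : A) : cb2 h -> cb2 (scA c * h).
  move=> [M [K [M0 K0 hh]]]; exists ((1 + `|c|) * M), K; split=> //.
    by rewrite mulr_gt0 // ltr_wpDr.
  move=> i j; rewrite scAM normrM -mulrA; apply: ler_pM => //.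
  by rewrite lerDr ler01.
have cvX : cb2 (vX : A) by have := cpoly 1%N 0%N; rewrite expr1 mulr1.
have cvY : cb2 (vY : A) by have := cpoly 0%N 1%N; rewrite expr1 mul1r.
have cQ : cb2 Q by apply: cb2D => //; apply: cb2N; apply: cc.
have cP2 : cb2 P2.
  by apply: cb2D; [apply: cb2D => //|]; apply: cb2N; apply: cc.
have [MQ [KQ [MQ0 KQ0 bQ]]] := cQ; have [MP [KP [MP0 KP0 bP]]] := cP2.
pose M := MP + MQ; pose K := KP + KQ.
have M0 : 0 < M by rewrite addr_gt0.
have K0 : 0 < K by rewrite addr_gt0.
have {}bQ i j : `|Q i j| <= M * K ^+ (i + j).
  by apply: (le_trans (bQ i j)); apply: cb_mono; rewrite ?lerDr; apply: ltW.
have {}bP i j : `|P2 i j| <= M * K ^+ (i + j).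
  by apply: (le_trans (bP i j)); apply: cb_mono; rewrite ?lerDl; apply: ltW.
have low i j : (i + j < 2)%N -> [\/ i = 0%N /\ j = 0%N, i = 1%N /\ j = 0%N | i = 0%N /\ j = 1%N].
  by case: i j => [|[|i]] [|[|j]] // _; [constructor 1|constructor 3|constructor 2].
have zQ i j : (i + j < 2)%N -> Q i j = 0.
  by move=> /low [] [-> ->]; apply: hY; rewrite ?muln0 ?muln1 ?addn0 // ltnS ltnW.
have P2E i j : P2 i j = P i j - b * vY i j by rewrite -scAM.
have PE i j : P i j = S vX i j - a * vX i j by rewrite -scAM.
have zP i j : (i + j < 2)%N -> P2 i j = 0.
  move=> /low [] [-> ->]; rewrite P2E.
  - by rewrite vY_coef /= mulr0 subr0; apply: hX; rewrite ?muln0 ?muln1 ?addn0.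
  - by rewrite vY_coef /= mulr0 subr0; apply: hX; rewrite ?muln0 ?muln1 ?addn0.
  - by rewrite PE vX_coef vY_coef /= mulr0 subr0 mulr1 subrr.
have na : 0 < `|a| by rewrite normr_gt0.
have nd : 0 < `|d| by rewrite normr_gt0.
(* Radii, in units of r, of the ball preserved by the Picard step: they solve BY |d| = 2 and BX |a|
   = 2 + |b| BY. *)
pose BY := 2%:R / `|d|; pose BX := (2%:R + `|b| * BY) / `|a|.
have two : 0 < 2%:R :> F by rewrite ltr0n.
have BY0 : 0 < BY by rewrite divr_gt0.
have BX0 : 0 < BX by rewrite divr_gt0 // ltr_wpDr // mulr_ge0 // ltW.
pose Bd := BX + BY; have Bd0 : 0 < Bd by rewrite addr_gt0.
(* With r = 1/D, [small1] is the smallness required by [box_subst], and [small2] turns its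
   conclusion into the bound r. *)
pose D := 16%:R * M * (K * Bd) ^+ 2 + 2%:R * (K * Bd).
have D10 : 0 <= 16%:R * M * (K * Bd) ^+ 2.
  by rewrite mulr_ge0 ?exprn_ge0 ?mulr_ge0 ?ler0n // ltW.
have D20 : 0 < 2%:R * (K * Bd) by rewrite !mulr_gt0.
have D0 : 0 < D by rewrite ltr_wpDl.
pose r := D^-1; have r0 : 0 < r by rewrite invr_gt0.
have small1 : K * (Bd * r) <= 2%:R^-1.
  rewrite mulrA ler_pdivrMr // ler_pdivlMl // /D lerDr //.
have small2 : 16%:R * M * (K * (Bd * r)) ^+ 2 <= r.
  have -> : 16%:R * M * (K * (Bd * r)) ^+ 2 = (16%:R * M * (K * Bd) ^+ 2) * r * r by ring.
  rewrite -[leRHS]mul1r; apply: ler_wpM2r; first exact: ltW.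
  by rewrite ler_pdivrMr // mul1r /D lerDl ltW.
pose N := box r; have hN k : seminorm (N k) := box_seminorm r0 k.
have sX : S' vX = scA a^-1 * (vX - S' P).
  have : S' (S vX) = vX by rewrite SK.
  have -> : S vX = scA a * vX + P by rewrite /P addrC subrK.
  rewrite rmorphD rmorphM hS'.1 => e; rewrite -{2}e addrK mulrA -[scA _ * sc _ _](rmorphM scA).
  by rewrite mulVf // rmorph1 mul1r.
have sY : S' vY = scA d^-1 * (vY - S' Q).
  have : S' (S vY) = vY by rewrite SK.
  have -> : S vY = scA d * vY + Q by rewrite /Q addrC subrK.
  rewrite rmorphD rmorphM hS'.1 => e; rewrite -{2}e addrK mulrA -[scA _ * sc _ _](rmorphM scA).
  by rewrite mulVf // rmorph1 mul1r.
have NvX k : N k vX <= r by have := box_mon_le r0 k 1 0; rewrite addn0 expr1 expr0 mulr1.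
have NvY k : N k vY <= r by have := box_mon_le r0 k 0 1; rewrite add0n expr1 expr0 mul1r.
have subN k x y : N k (x - y) <= N k x + N k y.
  apply: (le_trans (sn_D (hN k) _ _)); rewrite lerD2l.
  by rewrite -mulN1r -(rmorphN1 scA) /N box_scA normrN1 mul1r.
have picard l : exists f : {rmorphism A -> A}, [/\ fhom WA WA f,
    WA (n + l)%N (f vX - S' vX), WA (m + l)%N (f vY - S' vY),
    forall k, N k (f vX) <= BX * r & forall k, N k (f vY) <= BY * r].
  elim: l => [|l [f [hf fX fY NX NY]]].
    have [f [fX fY hf]] := @subst2_ex F A WA 0 0 (fl_zero _ _) (fl_zero _ _).
    have z k c : 0 < c -> N k 0 <= c * r by move=> c0; rewrite sn_0 // mulr_ge0 // ltW.
    exists f; split; rewrite ?fX ?fY ?addn0 ?sub0r.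
    - by apply: hf; apply: fl_zero.
    - by apply: (flN (W := WA)); apply: hS'.2; apply: ordA_vX.
    - by apply: (flN (W := WA)); apply: hS'.2; apply: ordA_vY.
    - by move=> k; apply: z.
    - by move=> k; apply: z.
  (* One Picard step: [sX] and [sY] with f in place of S' on the right. [P] and [Q] have weights
     above n and m, so the agreement with S' improves by one. *)
  pose u := scA a^-1 * (vX - f P); pose v := scA d^-1 * (vY - f Q).
  have Wu : WA n u.
    apply: (flMl (W := WA)); apply: (flB WA); first exact: ordA_vX.
    by apply: (flW (W := WA) (leqnSn n)); apply: hf.2.
  have Wv : WA m v.
    apply: (flMl (W := WA)); apply: (flB WA); first exact: ordA_vY.
    by apply: (flW (W := WA) (leqnSn m)); apply: hf.2.
  have [g [gX gY hg]] := subst2_ex (flW (W := WA) n0 Wu) (flW (W := WA) m0 Wv).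
  have dif w h : WA w h -> WA (w + l)%N (f h - S' h).
    by apply: (hom_diff_raise genA' hf hS') => k x [[-> ->]|[-> ->]].
  have rk k : N k (f vX) <= Bd * r /\ N k (f vY) <= Bd * r.
    split; [apply: (le_trans (NX k))|apply: (le_trans (NY k))]; apply: ler_wpM2r; rewrite ?ltW //.
      by rewrite ltrDl.
    by rewrite ltrDr.
  have NQ k : N k (f Q) <= r.
    have [h1 h2] := rk k.
    exact: le_trans (box_subst r0 hf (ltW M0) (ltW K0) bQ zQ h1 h2 small1) small2.
  have NP k : N k (f P) <= r + `|b| * (BY * r).
    have [h1 h2] := rk k.
    have -> : f P = f P2 + scA b * f vY.
      by rewrite -[P](subrK (scA b * vY)) rmorphD rmorphM hf.1.
    apply: (le_trans (sn_D (hN k) _ _)); apply: lerD.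
      exact: le_trans (box_subst r0 hf (ltW M0) (ltW K0) bP zP h1 h2 small1) small2.
    by rewrite /N box_scA; apply: ler_wpM2l.
  exists g; split; first exact: hg.
  - rewrite gX sX /u -mulrBr; apply: (flMl (W := WA)).
    have := dif _ _ hX; rewrite addSnnS => h; have := flN (W := WA) h.
    by congr (WA _ _); rewrite -/P; ring.
  - rewrite gY sY /v -mulrBr; apply: (flMl (W := WA)).
    have := dif _ _ hY; rewrite addSnnS => h; have := flN (W := WA) h.
    by congr (WA _ _); rewrite -/Q; ring.
  - move=> k; rewrite gX /u /N box_scA normfV mulrC ler_pdivrMr //.
    apply: (le_trans (subN _ _ _)); apply: (le_trans (lerD (NvX k) (NP k))).
    have -> : BX * r * `|a| = r + (r + `|b| * (BY * r)).
      by rewrite /BX; field; rewrite normr_eq0 a0.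
    by [].
  - move=> k; rewrite gY /v /N box_scA normfV mulrC ler_pdivrMr //.
    apply: (le_trans (subN _ _ _)); apply: (le_trans (lerD (NvY k) (NQ k))).
    have -> : BY * r * `|d| = r + r by rewrite /BY; field; rewrite normr_eq0 d0.
    by [].
have fin (x : A) (c : F) : 0 < c ->
    (forall i j, exists2 y : A, y i j = x i j & forall k, N k y <= c * r) -> cb2 x.
  move=> c0 h; exists (c * r), D; split=> //; first by rewrite mulr_gt0.
  move=> i j; have [y <- Ny] := h i j.
  have lti : (i < (i + j).+1)%N by rewrite ltnS leq_addr.
  have ltj : (j < (i + j).+1)%N by rewrite ltnS leq_addl.
  have := le_trans (box_coef r0 y lti ltj) (Ny (i + j).+1).
  by rewrite /r exprVn ler_pdivrMr // exprn_gt0.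
split.
  apply: (fin _ _ BX0) => i j; have [f [_ fX _ NX _]] := picard (n * i + m * j).+1.
  exists (f vX) => //; have := fX i j (leq_trans (ltnSn _) (leq_addl _ _)).
  by rewrite !fpsB => /eqP; rewrite subr_eq0 => /eqP.
apply: (fin _ _ BY0) => i j; have [f [_ _ fY _ NY]] := picard (n * i + m * j).+1.
exists (f vY) => //; have := fY i j (leq_trans (ltnSn _) (leq_addl _ _)).
by rewrite !fpsB => /eqP; rewrite subr_eq0 => /eqP.
Qed.
End AnalyticInverse.

(** * One variable as a special case of two *)

Section EmbedB.
Variable F : fieldType.
Notation B := (fps F).
Notation A := (fps (fps F)).
Definition embB (f : B) : A := Fps (fun i => fps_cst (f i)).
Fact embB_zmod : zmod_morphism embB.
Proof. by move=> f g; apply: fpsP => i; rewrite fpsB /= rmorphB. Qed.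
Fact embB_mon : monoid_morphism embB.
Proof.
split=> [|f g]; apply: fpsP => i; first by case: i => [|i] /=; rewrite ?rmorph1 ?rmorph0.
by rewrite [LHS]/= !fpsM rmorph_sum; apply: eq_bigr => j _; rewrite rmorphM.
Qed.
HB.instance Definition _ := GRing.isZmodMorphism.Build B A embB embB_zmod.
HB.instance Definition _ := GRing.isMonoidMorphism.Build B A embB embB_mon.

Lemma embB_coef f i j : embB f i j = f i *+ (j == 0)%N.
Proof. exact: fps_cstE. Qed.
Lemma embB_X : embB fpsX = vX.
Proof. by apply: fpsP => i; rewrite /vX /= rmorph_nat. Qed.
Lemma embB_fhom q : fhom (filtB F) (filtA F 1 q) embB.
Proof.
split=> [c|k f hf i j lt].
  by apply: fpsP => -[|i] //=; rewrite rmorph0.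
rewrite embB_coef; case: eqP => // j0; rewrite hf //; lia.
Qed.
End EmbedB.

Lemma formal_inverse1 (F : fieldType) (R : {rmorphism fps F -> fps F}) (a : F) :
  fhom (filtB F) (filtB F) R -> a != 0 -> filtB F 2 (R fpsX - fps_cst a * fpsX) ->
  exists R' : {rmorphism fps F -> fps F}, faut (filtB F) R R'.
Proof.
move=> hR a0 Ra.
pose T : {rmorphism fps F -> fps F} := fps_scale a^-1.
pose T' : {rmorphism fps F -> fps F} := fps_scale a.
have hT : fhom (filtB F) (filtB F) T by apply: (@fps_scale_fhom F a^-1).
have T'K : cancel T' T := fps_scaleK a0.
pose R1 : {rmorphism fps F -> fps F} := R \o T.
have hR1 : fhom (filtB F) (filtB F) R1 := fhom_comp hT hR.
have R1R k f : filtB F k f -> filtB F k.+1 (R1 f - f).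
  move=> Wf; rewrite -addn1.
  apply: (hom_diff_raise (genB_generated F) (g := idfun) hR1 (fhom_id (filtB F)) _ Wf).
  move=> l x [-> ->]; have -> : R1 fpsX = fps_cst a^-1 * R fpsX.
    by rewrite /R1 /= fps_scale_X rmorphM hR.1.
  have := flMl (W := filtB F) (fps_cst a^-1) Ra; rewrite mulrBr mulrA -rmorphM mulVf //.
  by rewrite rmorph1 mul1r.
have [Q [hQ QK KQ _]] := hom_inv hR1 R1R.
pose R' : {rmorphism fps F -> fps F} := T \o Q.
exists R'; split=> //.
  exact: (fhom_comp hQ hT).
by move=> h; rewrite /R' /= -{1}(T'K h) -[R (T _)]/(R1 _) QK T'K.
Qed.

Section AnalyticInverse1.
Variable F : numFieldType.
Notation B := (fps F).
Notation A := (fps (fps F)).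
Notation WB := (filtB F).

(** The inverse theorem in the plane is applied to (rho(X), Y) with weights 1 and 2; the first
    component of the inverse is the inverse of rho, read as a series in X. *)
Lemma analytic_inverse1 (rho : B) : cb1 rho -> rho 0%N = 0 -> rho 1%N != 0 ->
  exists R R' : {rmorphism B -> B}, [/\ faut WB R R', R fpsX = rho & cb1 (R' fpsX)].
Proof.
move=> crho rho0 rho1.
have Wrho : WB 1 rho by case.
have [R [hR RX]] := subst1_ex Wrho.
have Rlow : WB 2 (R fpsX - fps_cst (rho 1%N) * fpsX).
  by rewrite RX => -[|[|//]] _; rewrite fpsB fpsCM /= ?rho0 ?mulr0 ?mulr1 subrr.
have [R' hRR'] := formal_inverse1 hR rho1 Rlow.
have [_ hR' RK R'K] := hRR'.
exists R, R'; split=> //.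
pose W2 := filtA F 1 2.
have hem := embB_fhom F 2.
have [S [SX SY hS']] := subst2_ex (hem.2 _ _ Wrho) (flW (W := W2) (isT : 1 <= 2)%N (@ordA_vY F 1 2)).
have hS : fhom W2 W2 S.
  exact: (hS' 1%N 2%N (hem.2 _ _ Wrho) (@ordA_vY F 1 2)).
have lX : W2 2%N (S vX - scA (rho 1%N) * vX).
  rewrite SX -embB_X; have -> : scA (rho 1%N) = embB (fps_cst (rho 1%N)) by rewrite hem.1.
  by rewrite -rmorphM -rmorphB; apply: hem.2; rewrite -{1}RX; exact: Rlow.
have lY : W2 3%N (S vY - scA 1 * vY) by rewrite SY rmorph1 mul1r subrr; apply: fl_zero.
have [S' hSS'] := @formal_inverse F 1 2 isT isT S _ _ hS rho1 (oner_neq0 _) lX lY.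
have cX : cb2 (S vX).
  rewrite SX; have [M [K [M0 K0 h]]] := crho; exists M, K; split=> // i j.
  rewrite embB_coef; case: eqP => [->|_]; first by rewrite addn0 mulr1n.
  by rewrite mulr0n normr0 mulr_ge0 ?exprn_ge0 // ltW.
have cY : cb2 (S vY).
  by rewrite SY; apply: (@cb2_finite F _ 2) => i j; rewrite vY_coef; case: i j => [|[|i]] [|[|j]].
have [cX' _] := @analytic_inverse F 1 2 isT isT S S' _ _ hSS' rho1 (oner_neq0 _) lX lY cX cY.
have [_ _ SK _] := hSS'.
have semE : (S \o @embB F) =1 (@embB F \o R).
  apply: (@hom_uniq _ _ _ _ _ _ (genB_generated F) (S \o @embB F) (@embB F \o R)).
  - exact: (fhom_comp hem hS).
  - exact: (fhom_comp hR hem).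
  - by move=> k x [_ ->] /=; rewrite embB_X SX RX.
have e : S' vX = embB (R' fpsX).
  rewrite -embB_X -{1}(R'K fpsX) -[embB (R _)]/((@embB F \o R) _) -semE /=.
  by rewrite SK.
have [M [K [M0 K0 h]]] := cX'; exists M, K; split=> // i.
by have := h i 0%N; rewrite e embB_coef addn0.
Qed.
End AnalyticInverse1.

(** * Finite determinacy *)

Section Tail.
Variable F : numFieldType.
Variables n m : nat.
Hypotheses (n0 : (0 < n)%N) (m0 : (0 < m)%N).
Notation B := (fps F).
Notation A := (fps (fps F)).
Notation WB := (filtB F).
Notation WA := (filtA F n m).
Notation t := (fpsX : fps F).
Variables (zeta : F) (zetaP : n.-primitive_root zeta).
Variables (phi : {rmorphism A -> B}) (hphi : fhom WA WB phi) (phiX : phi vX = t ^+ n).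
Notation y := (phi vY).
Hypothesis cy : cb1 y.
Hypothesis y_moved : forall l, (0 < l < n)%N -> fps_scale (zeta ^+ l) y <> y.

Let sig (l : 'I_n) : {rmorphism B -> B} := fps_scale (zeta ^+ l).
Let i0 : 'I_n := Ordinal n0.

Lemma hasord_ex (f : B) : f <> 0 -> exists k, hasord f k.
Proof.
move=> f0; have ex : exists k, f k != 0.
  by apply: contrapT => h; apply: f0; apply: fpsP => k; apply: contrapT => /eqP fk; apply: h; exists k.
case: (ex_minnP ex) => k fk kmin; exists k; split=> // i lt.
by apply/eqP/negPn/negP => /kmin; rewrite leqNgt lt.
Qed.

(** The derivative at y of the monic polynomial with roots the conjugates of y, that is, the
    denominator of the interpolation. By [y_moved] no factor is zero. *)
Let Dl : B := \prod_(l < n | l != i0) (y - sig l y).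

Lemma Dl_ord : exists k, hasord Dl k.
Proof.
apply: (big_ind (fun f => exists k, hasord f k)).
- by exists 0%N; split; rewrite ?fps1 ?oner_neq0.
- by move=> f g [k hf] [l hg]; exists (k + l)%N; apply: hasordM.
- move=> l ne; apply: hasord_ex => /eqP; rewrite subr_eq0 => /eqP e.
  apply: (@y_moved l); last by rewrite {2}e.
  by rewrite ltn_ord andbT lt0n; apply: contraNneq ne => l0; apply/eqP/val_inj.
Qed.

Lemma cb1_scale c (f : B) : cb1 f -> cb1 (fps_scale c f).
Proof.
move=> [M [K [M0 K0 h]]]; have c1 : 0 < 1 + `|c| by rewrite ltr_wpDr.
exists M, ((1 + `|c|) * K); split; rewrite ?mulr_gt0 // => i.
rewrite /= normrM normrX exprMn mulrCA; apply: ler_pM => //; first exact: exprn_ge0.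
by apply: lerXn2r; rewrite ?nnegrE ?(ltW c1) // lerDr ler01.
Qed.

Let coefs_cb1 (p : {poly B}) := forall j, cb1 p`_j.
Let coefs_cb1D p q : coefs_cb1 p -> coefs_cb1 q -> coefs_cb1 (p + q).
Proof. by move=> hp hq j; rewrite coefD; apply: cb1D. Qed.
Let coefs_cb1M p q : coefs_cb1 p -> coefs_cb1 q -> coefs_cb1 (p * q).
Proof. by move=> hp hq j; rewrite coefM; apply: cb1_sum => i _; apply: cb1M. Qed.
Let coefs_cb1C c : cb1 c -> coefs_cb1 c%:P.
Proof. by move=> hc j; rewrite coefC; case: ifP => // _; apply: (@cb1_finite _ _ 0). Qed.
Let cb1_nat (b : bool) : cb1 (b%:R : B).
Proof.
by apply: (@cb1_finite _ _ 1) => -[|i] //; case: b; rewrite ?fps1 ?fps0.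
Qed.

Section Interpolation.
Variable q : B.
Hypothesis cq : cb1 q.

(** Lagrange interpolation over the conjugates of [y]; being invariant under
    [t -> zeta t], it has coefficients in [t ^+ n = phi vX]. *)
Let G : {poly B} :=
  \sum_(l < n) (sig l q)%:P * \prod_(l' < n | l' != l) ('X - (sig l' y)%:P).

Let sig0 f : sig i0 f = f.
Proof. by apply: fpsP => k; rewrite /= expr0 expr1n mul1r. Qed.

Let G_eval : G.[y] = q * Dl.
Proof.
rewrite horner_sum (bigD1 i0) //= [X in _ + X]big1 ?addr0; last first.
  move=> l ne; rewrite hornerM horner_prod (bigD1 i0) 1?eq_sym //=.
  by rewrite hornerXsubC -/(sig i0 y) sig0 subrr mul0r mulr0.
rewrite hornerM hornerC horner_prod -/(sig i0 q) sig0; congr (_ * _).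
by apply: eq_bigr => l _; rewrite hornerXsubC.
Qed.

Let sigS l f : fps_scale zeta (sig l f) = sig (ordS l) f.
Proof.
apply: fpsP => k; rewrite /= mulrA -exprMn -exprS; congr (_ ^+ _ * _).
by rewrite (prim_expr_mod zetaP).
Qed.

Let G_inv : map_poly (fps_scale zeta) G = G.
Proof.
rewrite rmorph_sum /= [RHS](reindex_inj (@ordS_inj n)) /=; apply: eq_bigr => l _.
rewrite rmorphM /= map_polyC -/(sig l q) /= sigS; congr (_ * _).
rewrite rmorph_prod [RHS](reindex_inj (@ordS_inj n)) /=.
apply: eq_big => [l'|l' _]; first by rewrite (inj_eq (@ordS_inj n)).
by rewrite rmorphB /= map_polyX map_polyC /= -/(sig l' y) sigS.
Qed.

Let G_coef j k : ~~ (n %| k)%N -> G`_j k = 0.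
Proof.
move=> nd; have := congr1 (fun p : {poly B} => p`_j k) G_inv.
rewrite coef_map /= => /eqP; rewrite -subr_eq0 -{2}[G`_j k]mul1r -mulrBl mulf_eq0.
by rewrite subr_eq0 -(prim_order_dvd zetaP) (negPf nd) /= => /eqP.
Qed.

Let G_cb1 j : cb1 G`_j.
Proof.
suff : coefs_cb1 G by apply.
apply: (big_ind coefs_cb1) => [j'||l _]; [by rewrite coef0; apply: (@cb1_finite _ _ 0)|exact: coefs_cb1D|].
apply: coefs_cb1M; first by apply/coefs_cb1C/cb1_scale.
apply: (big_ind coefs_cb1) => [||l' _]; [|exact: coefs_cb1M|].
  by move=> j'; rewrite coef1; apply: cb1_nat.
apply: coefs_cb1D; first by move=> j'; rewrite coefX; apply: cb1_nat.
by move=> j'; rewrite coefN; apply: cb1N; apply/coefs_cb1C/cb1_scale.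
Qed.

Let G_ord k j : WB k q -> WB k G`_j.
Proof.
move=> hq; rewrite coef_sum; apply: (fl_bigsum (W := WB)) => l _.
rewrite coefCM; apply: (flMr (W := WB)) => i lt.
by rewrite /= hq ?mulr0.
Qed.

(** [G] has finitely many coefficients, so one bound serves them all; K >= 1 permits enlarging the
    exponent of K later. *)
Let G_unif : exists M K : F, [/\ 0 < M, 1 <= K & forall j i, `|G`_j i| <= M * K ^+ i].
Proof.
have H s : exists M K : F, [/\ 0 < M, 1 <= K & forall j i, (j < s)%N -> `|G`_j i| <= M * K ^+ i].
  elim: s => [|s [M1 [K1 [m1 k1 h1]]]]; first by exists 1, 1; split.
  have [M2 [K2 [m2 k2 h2]]] := G_cb1 s.
  have k1' : 0 < K1 by apply: lt_le_trans k1.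
  exists (M1 + M2), (K1 + K2); split; first exact: addr_gt0.
    by apply: (le_trans k1); rewrite lerDl ltW.
  move=> j i; rewrite ltnS leq_eqVlt => lt.
  apply: le_trans (bound_add i m1 k1' m2 k2).
  case/orP: lt => [/eqP ->|lt].
    by apply: (le_trans (h2 i)); rewrite lerDr mulr_ge0 ?exprn_ge0 // ltW.
  by apply: (le_trans (h1 j i lt)); rewrite lerDl mulr_ge0 ?exprn_ge0 // ltW.
have [M [K [M0 K1 h]]] := H (size G); exists M, K; split=> // j i.
case: (ltnP j (size G)) => [|le]; first exact: h.
have K0 : 0 < K by apply: lt_le_trans K1.
by rewrite nth_default // normr0; apply: mulr_ge0; [exact: ltW|apply: exprn_ge0; exact: ltW].
Qed.

(** h is [G] with its indeterminate replaced by Y and t^n by X. The order n (m + 1) of q leaves only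
    monomials with exponent of X above m, hence of weight above m. *)
Lemma interpolation : WB (n * m.+1) q ->
  exists h : A, [/\ cb2 h, WA m.+1 h & phi h = q * Dl].
Proof.
move=> hq; pose h : A := Fps (fun i => Fps (fun j => G`_j (n * i)%N)).
have [M [K [M0 K1 hG]]] := G_unif.
have K0 : 0 < K by apply: lt_le_trans K1.
exists h; split.
- exists M, (K ^+ n); split; rewrite ?exprn_gt0 // => i j /=.
  apply: (le_trans (hG _ _)); rewrite -exprM; apply: ler_wpM2l; first exact: ltW.
  by rewrite ler_weXn2l // leq_mul2l leq_addr orbT.
- move=> i j lt /=; apply: (G_ord j hq); rewrite ltn_pmul2l //; nia.
- rewrite -G_eval; apply: (@fl_eq _ _ WB) => N.
  pose L := (N + size G)%N.
  have e1 := hphi.2 _ _ (@ordA_trunc F n m n0 m0 L h).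
  rewrite rmorphB in e1; apply: (fl_trans (W := WB) (flW (W := WB) (leq_addr _ _) e1)).
  rewrite (@horner_coef_wide _ L) ?leq_addl // rmorph_sum.
  have -> : \sum_(i < L) phi (\sum_(j < L) scA (h i j) * (vX ^+ i * vY ^+ j)) =
      \sum_(j < L) (\sum_(i < L) fps_cst (G`_j (n * i)%N) * t ^+ (n * i)) * y ^+ j.
    under eq_bigr => i _ do rewrite rmorph_sum.
    rewrite exchange_big; apply: eq_bigr => j _; rewrite mulr_suml; apply: eq_bigr => i _.
    by rewrite !rmorphM !rmorphXn hphi.1 phiX -exprM mulrA.
  rewrite -sumrB; apply: (fl_bigsum (W := WB)) => j _; rewrite -mulrBl.
  apply: (flMr (W := WB)) => k lt; rewrite fpsB fps_sum.
  case: (boolP (n %| k)%N) => [/dvdnP [i kE]|nd].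
    have ltL : (i < L)%N by rewrite /L; nia.
    rewrite (bigD1 (Ordinal ltL)) //= fpsCM fpsXn kE mulnC eqxx mulr1.
    rewrite big1 ?addr0 ?subrr // => i' /eqP ne; rewrite fpsCM fpsXn.
    case: eqP => [e|_]; rewrite ?mulr0 //; case: ne; apply: val_inj => /=.
    by apply/eqP; rewrite -(eqn_pmul2l n0); apply/eqP; lia.
  rewrite G_coef // subr0 big1 // => i _; rewrite fpsCM fpsXn.
  by case: eqP => [e|_]; rewrite ?mulr0 //; move: nd; rewrite e dvdn_mulr.
Qed.
End Interpolation.

(** N is the order of [Dl], lost in the division of f by [Dl], plus the order required by
    [interpolation]. *)
Lemma tail : exists N, forall f : B, cb1 f -> WB N f ->
  exists h : A, [/\ cb2 h, WA m.+1 h & phi h = f].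
Proof.
have [k hD] := Dl_ord; exists (k + n * m.+1)%N => f cf hf.
have [q fE hq] := ordB_divide hD hf.
have cD : cb1 Dl.
  apply: (big_ind (@cb1 F)); [exact: (cb1_cst 1)|exact: cb1M|].
  by move=> l _; apply: cb1D => //; apply: cb1N; apply: cb1_scale.
have cq : cb1 q := cb1_divide hD cD cf fE.
by rewrite fE; apply: interpolation.
Qed.
End Tail.

(** * Convergent equivalences and existence of the normal form *)

Section AnalyticEquivalence.
Variable F : numFieldType.
Variables n m : nat.
Hypotheses (n0 : (0 < n)%N) (nm : (n < m)%N) (ndvd : ~~ (n %| m)%N).
Notation B := (fps F).
Notation A := (fps (fps F)).
Notation WB := (filtB F).
Notation WA := (filtA F n m).
Notation t := (fpsX : fps F).
Implicit Types (phi psi : {rmorphism A -> B}).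
Notation lead := (@lead F n m).
Let m0 : (0 < m)%N := ltn_trans n0 nm.
Notation genA' := (genA_generated F n0 (ltn_trans n0 nm)).

Let nat0 k : (0 < k)%N -> k%:R != 0 :> F.
Proof. by rewrite pnatr_eq0 -lt0n. Qed.

Definition analytic_equiv phi psi := exists S S' R R',
  [/\ faut WA S S', faut WB R R',
      [/\ cb2 (S vX), cb2 (S vY), cb2 (S' vX) & cb2 (S' vY)],
      cb1 (R t) /\ cb1 (R' t)
    & phi (S vX) = R (psi vX) /\ phi (S vY) = R (psi vY)].

Lemma weight_nX (h : A) : WA n h -> WA n.+1 (h - scA (h 1%N 0%N) * vX).
Proof.
move=> Wh i j; rewrite ltnS leq_eqVlt !fpsB scAM vX_coef => /orP[/eqP e|lt].
  have j0 : j = 0%N by case: j e => // j; rewrite mulnS; lia.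
  have -> : i = 1%N by apply/eqP; rewrite -(eqn_pmul2l n0) muln1; apply/eqP; lia.
  rewrite j0.
  by rewrite mulr1 subrr.
rewrite Wh // sub0r; case: i j lt => [|[|i]] [|j] lt /=; rewrite ?mulr0 ?oppr0 //; lia.
Qed.

(** Since n does not divide m, Y is the only monomial of weight m. *)
Lemma weight_mY (h : A) : WA m h -> WA m.+1 (h - scA (h 0%N 1%N) * vY).
Proof.
move=> Wh i j; rewrite ltnS leq_eqVlt !fpsB scAM vY_coef => /orP[/eqP e|lt].
  have [-> ->] : i = 0%N /\ j = 1%N.
    case: j e => [|[|j]] e; last by nia.
      by case/negP: ndvd; rewrite -e muln0 addn0 dvdn_mulr.
    by split=> //; case: i e => // i; rewrite mulnS; lia.
  by rewrite mulr1 subrr.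
rewrite Wh // sub0r; case: i j lt => [|i] [|[|j]] lt /=; rewrite ?mulr0 ?oppr0 //; lia.
Qed.

Section Determinacy.
Variables (zeta : F) (zetaP : n.-primitive_root zeta).
Variable phi : {rmorphism A -> B}.
Hypotheses (lphi : lead phi) (phiX : phi vX = t ^+ n) (cy : cb1 (phi vY)).
Variable c : nat.
Hypothesis conductor : forall l, (c <= l)%N -> Gam phi l.

(** Otherwise all pull-backs are invariant under t -> zeta^l t, so every value v satisfies zeta^(l
    v) = 1. The value n c + 1, beyond the conductor, then gives zeta^l = 1. *)
Lemma conductor_moved l : (0 < l < n)%N -> fps_scale (zeta ^+ l) (phi vY) <> phi vY.
Proof.
move=> /andP[l0 ln] e; have [hphi _ _] := lphi.
pose T : {rmorphism B -> B} := fps_scale (zeta ^+ l).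
have hT : fhom WB WB T by apply: (@fps_scale_fhom F (zeta ^+ l)).
have Tphi : (T \o phi) =1 phi.
  apply: (@hom_uniq _ _ _ _ _ _ genA' (T \o phi) phi (fhom_comp hphi hT) hphi).
  move=> k x [[_ ->]|[_ ->]] //=; rewrite phiX; apply: fpsP => i /=.
  rewrite fpsXn; case: eqP => [->|_]; rewrite ?mulr0 // mulr1.
  by rewrite -exprM mulnC exprM (prim_expr_order zetaP) expr1n.
have [h [hv _]] := @conductor (n * c).+1 ltac:(nia).
have := congr1 (fun f : B => f (n * c).+1) (Tphi h).
rewrite /= => /eqP; rewrite -subr_eq0 -{2}[phi h _]mul1r -mulrBl mulf_eq0 (negPf hv) orbF.
rewrite subr_eq0 -exprM mulnS exprD mulnCA exprM (prim_expr_order zetaP) expr1n mulr1.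
rewrite -(prim_order_dvd zetaP) => /dvdn_leq; lia.
Qed.

(** [S] and [R] are truncated to polynomials. The resulting error is convergent and of large order
    in t, hence the pull-back of convergent h1 and h2; subtracting these from the truncation of [S]
    makes the equation exact. Since psi is polynomial, its image under the truncation of [R]
    converges. *)
Lemma finite_determinacy : exists N, forall psi (S : {rmorphism A -> A}) (R : {rmorphism B -> B}),
  lead psi -> psi vX = t ^+ n -> (exists K, forall k, (K <= k)%N -> psi vY k = 0) ->
  fhom WA WA S -> fhom WB WB R -> R t 1%N != 0 ->
  WB N (phi (S vX) - R (psi vX)) -> WB N (phi (S vY) - R (psi vY)) ->
  analytic_equiv phi psi.
Proof.
have [hphi _ _] := lphi.
have [N0 tailP] := tail n0 m0 zetaP hphi phiX cy conductor_moved.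
(* N0 is the order needed for [tail]; the rest keeps the leading parts of [S] and [R] intact under
   truncation. *)
pose N := (N0 + m + n).+1; exists N => psi S R lpsi psiX [K zfin] hS hR R1 eX eY.
have [hpsi _ _] := lpsi.
pose pol (h : A) : A := trunc2 N h.
have polW h : WA N (h - pol h) by apply: ordA_trunc.
have cpol h : cb2 (pol h) by apply: cb2_trunc2.
have cphipol h : cb1 (phi (pol h)).
  rewrite rmorph_sum; apply: cb1_sum => i _; rewrite rmorph_sum; apply: cb1_sum => j _.
  rewrite !rmorphM !rmorphXn hphi.1 phiX -exprM.
  by apply: cb1M; [exact: cb1_cst|apply: cb1M; [exact: cb1_Xn|exact: cb1X]].
pose rho : B := Fps (fun i => if (i < N)%N then R t i else 0).
have Rrho : WB N (R t - rho) by move=> i lt; rewrite fpsB /= lt subrr.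
have crho : cb1 rho by apply: (@cb1_finite _ _ N) => i le /=; rewrite ltnNge le.
have N1 : (1 < N)%N by rewrite /N; lia.
have rho0 : rho 0%N = 0 by rewrite /=; apply: (hR.2 _ _ (@ordB_X F)).
have rho1 : rho 1%N != 0 by rewrite /= N1.
have [Q [Q' [hQ QX cQ']]] := analytic_inverse1 crho rho0 rho1.
have [hQh _ _ _] := hQ.
have RQ w f : WB w.+1 f -> WB (w + N)%N (R f - Q f).
  move=> Wf; have -> : (w + N = w.+1 + N.-1)%N by rewrite /N; lia.
  apply: (hom_diff_raise (genB_generated F) hR hQh _ Wf) => k x [-> ->].
  by rewrite QX; apply: (flW (W := WB) _ Rrho); rewrite /N; lia.
have psiXo : WB 1 (psi vX) by apply: (flW (W := WB) n0); apply: ordB_leadX lpsi.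
have psiYo : WB 1 (psi vY) by apply: (flW (W := WB) m0); apply: ordB_leadY lpsi.
have WX : WB N (phi (pol (S vX)) - Q (psi vX)).
  have h1 := hphi.2 _ _ (fl_sym (W := WA) (polW (S vX))); rewrite rmorphB in h1.
  exact: (fl_trans (W := WB) (fl_trans (W := WB) h1 eX) (RQ 0%N _ psiXo)).
have WY : WB N (phi (pol (S vY)) - Q (psi vY)).
  have h1 := hphi.2 _ _ (fl_sym (W := WA) (polW (S vY))); rewrite rmorphB in h1.
  exact: (fl_trans (W := WB) (fl_trans (W := WB) h1 eY) (RQ 0%N _ psiYo)).
have cQ (z : B) : (exists K, forall k, (K <= k)%N -> z k = 0) -> cb1 (Q z).
  move=> [Kz zK]; have -> : z = \sum_(k < Kz) fps_cst (z k) * t ^+ k.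
    apply: fpsP => i; rewrite fps_sum; case: (ltnP i Kz) => [lt|le].
      rewrite (bigD1 (Ordinal lt)) //= fpsCM fpsXn eqxx mulr1 big1 ?addr0 // => k /eqP ne.
      by rewrite fpsCM fpsXn; case: eqP => [e|_]; rewrite ?mulr0 //; case: ne; apply: val_inj.
    rewrite zK // big1 // => k _; rewrite fpsCM fpsXn.
    by case: eqP => [e|_]; rewrite ?mulr0 //; move: le; rewrite e leqNgt ltn_ord.
  rewrite rmorph_sum; apply: cb1_sum => k _; rewrite rmorphM rmorphXn hQh.1 QX.
  by apply: cb1M; [exact: cb1_cst|exact: cb1X].
have cfX : cb1 (phi (pol (S vX)) - Q (psi vX)).
  apply: cb1D => //; apply/cb1N/cQ; exists n.+1 => k lt; rewrite psiX fpsXn.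
  by case: eqP lt => // ->; rewrite ltnn.
have cfY : cb1 (phi (pol (S vY)) - Q (psi vY)).
  by apply: cb1D => //; apply/cb1N/cQ; exists K.
have leN : (N0 <= N)%N by rewrite /N; lia.
have [h1 [ch1 Wh1 h1E]] := tailP _ cfX (flW (W := WB) leN WX).
have [h2 [ch2 Wh2 h2E]] := tailP _ cfY (flW (W := WB) leN WY).
pose s1 := pol (S vX) - h1; pose s2 := pol (S vY) - h2.
have Ws1 : WA n s1.
  apply: (flB WA); last by apply: (flW (W := WA) _ Wh1); rewrite ltnW // ltnW.
  apply: (fl_congr (W := WA) (b := S vX)); last exact: (hS.2 _ _ (@ordA_vX F n m)).
  by apply: (fl_sym (W := WA)); apply: (flW (W := WA) _ (polW _)); rewrite /N; lia.
have Ws2 : WA m s2.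
  apply: (flB WA); last by apply: (flW (W := WA) _ Wh2); rewrite ltnW.
  apply: (fl_congr (W := WA) (b := S vY)); last exact: (hS.2 _ _ (@ordA_vY F n m)).
  by apply: (fl_sym (W := WA)); apply: (flW (W := WA) _ (polW _)); rewrite /N; lia.
have [T [TX TY hT]] := subst2_ex (flW (W := WA) n0 Ws1) (flW (W := WA) m0 Ws2).
have {}hT : fhom WA WA T := hT _ _ Ws1 Ws2.
have phiTX : phi (T vX) = Q (psi vX) by rewrite TX rmorphB h1E; ring.
have phiTY : phi (T vY) = Q (psi vY) by rewrite TY rmorphB h2E; ring.
have lX := weight_nX Ws1; have lY := weight_mY Ws2.
have a0 : s1 1%N 0%N != 0.
  have [qn _] : hasord (Q (psi vX)) n.
    by apply/(hasord_aut _ _ hQ); rewrite psiX; split; [rewrite fpsXn eqxx oner_neq0|apply: ordB_Xn].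
  apply: contraNneq qn => a0; rewrite a0 rmorph0 mul0r subr0 in lX.
  by rewrite -phiTX TX (hphi.2 _ _ lX).
have d0 : s2 0%N 1%N != 0.
  have [qm _] : hasord (Q (psi vY)) m.
    apply/(hasord_aut _ _ hQ); split; last exact: ordB_leadY lpsi.
    by rewrite (leadY_coef lpsi) oner_neq0.
  apply: contraNneq qm => d0; rewrite d0 rmorph0 mul0r subr0 in lY.
  by rewrite -phiTY TY (hphi.2 _ _ lY).
rewrite -TX in lX a0; rewrite -TY in lY d0.
have [T' hTT'] := formal_inverse n0 nm hT a0 d0 lX lY.
have cs1 : cb2 (T vX) by rewrite TX; apply: cb2D => //; apply: cb2N.
have cs2 : cb2 (T vY) by rewrite TY; apply: cb2D => //; apply: cb2N.
have [ct1 ct2] := analytic_inverse n0 nm hTT' a0 d0 lX lY cs1 cs2.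
by exists T, T', Q, Q'; split=> //; rewrite ?QX.
Qed.

Hypothesis root_ex : forall (b : F) k, exists s, s ^+ k.+1 = b.

(** Finitely many reduction steps are made and the later coefficients of Y are set to 0. Finite
    determinacy makes the result equivalent to phi, and the sum in the normal form is finite by
    construction. *)
Theorem normal_form_exists :
  (exists psi, [/\ fhom WA WB psi, psi vX = t ^+ n, psi vY = t ^+ m & analytic_equiv phi psi]) \/
  (exists lam psi, [/\ (m < lam)%N /\ zariski n phi lam, fhom WA WB psi /\ psi vX = t ^+ n,
     normal_form n m lam (Lam phi) (psi vY),
     exists K, forall k, (K <= k)%N -> psi vY k = 0 & analytic_equiv phi psi]).
Proof.
have [N det] := finite_determinacy; have [hphi _ _] := lphi.
have WBXn k : WB k (t ^+ k) by apply: ordB_Xn.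
have target (z : B) : WB m.+1 (z - t ^+ m) -> exists psi : {rmorphism A -> B},
    [/\ lead psi, psi vX = t ^+ n & psi vY = z].
  move=> hz; have Wz : WB m z by apply: (fl_congr (W := WB) (flW (W := WB) (leqnSn _) hz)).
  have [psi [pX pY hpsi]] := subst2_ex (flW (W := WB) n0 (WBXn n)) (flW (W := WB) m0 Wz).
  exists psi; split=> //; split; rewrite ?pX ?pY //; first exact: hpsi.
  by rewrite subrr; exact: ordB_zero.
have ht : hasord t 1 by split; [rewrite /= oner_neq0|exact: ordB_X].
have [] := reduction nat0 n0 nm ndvd root_ex (N + c)%N lphi.
- move=> [psi0 [l0 [S [S' [R [R' [[hS _ _ _] hR E]]]]] X0 Y0]]; left.
  have [|psi [lpsi pX pY]] := target (t ^+ m); first by rewrite subrr; exact: ordB_zero.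
  have [hpsi _ _] := lpsi; have [hRh _ _ _] := hR.
  have [R1 _] := (hasord_aut t 1 hR).2 ht.
  exists psi; split=> //; apply: (det psi S R) => //.
  + by exists m.+1 => k lt; rewrite pY fpsXn; case: eqP lt => // ->; rewrite ltnn.
  + by rewrite E pX -rmorphB; apply: hRh.2; apply: (flW (W := WB) _ X0); lia.
  + by rewrite E pY -rmorphB; apply: hRh.2; apply: (flW (W := WB) _ Y0); lia.
- move=> [lam [psi0 [[lamN zar] l0 [S [S' [R [R' [[hS _ _ _] hR E]]]]] X0 Y0]]]; right.
  pose z : B := Fps (fun k => if (k < m + (N + c).+1)%N then psi0 vY k else 0).
  have zE : WB (m + (N + c).+1)%N (psi0 vY - z) by move=> i lt; rewrite fpsB /= lt subrr.
  have [|psi [lpsi pX pY]] := target z.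
    have [_ _ y0] := l0; apply: (fl_trans (W := WB) (fl_sym (W := WB) _) y0).
    by apply: (flW (W := WB) _ zE); lia.
  have [hpsi _ _] := lpsi; have [hRh _ _ _] := hR.
  have [R1 _] := (hasord_aut t 1 hR).2 ht.
  have zfin : exists K, forall k, (K <= k)%N -> psi vY k = 0.
    by exists (m + (N + c).+1)%N => k le; rewrite pY /= ltnNge le.
  exists lam, psi; split=> //.
  + by split=> //; case/andP: lamN.
  + move=> k nk; rewrite pY /=; case: ltnP => [lt|le]; first exact: Y0.
    by case: eqP => [|_]; [lia|case: eqP => [|_]; [lia|rewrite addr0]].
  + apply: (det psi S R) => //.
      by rewrite E pX -rmorphB; apply: hRh.2; apply: (flW (W := WB) _ X0); lia.
    by rewrite E pY -rmorphB; apply: hRh.2; apply: (flW (W := WB) _ zE); lia.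
Qed.
End Determinacy.
End AnalyticEquivalence.

(** * Transfer to convergent series over the complex numbers *)

Lemma prim_root_exists (F : numClosedFieldType) n : (0 < n)%N ->
  exists z : F, n.-primitive_root z.
Proof.
move=> n0; have [rs] := closed_field_poly_normal ('X^n - 1 : {poly F}).
rewrite (monicP (monicXnsubC 1 n0)) scale1r => XnE.
suff /hasP[z _ zP] : has n.-primitive_root rs by exists z.
apply: (has_prim_root n0).
- by apply/allP => z; rewrite -root_prod_XsubC -XnE.
- by rewrite -separable_prod_XsubC -XnE separable_Xn_sub_1 // pnatr_eq0 -lt0n.
- by have := size_prod_XsubC rs id; rewrite -XnE size_XnsubC // => -[<-].
Qed.

Section Transfer.
Notation C := (complex R).
Notation B := (fps C).
Notation A := (fps (fps C)).
Notation WB := (filtB C).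

Definition cx (z : Cplx) : C := Complex (fst z) (snd z).
Definition xc (z : C) : Cplx := let: Complex a b := z in (a, b).
Lemma cxK : cancel cx xc. Proof. by case. Qed.
Lemma xcK : cancel xc cx. Proof. by case. Qed.
Lemma cx_inj : injective cx. Proof. exact: can_inj cxK. Qed.
Lemma cxD z w : cx (Cadd z w) = cx z + cx w. Proof. by case: z w => [a b] [c d]. Qed.
Lemma cxM z w : cx (Cmul z w) = cx z * cx w.
Proof. by case: z w => [a b] [c d]. Qed.
Lemma cx_nat n : cx (Cnat n) = n%:R.
Proof. by rewrite /cx /= INRE -[n%:R in RHS](rmorph_nat (@real_complex R)). Qed.
Lemma cxX z n : cx (Cpow z n) = cx z ^+ n.
Proof. by elim: n => //= n IH; rewrite cxM IH exprS. Qed.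
Lemma cx_sum f n : cx (Csum f n) = \sum_(i < n) cx (f i).
Proof. by elim: n => [|n IH]; rewrite ?big_ord0 // big_ord_recr /= cxD IH. Qed.
Lemma cx_norm z : `|cx z| = (Cnorm z)%:C%C.
Proof. by rewrite normc_def /Cnorm RsqrtE !RmultE. Qed.

Lemma eqb_eqn a b : Nat.eqb a b = (a == b).
Proof. by apply/idP/eqP => [/Nat.eqb_eq|->] //; apply/Nat.eqb_eq. Qed.
Lemma ltb_ltn a b : Nat.ltb a b = (a < b)%N.
Proof. by apply/idP/idP => [/Nat.ltb_lt/ssrnat.ltP|/ssrnat.ltP/Nat.ltb_lt]. Qed.

Definition fs (s : ser) : B := Fps (fun n => cx (s n)).
Definition fs2 (h : ser2) : A := Fps (fun i => Fps (fun j => cx (h i j))).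
Definition sf (f : B) : ser := fun n => xc (f n).
Definition sf2 (h : A) : ser2 := fun i j => xc (h i j).

Lemma fsK f : fs (sf f) = f. Proof. by apply: fpsP => n; apply: xcK. Qed.
Lemma fs2K f : fs2 (sf2 f) = f. Proof. by apply: fpsP => i; apply: fpsP => j; apply: xcK. Qed.
Lemma fs_ext s s' : (forall n, s n = s' n) -> fs s = fs s'.
Proof. by move=> e; apply: fpsP => n /=; rewrite e. Qed.
Lemma fs_inj s s' : fs s = fs s' -> forall n, s n = s' n.
Proof. by move=> e n; apply: cx_inj; have := congr1 (fun f : B => f n) e. Qed.

Lemma fs_mono k : fs (mono k) = fpsX ^+ k.
Proof. by apply: fpsP => n; rewrite fpsXn /= /mono eqb_eqn; case: eqP. Qed.
Lemma fs_mul f g : fs (smul f g) = fs f * fs g.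
Proof.
apply: fpsP => n; rewrite fpsM [LHS]/= /smul cx_sum; apply: eq_bigr => i _.
by rewrite cxM.
Qed.
Lemma fs_pow f i : fs (spow f i) = fs f ^+ i.
Proof. by elim: i => [|i IH] /=; rewrite ?fs_mono // fs_mul IH exprS. Qed.
Lemma fs_deriv s : fs (Defs.deriv s) = fderiv (fs s).
Proof. by apply: fpsP => n; rewrite fderivE /= /Defs.deriv cxM cx_nat mulr_natl. Qed.
Lemma fs2_mono k l : fs2 (mono2 k l) = vX ^+ k * vY ^+ l.
Proof.
apply: fpsP => i; apply: fpsP => j; rewrite monA_coef /= /mono2 !eqb_eqn.
by case: eqP => _; case: eqP => _.
Qed.
Lemma fs2_mul f g : fs2 (smul2 f g) = fs2 f * fs2 g.
Proof.
apply: fpsP => a; apply: fpsP => b; rewrite fpsM2 [LHS]/= /smul2 cx_sum.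
by apply: eq_bigr => i _; rewrite cx_sum; apply: eq_bigr => j _; rewrite cxM.
Qed.
Lemma fs2_pow f i : fs2 (spow2 f i) = fs2 f ^+ i.
Proof. by elim: i => [|i IH] /=; rewrite ?fs2_mono ?mulr1 // fs2_mul IH exprS. Qed.

Lemma sum_shrink (V : zmodType) (a : nat -> V) N k : (k <= N)%N ->
  (forall i, (k <= i)%N -> a i = 0) -> \sum_(i < N) a i = \sum_(i < k) a i.
Proof.
move=> le a0; rewrite -(big_mkord xpredT a) -[RHS](big_mkord xpredT a).
rewrite (@big_cat_nat _ _ _ k) //= [X in _ + X]big_nat_cond [X in _ + X]big1 ?addr0 //.
by move=> i /andP[/andP[le' _] _]; apply: a0.
Qed.

(** [comp1] stops at i = n without loss, because [Q] maps series of order above n to series of order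
    above n. *)
Lemma fs_comp1 (Q : {rmorphism B -> B}) f r : fhom WB WB Q -> Q fpsX = fs r ->
  fs (comp1 f r) = Q (fs f).
Proof.
move=> hQ QX; apply: fpsP => n.
have low : WB n.+1 (fs f - \sum_(i < n.+1) fps_cst (fs f i) * fpsX ^+ i).
  move=> k lt; rewrite fpsB fps_sum (bigD1 (Ordinal lt)) //= fpsCM fpsXn eqxx mulr1.
  rewrite big1 ?addr0 ?subrr // => i /eqP ne; rewrite fpsCM fpsXn.
  by case: eqP => [e|_]; rewrite ?mulr0 //; case: ne; apply: val_inj.
have := hQ.2 _ _ low n (ltnSn n); rewrite rmorphB fpsB => /eqP; rewrite subr_eq0 => /eqP ->.
rewrite rmorph_sum fps_sum [LHS]/= /comp1 cx_sum; apply: eq_bigr => i _.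
by rewrite cxM rmorphM rmorphXn hQ.1 QX fpsCM -fs_pow.
Qed.

Lemma fs_pull (phi : {rmorphism A -> B}) p q h x y : (0 < p)%N -> (0 < q)%N ->
  fhom (filtA C p q) WB phi -> phi vX = fs x -> phi vY = fs y ->
  ordB 1 (fs x) -> ordB 1 (fs y) ->
  fs (pull h x y) = phi (fs2 h).
Proof.
move=> p0 q0 hphi pX pY x1 y1; apply: fpsP => n.
pose H := fs2 h.
have := hphi.2 _ _ (@ordA_trunc C p q p0 q0 n.+1 H) n (ltnSn n).
rewrite rmorphB fpsB => /eqP; rewrite subr_eq0 => /eqP ->.
rewrite rmorph_sum fps_sum [LHS]/= /pull cx_sum; apply: eq_bigr => i _.
rewrite rmorph_sum fps_sum cx_sum; apply: eq_bigr => j _.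
rewrite cxM !rmorphM !rmorphXn hphi.1 pX pY fpsCM -!fs_pow -fs_mul.
by [].
Qed.

(** [comp2] cuts off by total degree, the filtration by weight; the truncation N exceeds both
    bounds. Terms with i + j > a + b do not contribute at (a, b), as u and v have no constant
    term. *)
Lemma fs2_comp (S : {rmorphism A -> A}) p q p' q' h u v : (0 < p)%N -> (0 < q)%N ->
  fhom (filtA C p q) (filtA C p' q') S -> S vX = fs2 u -> S vY = fs2 v ->
  filtA C 1 1 1%N (fs2 u) -> filtA C 1 1 1%N (fs2 v) ->
  fs2 (comp2 h u v) = S (fs2 h).
Proof.
move=> p0 q0 hS SX SY u1 v1; apply: fpsP => a; apply: fpsP => b.
pose H := fs2 h; pose N := ((p' * a + q' * b).+1 + (a + b).+1)%N.
have := hS.2 _ _ (@ordA_trunc C p q p0 q0 N H) a b (leq_addr _ _).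
rewrite rmorphB !fpsB => /eqP; rewrite subr_eq0 => /eqP ->.
rewrite rmorph_sum !fps_sum.
have vanish i j : (a + b < i + j)%N -> (fs2 u ^+ i * fs2 v ^+ j) a b = 0.
  move=> lt; apply: (flM (filtA C 1 1) (flX i u1) (flX j v1)); rewrite !mul1n; lia.
have E i j : S (scA (H i j) * (vX ^+ i * vY ^+ j)) a b = H i j * (fs2 u ^+ i * fs2 v ^+ j) a b.
  by rewrite !rmorphM !rmorphXn hS.1 SX SY scAM.
rewrite (@sum_shrink _ (fun i => (S (\sum_(j < N) scA (H i j) * (vX ^+ i * vY ^+ j))) a b) N (a + b).+1).
- rewrite [LHS]/= /comp2 cx_sum; apply: eq_bigr => i _.
  rewrite rmorph_sum !fps_sum cx_sum.
  rewrite (@sum_shrink _ (fun j => (S (scA (H i j) * (vX ^+ i * vY ^+ j))) a b) N (a + b).+1).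
  + apply: eq_bigr => j _; rewrite E cxM -!fs2_pow -fs2_mul.
    by [].
  + by rewrite /N; lia.
  + by move=> j le; rewrite E vanish ?mulr0 //; lia.
- by rewrite /N; lia.
- move=> i le; rewrite rmorph_sum !fps_sum big1 // => j _.
  by rewrite E vanish ?mulr0 //; lia.
Qed.

Lemma Cnorm_le z (M : R) : Rle (Cnorm z) M <-> `|cx z| <= M%:C%C.
Proof. by rewrite cx_norm lecR; split=> /RleP. Qed.

Lemma real_of_pos (M : C) : 0 < M -> M = (complex.Re M)%:C%C.
Proof. by case: M => a b; rewrite ltcE /= => /andP[/eqP -> _]. Qed.

(** [conv1] and [conv2] put no sign on their constants, whereas [cb1] and [cb2] ask for positive
    ones. *)
Lemma conv_pos (M K : R) n : M * K ^+ n <= (1 + `|M|) * (1 + `|K|) ^+ n.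
Proof.
apply: (le_trans (ler_norm _)); rewrite normrM normrX; apply: ler_pM => //.
- exact: exprn_ge0.
- by rewrite lerDr ler01.
- by apply: lerXn2r; rewrite ?nnegrE ?lerDr ?ler01 // addr_ge0.
Qed.

Lemma conv1_cb s : conv1 s <-> cb1 (fs s).
Proof.
split=> [[M [K h]]|[M [K [M0 K0 h]]]].
  exists (1 + `|M|)%:C%C, (1 + `|K|)%:C%C; split; rewrite ?ltcR ?ltr_wpDr //.
  move=> i; rewrite -rmorphXn -rmorphM /=; apply/Cnorm_le/RleP.
  by apply: le_trans (conv_pos M K i); apply/RleP; rewrite -RpowE; apply: h.
exists (complex.Re M), (complex.Re K) => i; apply/Cnorm_le.
rewrite RmultE RpowE rmorphM rmorphXn /= -(real_of_pos M0) -(real_of_pos K0).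
exact: h.
Qed.
Lemma conv2_cb s : conv2 s <-> cb2 (fs2 s).
Proof.
split=> [[M [K h]]|[M [K [M0 K0 h]]]].
  exists (1 + `|M|)%:C%C, (1 + `|K|)%:C%C; split; rewrite ?ltcR ?ltr_wpDr //.
  move=> i j; rewrite -rmorphXn -rmorphM /=; apply/Cnorm_le/RleP.
  by apply: le_trans (conv_pos M K (i + j)); apply/RleP; rewrite -RpowE; apply: h.
exists (complex.Re M), (complex.Re K) => i j; apply/Cnorm_le.
rewrite RmultE RpowE rmorphM rmorphXn /= -(real_of_pos M0) -(real_of_pos K0).
exact: h.
Qed.

Lemma is_ord_hasord s n : is_ord s n <-> hasord (fs s) n.
Proof.
split=> [[s0 h]|[s0 h]].
  split; first by apply/eqP => e; apply: s0; apply: cx_inj.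
  by move=> i /ssrnat.ltP /h /= ->.
split; first by move=> e; case/eqP: s0; rewrite /= e.
by move=> k /ssrnat.ltP lt; apply: cx_inj; apply: (h k lt).
Qed.
End Transfer.

(** * Parametrizations as filtered morphisms *)

Section Main.
Notation C := (complex R).
Notation B := (fps C).
Notation A := (fps (fps C)).
Notation WB := (filtB C).
Variables n m : nat.
Hypotheses (n0 : (0 < n)%N) (nm : (n < m)%N).
Notation WA := (filtA C n m).
Notation t := (fpsX : B).
Let m0 : (0 < m)%N := ltn_trans n0 nm.
Let nat0 k : (0 < k)%N -> k%:R != 0 :> C.
Proof. by rewrite pnatr_eq0 -lt0n. Qed.

Definition represents (phi : param_t) (f : {rmorphism A -> B}) :=
  [/\ fhom WA WB f, f vX = fs (fst phi) & f vY = fs (snd phi)].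

Section Represented.
Variables (phi : param_t) (f : {rmorphism A -> B}).
Hypothesis rep : represents phi f.

Lemma rep_ordX : ordB 1 (fs (fst phi)).
Proof.
case: rep => hf <- _; apply: (flW (W := WB) n0); apply: hf.2; exact: ordA_vX.
Qed.
Lemma rep_ordY : ordB 1 (fs (snd phi)).
Proof.
case: rep => hf _ <-; apply: (flW (W := WB) m0); apply: hf.2; exact: ordA_vY.
Qed.

Lemma rep_pull h : fs (pull h (fst phi) (snd phi)) = f (fs2 h).
Proof.
case: rep => hf fX fY.
exact: (fs_pull h n0 m0 hf fX fY rep_ordX rep_ordY).
Qed.

Lemma trunc2_low N h : WB N (f h - f (trunc2 N h)).
Proof.
case: rep => hf _ _; rewrite -rmorphB; apply: hf.2; exact: ordA_trunc.
Qed.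

(** Truncating a formal h beyond order v leaves its value unchanged, so formal series give no more
    values than convergent ones. [Lam_in] rests on the same remark. *)
Lemma Gam_in v : in_Gamma phi v <-> Gam f v.
Proof.
split=> [[h [_ /is_ord_hasord]]|[h hh]]; first by rewrite rep_pull; exists (fs2 h).
exists (sf2 (trunc2 v.+1 h)); split; first by apply/conv2_cb; rewrite fs2K; apply: cb2_trunc2.
apply/is_ord_hasord; rewrite rep_pull fs2K.
by apply: (hasord_congr (l := v.+1) (ltnSn v) _ hh); apply: (fl_sym (W := WB)); apply: trunc2_low.
Qed.

Lemma form_ext h g : fs (fun k => Cadd (smul (pull h (fst phi) (snd phi)) (Defs.deriv (fst phi)) k)
     (smul (pull g (fst phi) (snd phi)) (Defs.deriv (snd phi)) k)) = pform f (fs2 h) (fs2 g).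
Proof.
case: rep => _ fX fY.
rewrite /pform fX fY -!fs_deriv -!rep_pull -!fs_mul; apply: fpsP => k.
by rewrite /= cxD.
Qed.

Lemma Lam_in v : in_Lambda phi v <-> Lam f v.
Proof.
split=> [[h [g [_ [_ [o [/is_ord_hasord ho ->]]]]]]|[h [g [o [ho ->]]]]].
  by rewrite form_ext in ho; exists (fs2 h), (fs2 g), o.
exists (sf2 (trunc2 o.+1 h)), (sf2 (trunc2 o.+1 g)).
split; first by apply/conv2_cb; rewrite fs2K; apply: cb2_trunc2.
split; first by apply/conv2_cb; rewrite fs2K; apply: cb2_trunc2.
exists o; split=> //; apply/is_ord_hasord; rewrite form_ext !fs2K.
apply: (hasord_congr (l := o.+1) (ltnSn o) _ ho).
have -> : pform f (trunc2 o.+1 h) (trunc2 o.+1 g) - pform f h g =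
   - ((f h - f (trunc2 o.+1 h)) * fderiv (f vX) + (f g - f (trunc2 o.+1 g)) * fderiv (f vY)).
  by rewrite /pform; ring.
by apply: (flN (W := WB)); apply: (flD (W := WB)); apply: (flMr (W := WB)); apply: trunc2_low.
Qed.

Lemma zariski_in lam : is_zariski phi n lam <-> zariski n f lam.
Proof.
split=> [[v [Lv [nG [vmin e]]]]|[L nG vmin]].
  have {}e : v = (lam + n)%N by rewrite -e.
  subst v; split; first by apply/Lam_in.
    by move/Gam_in.
  by move=> w /Lam_in Lw nGw; apply/ssrnat.leP; apply: vmin => // /Gam_in.
exists (lam + n)%N; split; first exact/Lam_in.
split; first by move/Gam_in.
by split=> // w /Lam_in Lw nGw; apply/ssrnat.leP; apply: vmin => // /Gam_in.
Qed.
End Represented.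

Lemma represents_ex (phi : param_t) : ordB n (fs (fst phi)) -> ordB m (fs (snd phi)) ->
  exists f, represents phi f.
Proof.
move=> hx hy; have [f [fX fY hf]] := subst2_ex (flW (W := WB) n0 hx) (flW (W := WB) m0 hy).
by exists f; split=> //; apply: hf.
Qed.

(** Needed to compare [f \o S] with [Q \o f'] when [S] is only filtered from the weights (1, 1). *)
Lemma fhom11 (f : {rmorphism A -> B}) phi : represents phi f -> fhom (filtA C 1 1) WB f.
Proof.
move=> rep; have hX := rep_ordX rep; have hY := rep_ordY rep; have [hf fX fY] := rep.
have [g [gX gY hg]] := subst2_ex (W := WB) hX hY.
have fg : f =1 g.
  apply: (hom_uniq (genA_generated C n0 m0) hf).
    by apply: hg; rewrite -?fX -?fY; apply: hf.2; [exact: ordA_vX|exact: ordA_vY].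
  by move=> k x [[_ ->]|[_ ->]]; rewrite ?gX ?gY.
have [g1 g2] := hg _ _ hX hY.
by split=> [c|k a Wa]; rewrite fg; [apply: g1|apply: g2].
Qed.

Lemma A_equiv_of_analytic phi phi' f f' : represents phi f -> represents phi' f' ->
  analytic_equiv n m f f' -> A_equiv phi phi'.
Proof.
move=> rep rep' [S [S' [Q [Q' [hS hQ [c1 c2 c3 c4] [cQ cQ'] [E1 E2]]]]]].
have [hf fX fY] := rep; have [hf' fX' fY'] := rep'.
have [hSh hSh' SK S'K] := hS; have [hQh hQh' QK Q'K] := hQ.
have const0 (T : {rmorphism A -> A}) : fhom WA WA T ->
    filtA C 1 1 1%N (T vX) /\ filtA C 1 1 1%N (T vY).
  move=> hT; split=> i j lt; have [-> ->] : i = 0%N /\ j = 0%N by split; lia.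
    by apply: (hT.2 _ _ (@ordA_vX C n m)); lia.
  by apply: (hT.2 _ _ (@ordA_vY C n m)); lia.
have [sX sY] := const0 _ hSh; have [sX' sY'] := const0 _ hSh'.
have zero (h : A) : filtA C 1 1 1%N h -> sf2 h 0%N 0%N = Czero.
  by move=> hh; apply: cx_inj; rewrite xcK hh.
have q0 (T : {rmorphism B -> B}) : fhom WB WB T -> sf (T t) 0%N = Czero.
  by move=> hT; apply: cx_inj; rewrite xcK (hT.2 _ _ (@ordB_X C)).
exists (sf2 (S vX)), (sf2 (S vY)), (sf (Q t)), (sf (Q' t)).
have compS (T T' : {rmorphism A -> A}) : fhom WA WA T -> fhom WA WA T' -> cancel T' T ->
    (forall a b, comp2 (sf2 (T' vX)) (sf2 (T vX)) (sf2 (T vY)) a b = mono2 1 0 a b) /\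
    (forall a b, comp2 (sf2 (T' vY)) (sf2 (T vX)) (sf2 (T vY)) a b = mono2 0 1 a b).
  move=> hT hT' TK; have [tX tY] := const0 _ hT.
  have E h : fs2 (comp2 (sf2 h) (sf2 (T vX)) (sf2 (T vY))) = T h.
    by rewrite (fs2_comp (S := T) _ n0 m0 hT) ?fs2K.
  by split=> a b; apply: cx_inj; [have := E (T' vX)|have := E (T' vY)]; rewrite TK;
    [have := fs2_mono 1 0|have := fs2_mono 0 1]; rewrite expr0 expr1 ?mulr1 ?mul1r => <-
    => /(congr1 (fun h : A => h a b)).
split.
  split; first by apply/conv2_cb; rewrite fs2K.
  split; first by apply/conv2_cb; rewrite fs2K.
  split; first exact: zero.
  split; first exact: zero.
  exists (sf2 (S' vX)), (sf2 (S' vY)).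
  split; first by apply/conv2_cb; rewrite fs2K.
  split; first by apply/conv2_cb; rewrite fs2K.
  split; first exact: zero.
  split; first exact: zero.
  have [e1 e2] := compS S' S hSh' hSh SK; have [e3 e4] := compS S S' hSh hSh' S'K.
  by split.
have compQ (T T' : {rmorphism B -> B}) : fhom WB WB T -> cancel T' T ->
    forall k, comp1 (sf (T' t)) (sf (T t)) k = mono 1 k.
  move=> hT TK; apply: fs_inj; rewrite (fs_comp1 (Q := T)) ?fsK // TK fs_mono.
  by rewrite expr1.
split.
  split; first by apply/conv1_cb; rewrite fsK.
  split; first by apply/conv1_cb; rewrite fsK.
  split; first exact: q0.
  split; first exact: q0.
  by split; apply: compQ.
(* The pull-back along the parametrization phi composed with the inverse of rho, as in [A_equiv]. *)
pose g : {rmorphism A -> B} := Q' \o f.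
have hg : fhom WA WB g := fhom_comp hf hQh'.
have repg : represents (comp1 (fst phi) (sf (Q' t)), comp1 (snd phi) (sf (Q' t))) g.
  by split=> //=; rewrite (fs_comp1 (Q := Q')) ?fsK // ?fX ?fY.
split; apply: fs_inj; rewrite (rep_pull repg) fs2K /g /=.
  by rewrite E1 QK fX'.
by rewrite E2 QK fY'.
Qed.

(** A priori sigma may contain monomials of weight below n or m, so [S] is filtered for these
    weights only under conditions, which [formal_uniqueness] establishes. *)
Lemma homs_of_A_equiv phi phi' f f' : represents phi f -> represents phi' f' ->
  A_equiv phi phi' -> exists (S : {rmorphism A -> A}) (Q : {rmorphism B -> B}),
  [/\ (S vX) 0%N 0%N = 0 /\ (S vY) 0%N 0%N = 0,
      WA n (S vX) -> WA m (S vY) -> fhom WA WA S, fhom WB WB Q, Q t 1%N != 0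
    & forall h, f (S h) = Q (f' h)].
Proof.
move=> rep rep' [s1 [s2 [rho [rhoi [[_ [_ [s10 [s20 _]]]] [[_ [_ [r0 [ri0 [rr1 rr2]]]]] [E1 E2]]]]]]].
have [hf fX fY] := rep; have [hf' fX' fY'] := rep'.
have low (s : ser2) p q : (0 < p)%N -> (0 < q)%N -> s 0%N 0%N = Czero -> filtA C p q 1%N (fs2 s).
  by move=> p0 q0 s0 i j lt; have [-> ->] : i = 0%N /\ j = 0%N by [split; nia]; rewrite /= s0.
have [S [SX SY hS]] := subst2_ex (low _ _ _ n0 m0 s10) (low _ _ _ n0 m0 s20).
have lowB (s : ser) : s 0%N = Czero -> WB 1 (fs s) by move=> s0 [|//] _; rewrite /= s0.
have [Q [hQ QX]] := subst1_ex (lowB _ r0); have [Q' [hQ' QX']] := subst1_ex (lowB _ ri0).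
have QQ' : (Q \o Q') =1 idfun.
  apply: (hom_uniq (genB_generated C) (f := Q \o Q') (g := idfun) (fhom_comp hQ' hQ) (fhom_id WB)).
  move=> k x [_ ->] /=; rewrite QX' -(@fs_comp1 Q rhoi rho hQ QX) (fs_ext rr2) fs_mono.
  by rewrite expr1.
have Q'Q : (Q' \o Q) =1 idfun.
  apply: (hom_uniq (genB_generated C) (f := Q' \o Q) (g := idfun) (fhom_comp hQ hQ') (fhom_id WB)).
  move=> k x [_ ->] /=; rewrite QX -(@fs_comp1 Q' rho rhoi hQ' QX') (fs_ext rr1) fs_mono.
  by rewrite expr1.
have hQQ : faut WB Q Q' by [].
exists S, Q; split=> //.
- by split; rewrite ?SX ?SY /= ?s10 ?s20.
- by rewrite SX SY; apply: hS.
- have ht : hasord t 1 by split; [rewrite /= oner_neq0|exact: ordB_X].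
  by have [] := (hasord_aut t 1 hQQ).2 ht.
pose g : {rmorphism A -> B} := Q' \o f.
have repg : represents (comp1 (fst phi) rhoi, comp1 (snd phi) rhoi) g.
  by split=> /=; [exact: (fhom_comp hf hQ')| |]; rewrite (fs_comp1 (Q := Q')) // ?fX ?fY.
have X1 : f' vX = Q' (f (fs2 s1)) by rewrite fX' (fs_ext E1) (rep_pull repg).
have Y1 : f' vY = Q' (f (fs2 s2)) by rewrite fY' (fs_ext E2) (rep_pull repg).
have hS11 : fhom (filtA C 1 1) WA S.
  by apply: hS; apply: low.
apply: (hom_uniq (genA_generated C (isT : 0 < 1)%N (isT : 0 < 1)%N) (f := f \o S) (g := Q \o f')).
- exact: (fhom_comp hS11 hf).
- exact: (fhom_comp (fhom11 rep') hQ).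
- by move=> k x [[_ ->]|[_ ->]] /=; rewrite ?SX ?SY ?X1 ?Y1 [RHS](QQ' _).
Qed.

Lemma homothety_equiv phi phi' f f' r : represents phi f -> represents phi' f' ->
  f vX = t ^+ n -> f' vX = t ^+ n -> r != 0 ->
  (forall k, r ^+ m * f vY k = r ^+ k * f' vY k) -> A_equiv phi phi'.
Proof.
move=> rep rep' fX fX' r0 E; apply: (A_equiv_of_analytic rep rep').
have [hf _ _] := rep.
have [S [S' [hS SX SY SX' SY']]] := scaleA_faut n0 nm (expf_neq0 n r0) (expf_neq0 m r0).
have cb s : cb1 (fps_cst s * t : B).
  by apply: cb1M; [exact: cb1_cst|exact: (cb1_Xn _ 1)].
have cb2c (i j : nat) s : cb2 (scA s * (vX ^+ i * vY ^+ j) : A).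
  apply: (@cb2_finite _ _ (i + j).+1) => i' j'; rewrite scAM monA_coef.
  by case: eqP => [->|_]; case: eqP => [->|_]; rewrite ?mulr0 // => /orP[]; lia.
have cbX s : cb2 (scA s * vX : A) by have := cb2c 1%N 0%N s; rewrite expr1 mulr1.
have cbY s : cb2 (scA s * vY : A) by have := cb2c 0%N 1%N s; rewrite expr1 mul1r.
exists S, S', (fps_scale r), (fps_scale r^-1); split=> //.
- split; [exact: (@fps_scale_fhom C r)|exact: (@fps_scale_fhom C r^-1)|exact: fps_scaleK|].
  exact: fps_scaleVK.
- by rewrite SX SY SX' SY'; split.
- by have h1 := cb r; have h2 := cb r^-1; rewrite -!fps_scale_X in h1 h2.
- rewrite SX SY !rmorphM !hf.1 fX fX'; split; apply: fpsP => k; rewrite fpsCM /=.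
    by rewrite fpsXn; case: eqP => [->|_]; rewrite ?mulr0.
  exact: E.
Qed.
End Main.

(** * The two halves of the theorem *)

Section Assembly.
Notation C := (complex R).
Notation B := (fps C).
Notation A := (fps (fps C)).
Notation WB := (filtB C).
Notation t := (fpsX : B).

Lemma semigroup_generators Gamma v0 v1 : is_v0 Gamma v0 -> is_v1 Gamma v0 v1 ->
  [/\ (0 < v0)%N, (v0 < v1)%N & ~~ (v0 %| v1)%N].
Proof.
move=> [_ [/ssrnat.ltP p0 hmin]] [G1 [hmod _]].
have nd : ~~ (v0 %| v1)%N.
  apply/negP => /dvdnP[k e]; apply: hmod; rewrite e.
  by apply: Nat.Div0.mod_mul.
split=> //; have v1p : (0 < v1)%N by case: v1 nd {G1 hmod} => //; rewrite dvdn0.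
rewrite ltn_neqAle; apply/andP; split; first by apply: contraNneq nd => ->.
by apply/ssrnat.leP; apply: hmin => //; apply/ssrnat.ltP.
Qed.

Variables (n m : nat).
Hypotheses (n0 : (0 < n)%N) (nm : (n < m)%N) (ndvd : ~~ (n %| m)%N).
Let m0 : (0 < m)%N := ltn_trans n0 nm.
Let nat0 k : (0 < k)%N -> k%:R != 0 :> C.
Proof. by rewrite pnatr_eq0 -lt0n. Qed.

Lemma represents_lead phi : (forall k, fst phi k = mono n k) ->
  ordB m.+1 (fs (snd phi) - t ^+ m) ->
  exists f, [/\ represents n m phi f, lead n m f & f vX = t ^+ n].
Proof.
move=> fX sY; have eX : fs (fst phi) = t ^+ n by rewrite (fs_ext fX) fs_mono.
have hX : ordB n (fs (fst phi)) by rewrite eX; apply: ordB_Xn.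
have hY : ordB m (fs (snd phi)).
  apply: (fl_congr (W := WB) (flW (W := WB) (leqnSn m) sY)); exact: ordB_Xn.
have [f rep] := represents_ex n0 nm hX hY; have [hf f1 f2] := rep.
exists f; split; rewrite ?f1 //; split; rewrite ?f1 ?f2 //.
by rewrite eX subrr; apply: ordB_zero.
Qed.

Lemma normal_form_coef lam L a phi : (m < lam)%N -> is_normal_form n m lam L a phi ->
  normal_form n m lam L (fs (snd phi)) /\
  forall k, (lam < k)%N -> ~ L (k + n)%N -> fs (snd phi) k = cx (a k).
Proof.
have monoE k j : cx (mono k j) = (j == k)%:R by rewrite /mono eqb_eqn; case: eqP.
move=> ml [_ [h1 h2]]; split=> [k nk|k lt nL] /=.
  rewrite h2; first by rewrite cxD !monoE.
  by case=> /ssrnat.ltP lt nL; apply: nk.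
rewrite h1; last by split=> //; apply/ssrnat.ltP.
by rewrite !cxD !monoE; case: eqP => [|_]; [lia|case: eqP => [|_]; [lia|rewrite !add0r]].
Qed.

Lemma normal_form_ordY lam L y : (m < lam)%N -> normal_form n m lam L y ->
  ordB m.+1 (y - t ^+ m : B).
Proof.
move=> ml nf k lt; rewrite fpsB fpsXn nf; last by case; lia.
by case: (eqVneq k lam) => [e|_]; [lia|rewrite addr0 subrr].
Qed.

Lemma reduction_to_normal_form (Gamma : nat -> Prop) c phi :
  is_conductor Gamma c -> in_Sigma Gamma n m c phi ->
  A_equiv phi (mono n, mono m) \/
  ((exists v, in_Lambda phi v /\ ~ Gamma v) /\
   exists lam a psi, is_zariski phi n lam /\
     (exists N, forall i, le N i -> a i = Czero) /\
     is_normal_form n m lam (in_Lambda phi) a psi /\ A_equiv phi psi).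
Proof.
move=> [cond _] [[prim GE] [a [fX sY]]].
have yE k : fs (snd phi) k = if k == m then 1 else
    if (m < k)%N && (k < c)%N then cx (a k) else 0.
  by rewrite /= sY eqb_eqn !ltb_ltn; case: eqP => // _; case: ifP.
have hy : ordB m.+1 (fs (snd phi) - t ^+ m).
  move=> k lt; rewrite fpsB fpsXn yE; case: eqP => [_|_]; first by rewrite subrr.
  by rewrite ltnNge -ltnS lt subrr.
have [f [rep lf fX']] := represents_lead fX hy; have [hf f1 f2] := rep.
have cy : cb1 (f vY) by rewrite f2; apply/conv1_cb; case: prim => -[_ [_ [_ [] //]]].
have condG l : (c <= l)%N -> Gam f l.
  by move=> le; apply/(Gam_in n0 nm rep)/GE/cond/ssrnat.leP.
have [zeta zetaP] := @prim_root_exists C n n0.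
have root_ex (b : C) k : exists s, s ^+ k.+1 = b by exists (k.+1.-root b); rewrite rootCK.
case: (normal_form_exists n0 nm ndvd zetaP lf fX' cy condG root_ex).
  move=> [psi [hpsi pX pY eq]]; left.
  have rep' : represents n m (mono n, mono m) psi by split; rewrite //= fs_mono.
  exact: (A_equiv_of_analytic n0 nm rep rep' eq).
move=> [lam [psi [[ml zar] [hpsi pX] nf [K zK] eq]]]; right.
have Lin := Lam_in n0 nm rep; have Gin := Gam_in n0 nm rep.
split.
  have [L nG _] := zar; exists (lam + n)%N; split; first exact/Lin.
  by move=> /GE /Gin.
pose phi' : param_t := (mono n, sf (psi vY)).
have rep' : represents n m phi' psi by split; rewrite //= ?fs_mono ?fsK.
exists lam, (fun i => if asbool ((lam < i)%N /\ ~ in_Lambda phi (i + n)%N)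
  then snd phi' i else Czero), phi'.
split; first exact/(zariski_in n0 nm rep).
split.
  exists K => i /ssrnat.leP le; case: asboolP => // _; apply: cx_inj.
  by rewrite /= xcK zK.
split; last exact: (A_equiv_of_analytic n0 nm rep rep' eq).
have monoE k j : cx (mono k j) = (j == k)%:R by rewrite /mono eqb_eqn; case: eqP.
split=> //; split=> k hk; apply: cx_inj.
  rewrite !cxD !monoE; have {}hk : (lam < k)%N /\ ~ in_Lambda phi (k + n)%N.
    by case: hk => /ssrnat.ltP lt nL.
  have lt := hk.1; rewrite (asboolT hk).
  by case: eqP => [|_]; [lia|case: eqP => [|_]; [lia|rewrite !add0r]].
rewrite cxD !monoE /= xcK; apply: nf => -[lt nL]; apply: hk; split; first exact/ssrnat.ltP.
by move/Lin.
Qed.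

Lemma normal_form_uniqueness (Gamma L : nat -> Prop) lam a a' phi phi' :
  has_semigroup phi Gamma -> has_semigroup phi' Gamma ->
  (forall v, L v <-> in_Lambda phi v) ->
  is_zariski phi n lam ->
  is_normal_form n m lam L a phi -> is_normal_form n m lam L a' phi' ->
  (A_equiv phi phi' <->
   exists r : Cplx, r <> Czero /\ Cpow r (lam - m) = Cone /\
     forall i, lt lam i -> ~ L (i + n)%N -> a i = Cmul (Cpow r (i - m)) (a' i)).
Proof.
move=> [prim GE] [prim' _] LE zar nf nf'.
have eX : fs (fst phi) = t ^+ n by case: nf => e _; rewrite (fs_ext e) fs_mono.
have ml : (m < lam)%N.
  have x1 : WB 1 (fs (fst phi)).
    by rewrite eX; apply: (flW (W := WB) n0); apply: ordB_Xn.
  have y1 : WB 1 (fs (snd phi)) by case: prim => -[_ [y0 _]] _ [|//] _; rewrite /= y0.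
  have [g [gX gY hg]] := subst2_ex x1 y1.
  have hg1 : fhom (filtA C 1 1) WB g by apply: hg.
  have Gg v : Gam g v -> in_Gamma phi v.
    move=> [h hh]; exists (sf2 (trunc2 v.+1 h)); split.
      by apply/conv2_cb; rewrite fs2K; apply: cb2_trunc2.
    apply/is_ord_hasord; rewrite (fs_pull _ (isT : 0 < 1)%N (isT : 0 < 1)%N hg1 gX gY x1 y1) fs2K.
    apply: (hasord_congr (l := v.+1) (ltnSn v) _ hh); apply: (fl_sym (W := WB)).
    by rewrite -rmorphB; apply: hg1.2; apply: ordA_trunc.
  have [v [_ [nG [_ e]]]] := zar.
  apply: (lam_gt nat0 n0 nm (phi := g) (lam := lam) (L := L)).
  - by rewrite gX.
  - rewrite gY => k nk; case: nf => _ [_ h2] /=; rewrite h2; last first.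
      by case=> /ssrnat.ltP lt nL; apply: nk.
    by rewrite cxD /mono !eqb_eqn; case: eqP => _; case: eqP.
  - by move=> /Gg gG; apply: nG; rewrite -e; exact: gG.
have [nfy ya] := normal_form_coef ml nf; have [nfy' ya'] := normal_form_coef ml nf'.
have [f [rep lf fX]] := represents_lead (proj1 nf) (normal_form_ordY ml nfy).
have [f' [rep' lf' fX']] := represents_lead (proj1 nf') (normal_form_ordY ml nfy').
have [_ _ fY] := rep; have [_ _ fY'] := rep'.
split=> [eq|[r [r0 [r1 ar]]]].
  have [S [Q [[S1 S2] hS hQ Q1 E]]] := homs_of_A_equiv n0 nm rep rep' eq.
  have LL v : L v <-> Lam f v by rewrite LE; apply: (Lam_in n0 nm rep).
  have nG : ~ Gam f (lam + n)%N by case/(zariski_in n0 nm rep): zar.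
  rewrite -fY in nfy; rewrite -fY' in nfy'.
  have [r [r0 r1 hr]] := formal_uniqueness nat0 n0 nm ndvd lf lf' fX fX' nfy nfy' LL nG S1 S2 hS hQ Q1 E.
  exists (xc r); split; first by move=> e; case/eqP: r0; rewrite -[r]xcK e.
  split; first by apply: cx_inj; rewrite cxX xcK.
  move=> i /ssrnat.ltP lt nL; apply: cx_inj; rewrite cxM cxX xcK.
  by rewrite -ya // -ya' // -fY -fY' hr.
have r0' : cx r != 0 by apply/eqP => e; apply: r0; apply: cx_inj.
(* For the converse, the homothety of ratio r is an equivalence; r^(lambda - m) = 1 makes it keep
   the term t^lambda. *)
apply: (homothety_equiv n0 nm rep rep' fX fX' r0') => k; rewrite fY fY'.
have r1' : cx r ^+ (lam - m) = 1 by rewrite -cxX r1.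
case: (pselect ((lam < k)%N /\ ~ L (k + n)%N)) => [[lt nL]|nk].
  rewrite ya // ya' // ar //; last exact/ssrnat.ltP.
  by rewrite cxM cxX mulrA -exprD subnKC // ltnW // (ltn_trans ml).
rewrite nfy // nfy' //; case: (eqVneq k m) => [->|_] //.
case: (eqVneq k lam) => [->|_]; last by rewrite addr0 !mulr0.
by rewrite -[in RHS](subnKC (ltnW ml)) exprD r1' mulr1.
Qed.
End Assembly.

End PlaneBranches.

Theorem theorem2p1 (Gamma : nat -> Prop) (v0 v1 c : nat)
  (hGamma : branch_semigroup Gamma) (hv0 : is_v0 Gamma v0)
  (hv1 : is_v1 Gamma v0 v1) (hc : is_conductor Gamma c) :
  (forall phi : param_t, in_Sigma Gamma v0 v1 c phi ->
     A_equiv phi (mono v0, mono v1) \/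
     ((exists m, in_Lambda phi m /\ ~ Gamma m) /\
      exists (lam : nat) (a : ser) (psi : param_t),
        is_zariski phi v0 lam /\
        (exists N, forall i, (N <= i)%nat -> a i = Czero) /\
        is_normal_form v0 v1 lam (in_Lambda phi) a psi /\
        A_equiv phi psi)) /\
  (forall (Lam : nat -> Prop) (lam : nat) (a a' : ser) (phi phi' : param_t),
     has_semigroup phi Gamma -> has_semigroup phi' Gamma ->
     (forall v, Lam v <-> in_Lambda phi v) ->
     (forall v, Lam v <-> in_Lambda phi' v) ->
     is_zariski phi v0 lam ->
     is_normal_form v0 v1 lam Lam a phi ->
     is_normal_form v0 v1 lam Lam a' phi' ->
     (A_equiv phi phi' <->
      exists r : Cplx, r <> Czero /\ Cpow r (lam - v1) = Cone /\
        forall i, (lam < i)%nat -> ~ Lam (i + v0)%nat ->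
          a i = Cmul (Cpow r (i - v1)) (a' i))).
Proof.
destruct (PlaneBranches.semigroup_generators hv0 hv1) as [n0 nm ndvd].
split.
- intros phi hphi.
  exact (PlaneBranches.reduction_to_normal_form n0 nm ndvd hc hphi).
- intros Lam lam a a' phi phi' hG hG' hL hL' hz hn hn'.
  exact (PlaneBranches.normal_form_uniqueness n0 nm ndvd hG hG' hL hz hn hn').
Qed.
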